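(* Let $\Delta_w$ be the canonical pencil corresponding to an odd long bracket (of weight zero) on $M$. If the long bracket satisfies the Jacobi identity, then $$\Delta_w^2=\mathcal L_X\qquad\text{for all }w,$$ where $X$ is a Poisson vector field on $M$ (with respect to the odd bracket of functions) and $\mathcal L_X$ stands for the Lie derivative on $w$-densities.
   Context: Let $M$ be a supermanifold with local coordinates $x^a$ of parity $\tilde a$; $\partial_a=\partial/\partial x^a$; all Jacobians (Berezinians) of the atlas are positive. The algebra of densities $\mathfrak V(M)$ consists of finite formal sums of densities $\psi(x)(Dx)^w$ of arbitrary real weights with tensor multiplication; densities are identified with functions on $\hat M=(\operatorname{Ber}TM)\setminus M$ with local coordinates $x^a,t$, where $t$ corresponds to $Dx$. An odd long bracket of weight $0$ is an odd symmetric bi-derivation of $\mathfrak V(M)$ preserving the total weight; in local coordinates $$\{\boldsymbol\psi;\boldsymbol\chi\}=S^{ab}\tfrac{\partial\boldsymbol\psi}{\partial x^b}\tfrac{\partial\boldsymbol\chi}{\partial x^a}(-1)^{\tilde a\tilde\psi}+t\gamma^a\bigl(\tfrac{\partial\boldsymbol\psi}{\partial x^a}\tfrac{\partial\boldsymbol\chi}{\partial t}+(-1)^{\tilde a\tilde\psi}\tfrac{\partial\boldsymbol\psi}{\partial t}\tfrac{\partial\boldsymbol\chi}{\partial x^a}\bigr)+t^2\theta\,\tfrac{\partial\boldsymbol\psi}{\partial t}\tfrac{\partial\boldsymbol\chi}{\partial t},$$ with $S^{ab}=(-1)^{\tilde a\tilde b}S^{ba}$, $\gamma^a$, $\theta$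 functions of $x$. On functions it restricts to $\{f,g\}=S^{ab}\partial_bf\,\partial_ag(-1)^{\tilde a\tilde f}$. Its Jacobi identity is $$(-1)^{\tilde a\tilde c}\{\{a;b\};c\}+(-1)^{\tilde c\tilde b}\{\{c;a\};b\}+(-1)^{\tilde b\tilde a}\{\{b;c\};a\}=0\quad\text{for all }a,b,c\in\mathfrak V(M).$$ The corresponding canonical pencil is the family of odd operators on $w$-densities $$\Delta_w=\tfrac12\Bigl(S^{ab}\partial_b\partial_a+\bigl(\partial_bS^{ba}+(2w-1)\gamma^a\bigr)\partial_a+w\,\partial_a\gamma^a+w(w-1)\theta\Bigr).$$ An even vector field $X$ on $M$ is Poisson if $X\{f,g\}=\{Xf,g\}+\{f,Xg\}$ for all functions $f,g$. *)

(* Defs.v *)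
From HB Require Import structures.
From mathcomp Require Import all_boot all_order all_algebra.

Set Implicit Arguments.
Unset Strict Implicit.
Unset Printing Implicit Defensive.

Import Order.TTheory GRing.Theory Num.Theory.
Local Open Scope ring_scope.

(* Grassmann algebra on q odd generators:
   [u A] is the coefficient of the product of the generators xi_l, l in A,
   taken in increasing order. *)

Definition grassmann (R : comNzRingType) (q : nat) : Type :=
  {ffun {set 'I_q} -> R^o}.

HB.instance Definition _ (R : comNzRingType) (q : nat) :=
  GRing.Lmodule.copy (grassmann R q) {ffun {set 'I_q} -> R^o}.

Section GrassmannRing.
Variables (R : comNzRingType) (q : nat).
Implicit Types (A B C : {set 'I_q}) (u v w : grassmann R q).

(* xi^A xi^B = (-1)^(ninv A B) xi^(A :|: B) for disjoint A and B *)
Definition ninv A B : nat := (\sum_(i in A) \sum_(j in B) (j < i)%N)%N.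

Definition gmul u v : grassmann R q :=
  [ffun C : {set 'I_q} => \sum_(A : {set 'I_q} | A \subset C)
               (-1) ^+ ninv A (C :\: A) * (u A * v (C :\: A))].

Definition gone : grassmann R q := [ffun A : {set 'I_q} => (A == set0)%:R].

Lemma ninvUl A B C : [disjoint A & B] ->
  ninv (A :|: B) C = (ninv A C + ninv B C)%N.
Proof.
by move=> dAB; rewrite /ninv -bigU //=; apply: eq_bigl => i; rewrite !inE.
Qed.

Lemma ninvUr A B C : [disjoint B & C] ->
  ninv A (B :|: C) = (ninv A B + ninv A C)%N.
Proof.
move=> dBC; rewrite /ninv -big_split; apply: eq_bigr => i _ /=.
by rewrite -bigU //=; apply: eq_bigl => j; rewrite !inE.
Qed.

Lemma gmulA : associative gmul.
Proof.
move=> u v w; apply/esym/ffunP => E; rewrite !ffunE.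
under eq_bigr => A AE.
  rewrite ffunE mulr_suml mulr_sumr.
  over.
under [RHS]eq_bigr => D DE.
  rewrite ffunE mulr_sumr mulr_sumr.
  over.
rewrite (exchange_big_dep (fun A : {set 'I_q} => A \subset E)) /=; last first.
  by move=> D A DE AD; exact: subset_trans AD DE.
apply: eq_bigr => A AE.
rewrite (reindex_onto (fun B => A :|: B) (fun D => D :\: A)) /=; last first.
  by move=> D /andP[DE AD]; rewrite setDE setUIr setUCr setIT; apply/setUidPr.
have P B : (B \subset E :\: A) =
    ((A :|: B \subset E) && (A \subset A :|: B)) && ((A :|: B) :\: A == B).
  rewrite subsetUl andbT subUset AE /= setDUl setDv set0U subsetD.
  by rewrite (sameP eqP setDidPl) .
apply: eq_big => [B|B]; first by rewrite P.
rewrite -P subsetD => /andP[BE dBA].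
have dAB : [disjoint A & B] by rewrite disjoint_sym.
have -> : (A :|: B) :\: A = B.
  by rewrite setDUl setDv set0U; apply/setDidPl.
have -> : E :\: (A :|: B) = E :\: A :\: B by rewrite setDDl.
have BEA : B \subset E :\: A by rewrite subsetD BE dBA.
have eEA : E :\: A = B :|: (E :\: A :\: B).
  by rewrite -{1}(setID (E :\: A) B) (setIidPr BEA).
have d1 : [disjoint B & E :\: A :\: B].
  by rewrite disjoints_subset setDE setCI setCK subsetUr.
have -> : ninv A (E :\: A) = (ninv A B + ninv A (E :\: A :\: B))%N.
  by rewrite {1}eEA ninvUr.
rewrite ninvUl // !exprD -!mulrA [RHS]mulrCA; congr (_ * _).
rewrite [LHS]mulrCA [RHS]mulrCA [LHS]mulrCA.
by rewrite [LHS]mulrCA [RHS]mulrCA; congr (_ * _); rewrite mulrCA.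
Qed.

Lemma gmul1 : left_id gone gmul.
Proof.
move=> u; apply/ffunP => C; rewrite ffunE (bigD1 set0) ?sub0set //= big1 ?addr0.
  by rewrite /ninv big_set0 expr0 mul1r ffunE eqxx mul1r setD0.
by move=> A /andP[_ /negbTE A0]; rewrite ffunE A0 mul0r mulr0.
Qed.

Lemma gmulr1 : right_id gone gmul.
Proof.
move=> u; apply/ffunP => C; rewrite ffunE (bigD1 C) //= big1 ?addr0.
  rewrite setDv ffunE eqxx mulr1 /ninv big1 ?mul1r // => i _.
  by rewrite big_set0.
move=> A /andP[AC /negP AC']; rewrite ffunE (_ : _ == _ = false) ?mulr0 //.
by apply/negbTE/negP; rewrite setD_eq0 => CA; apply: AC'; rewrite eqEsubset AC.
Qed.

Lemma gmulDl : left_distributive gmul +%R.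
Proof.
move=> u v w; apply/ffunP => C; rewrite !ffunE -big_split /=.
by apply: eq_bigr => A _; rewrite ffunE mulrDl mulrDr.
Qed.

Lemma gmulDr : right_distributive gmul +%R.
Proof.
move=> u v w; apply/ffunP => C; rewrite !ffunE -big_split /=.
by apply: eq_bigr => A _; rewrite ffunE mulrDr mulrDr.
Qed.

Lemma gone_neq0 : gone != 0.
Proof. by apply/eqP => /ffunP/(_ set0)/eqP; rewrite !ffunE eqxx oner_eq0. Qed.

HB.instance Definition _ := GRing.Zmodule_isNzRing.Build (grassmann R q)
  gmulA gmul1 gmulr1 gmulDl gmulDr gone_neq0.

Lemma gscaleAl (k : R) u v : k *: gmul u v = gmul (k *: u) v.
Proof.
apply/ffunP => C; rewrite !ffunE scaler_sumr; apply: eq_bigr => A _.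
by rewrite ffunE /GRing.scale /= mulrCA -mulrA.
Qed.

HB.instance Definition _ :=
  GRing.Lmodule_isLalgebra.Build R (grassmann R q) gscaleAl.

Lemma gscaleAr (k : R) u v : k *: gmul u v = gmul u (k *: v).
Proof.
apply/ffunP => C; rewrite !ffunE scaler_sumr; apply: eq_bigr => A _.
by rewrite ffunE /GRing.scale /= mulrCA; congr (_ * _); rewrite mulrCA.
Qed.

HB.instance Definition _ :=
  GRing.Lalgebra_isAlgebra.Build R (grassmann R q) gscaleAr.

Definition ggen (l : 'I_q) : grassmann R q := [ffun A : {set 'I_q} => (A == [set l])%:R].

Definition gbody u : R := u set0.

Definition has_parity (b : bool) u : Prop := forall A, odd #|A| != b -> u A = 0.

(* the linear extension of u |-> (-1)^(b * parity of u) u *)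
Definition gsign (b : bool) u : grassmann R q :=
  [ffun A : {set 'I_q} => (-1) ^+ (b && odd #|A|) * u A].

(* left derivative with respect to xi_l *)
Definition gderiv (l : 'I_q) u : grassmann R q :=
  [ffun A : {set 'I_q} => if l \in A then 0
     else (-1) ^+ #|[set j in A | (j < l)%N]| * u (l |: A)].

End GrassmannRing.

From mathcomp Require Import all_classical all_reals all_analysis.
Import numFieldNormedType.Exports.
Local Open Scope classical_set_scope.

(* The real power of an even element of positive body, by the (finite) binomial
   series in its nilpotent part. *)
Definition gpow (R : realType) (q : nat) (w : R) (u : grassmann R q) :
    grassmann R q :=
  \sum_(k < q.+1)
    ((\prod_(j < k) (w - j%:R)) / k`!%:R * (gbody u) `^ (w - k%:R)) *:
      (u - (gbody u)%:A) ^+ k.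

(* inl: even coordinates, inr: odd coordinates *)
Definition crd (p q : nat) : finType := ('I_p + 'I_q)%type.

Definition par (p q : nat) (a : crd p q) : bool := if a is inr _ then true else false.

Definition superfun (R : realType) (p q : nat) : Type := 'rV[R]_p -> grassmann R q.

Section Superfunctions.
Variables (R : realType) (p q : nat).

Definition partial (k : 'I_p) (g : 'rV[R]_p -> R) : 'rV[R]_p -> R :=
  fun x => 'D_(delta_mx 0 k) g x.

Definition smooth_on (U : set 'rV[R]_p) (g : 'rV[R]_p -> R) : Prop :=
  forall (s : seq 'I_p) x, U x -> differentiable (foldr partial g s) x.

Definition ssmooth_on (U : set 'rV[R]_p) (f : superfun R p q) : Prop :=
  forall A, smooth_on U (fun x => f x A).

Definition coordf (a : crd p q) : superfun R p q := fun x =>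
  match a with
  | inl k => (x 0 k)%:A
  | inr l => ggen R l
  end.

Definition pd (a : crd p q) (f : superfun R p q) : superfun R p q := fun x =>
  match a with
  | inl k => [ffun A => partial k (fun y => f y A) x]
  | inr l => gderiv l (f x)
  end.

(* [is_ber J b]: b is the Berezinian det(J00 - J01 J11^-1 J10) / det J11 of the
   even supermatrix J. All the entries under the determinants are even, hence
   commute. *)
Definition is_ber (J : crd p q -> crd p q -> grassmann R q)
    (b : grassmann R q) : Prop :=
  let J00 := \matrix_(k, l) J (inl k) (inl l) in
  let J01 := \matrix_(k, l) J (inl k) (inr l) in
  let J10 := \matrix_(k, l) J (inr k) (inl l) in
  let J11 := \matrix_(k, l) J (inr k) (inr l) in
  has_parity false b /\
  exists K : 'M[grassmann R q]_q,
    [/\ K *m J11 = 1%:M, J11 *m K = 1%:M &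
        b * \det J11 = \det (J00 - J01 *m K *m J10)].

End Superfunctions.

(* Superfunctions in the chart i are functions on (the image of) the chart in
    R^p; [sm_trans i j] expresses in the coordinates of the chart i a
    superfunction given in the coordinates of the chart j. *)

(* psi (Dx_j)^w = (trans psi) Ber(dx_j/dx_i)^w (Dx_i)^w, with B = Ber(dx_j/dx_i) *)
Definition dens_trans (R : realType) (p q : nat)
    (trans : superfun R p q -> superfun R p q) (B : superfun R p q) (w : R)
    (f : superfun R p q) : superfun R p q :=
  fun x => trans f x * gpow w (B x).

Record supermanifold (R : realType) (p q : nat) := Supermanifold {
  sm_body : topologicalType;
  sm_idx : Type;
  sm_dom : sm_idx -> set sm_body;
  sm_chart : sm_idx -> sm_body -> 'rV[R]_p;
  sm_trans : sm_idx -> sm_idx -> superfun R p q -> superfun R p q;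
  sm_ber : sm_idx -> sm_idx -> superfun R p q;
  sm_hausdorff : hausdorff_space sm_body;
  sm_countable : @second_countable sm_body;
  sm_cover : forall m, exists i, sm_dom i m;
  sm_dom_open : forall i, open (sm_dom i);
  sm_chart_inj : forall i, {in sm_dom i &, injective (sm_chart i)};
  sm_chart_cont : forall i, {in sm_dom i, continuous (sm_chart i)};
  sm_chart_open : forall i (W : set sm_body), open W -> W `<=` sm_dom i ->
    open (sm_chart i @` W);
  (* the coordinate changes are local even unital algebra morphisms over the
     changes of body coordinates *)
  sm_trans_local : forall i j m (f g : superfun R p q),
    sm_dom i m -> sm_dom j m ->
    (\forall y \near sm_chart j m, f y = g y) ->
    sm_trans i j f (sm_chart i m) = sm_trans i j g (sm_chart i m);
  sm_trans_cst : forall i j m (c : R),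
    sm_dom i m -> sm_dom j m ->
    sm_trans i j (fun=> c%:A) (sm_chart i m) = c%:A;
  sm_trans_add : forall i j (W : set sm_body) m (f g : superfun R p q),
    open W -> W `<=` sm_dom i `&` sm_dom j -> W m ->
    ssmooth_on (sm_chart j @` W) f -> ssmooth_on (sm_chart j @` W) g ->
    sm_trans i j (fun y => f y + g y) (sm_chart i m) =
    sm_trans i j f (sm_chart i m) + sm_trans i j g (sm_chart i m);
  sm_trans_mul : forall i j (W : set sm_body) m (f g : superfun R p q),
    open W -> W `<=` sm_dom i `&` sm_dom j -> W m ->
    ssmooth_on (sm_chart j @` W) f -> ssmooth_on (sm_chart j @` W) g ->
    sm_trans i j (fun y => f y * g y) (sm_chart i m) =
    sm_trans i j f (sm_chart i m) * sm_trans i j g (sm_chart i m);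
  sm_trans_parity : forall i j (W : set sm_body) m (b : bool) (f : superfun R p q),
    open W -> W `<=` sm_dom i `&` sm_dom j -> W m ->
    ssmooth_on (sm_chart j @` W) f ->
    (forall y, (sm_chart j @` W) y -> has_parity b (f y)) ->
    has_parity b (sm_trans i j f (sm_chart i m));
  sm_trans_body : forall i j (W : set sm_body) m (f : superfun R p q),
    open W -> W `<=` sm_dom i `&` sm_dom j -> W m ->
    ssmooth_on (sm_chart j @` W) f ->
    gbody (sm_trans i j f (sm_chart i m)) = gbody (f (sm_chart j m));
  sm_trans_id : forall i (W : set sm_body) m (f : superfun R p q),
    open W -> W `<=` sm_dom i -> W m -> ssmooth_on (sm_chart i @` W) f ->
    sm_trans i i f (sm_chart i m) = f (sm_chart i m);
  (* The Berezinian of the Jacobian; the row index is that of the derivative,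
     so that with left derivatives the chain rule is a matrix product. *)
  sm_berP : forall i j m, sm_dom i m -> sm_dom j m ->
    is_ber (fun a b => pd a (sm_trans i j (coordf b)) (sm_chart i m))
           (sm_ber i j (sm_chart i m));
  sm_ber_gt0 : forall i j m, sm_dom i m -> sm_dom j m ->
    0 < gbody (sm_ber i j (sm_chart i m));
  (* Smoothness and the cocycle condition for the coordinate changes of
     (Ber TM) \ M. For w = 0 these are the conditions on the coordinate changes
     of M; for the other w they follow, by multiplicativity of the
     Berezinian. *)
  sm_trans_smooth : forall i j (W : set sm_body) (w : R) (f : superfun R p q),
    open W -> W `<=` sm_dom i `&` sm_dom j ->
    ssmooth_on (sm_chart j @` W) f ->
    ssmooth_on (sm_chart i @` W)
      (dens_trans (sm_trans i j) (sm_ber i j) w f);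
  sm_cocycle : forall i j k (W : set sm_body) (w : R) (f : superfun R p q) m,
    open W -> W `<=` sm_dom i `&` sm_dom j `&` sm_dom k -> W m ->
    ssmooth_on (sm_chart k @` W) f ->
    dens_trans (sm_trans i j) (sm_ber i j) w
      (dens_trans (sm_trans j k) (sm_ber j k) w f) (sm_chart i m) =
    dens_trans (sm_trans i k) (sm_ber i k) w f (sm_chart i m)
}.

Section Geometry.
Variables (R : realType) (p q : nat) (M : supermanifold R p q).
Local Notation superfun := (superfun R p q).
Local Notation crd := (crd p q).
Local Notation idx := (sm_idx M).

Definition chart_dom (i : idx) : set 'rV[R]_p := sm_chart i @` sm_dom i.

Record function := Function {
  fun_expr :> idx -> superfun;
  fun_smooth : forall i, ssmooth_on (chart_dom i) (fun_expr i);
  fun_compat : forall i j m, sm_dom i m -> sm_dom j m ->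
    fun_expr i (sm_chart i m) = sm_trans i j (fun_expr j) (sm_chart i m)
}.

Record wdensity (w : R) := WDensity {
  wd_expr :> idx -> superfun;
  wd_smooth : forall i, ssmooth_on (chart_dom i) (wd_expr i);
  wd_compat : forall i j m, sm_dom i m -> sm_dom j m ->
    wd_expr i (sm_chart i m) =
    dens_trans (sm_trans i j) (sm_ber i j) w (wd_expr j) (sm_chart i m)
}.

Record density := Density {
  d_comp :> forall w, wdensity w;
  d_finite : exists W : seq R, forall w, w \notin W ->
    forall i x, chart_dom i x -> d_comp w i x = 0
}.

Definition dens_parity (b : bool) (psi : density) : Prop :=
  forall w i x, chart_dom i x -> has_parity b (psi w i x).

(* Local expressions of densities: psi stands for the function
   \sum_w psi w x * t^w of x and t, where t corresponds to Dx. *)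
Definition lexpr : Type := R -> superfun.

Definition dens_lexpr (psi : density) (i : idx) : lexpr := fun w => psi w i.

Definition lmul (psi chi : lexpr) : lexpr :=
  fun w x => \sum_(u \in [set: R]) psi u x * chi (w - u) x.

Definition lcoef (f : superfun) (psi : lexpr) : lexpr := fun w x => f x * psi w x.

Definition lsign (b : bool) (psi : lexpr) : lexpr := fun w x => gsign b (psi w x).

Definition ldx (a : crd) (psi : lexpr) : lexpr := fun w => pd a (psi w).

(* d/dt *)
Definition ldt (psi : lexpr) : lexpr := fun w x => (w + 1) *: psi (w + 1) x.

(* multiplication by t^n *)
Definition lt (n : nat) (psi : lexpr) : lexpr := fun w => psi (w - n%:R).

Record lb_coefs := LbCoefs {
  lb_S : crd -> crd -> superfun;
  lb_gamma : crd -> superfun;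
  lb_theta : superfun
}.

Definition long_bracket_expr (c : lb_coefs) (psi chi : lexpr) : lexpr :=
  fun w x =>
    \sum_a \sum_b
      lcoef (lb_S c a b) (lmul (ldx b (lsign (par a) psi)) (ldx a chi)) w x
  + \sum_a
      lt 1 (lcoef (lb_gamma c a)
        (fun w' x' => lmul (ldx a psi) (ldt chi) w' x'
                    + lmul (ldt (lsign (par a) psi)) (ldx a chi) w' x')) w x
  + lt 2 (lcoef (lb_theta c) (lmul (ldt psi) (ldt chi))) w x.

Record long_bracket := LongBracket {
  lb_coef : idx -> lb_coefs;
  lb_br :> density -> density -> density;
  lb_S_smooth : forall i a b, ssmooth_on (chart_dom i) (lb_S (lb_coef i) a b);
  lb_gamma_smooth : forall i a, ssmooth_on (chart_dom i) (lb_gamma (lb_coef i) a);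
  lb_theta_smooth : forall i, ssmooth_on (chart_dom i) (lb_theta (lb_coef i));
  lb_S_parity : forall i a b x, chart_dom i x ->
    has_parity (~~ (par a (+) par b)) (lb_S (lb_coef i) a b x);
  lb_gamma_parity : forall i a x, chart_dom i x ->
    has_parity (~~ par a) (lb_gamma (lb_coef i) a x);
  lb_theta_parity : forall i x, chart_dom i x ->
    has_parity true (lb_theta (lb_coef i) x);
  lb_S_sym : forall i a b x, chart_dom i x ->
    lb_S (lb_coef i) a b x =
    (-1) ^+ (par a && par b) * lb_S (lb_coef i) b a x;
  lb_brE : forall psi chi i w x, chart_dom i x ->
    lb_br psi chi w i x =
    long_bracket_expr (lb_coef i) (dens_lexpr psi i) (dens_lexpr chi i) w x
}.

Definition jacobi (B : long_bracket) : Prop :=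
  forall (a b c : density) (pa pb pc : bool),
    dens_parity pa a -> dens_parity pb b -> dens_parity pc c ->
    forall w i x, chart_dom i x ->
      (-1) ^+ (pa && pc) * B (B a b) c w i x
    + (-1) ^+ (pc && pb) * B (B c a) b w i x
    + (-1) ^+ (pb && pa) * B (B b c) a w i x = 0.

Definition pencil_expr (c : lb_coefs) (w : R) (f : superfun) : superfun := fun x =>
  2^-1 *: (\sum_a \sum_b lb_S c a b x * pd b (pd a f) x
         + \sum_a (\sum_b pd b (lb_S c b a) x + (2 * w - 1) *: lb_gamma c a x)
                    * pd a f x
         + w *: (\sum_a pd a (lb_gamma c a) x) * f x
         + (w * (w - 1)) *: lb_theta c x * f x).

Definition canonical_pencil (B : long_bracket)
    (Delta : forall w, wdensity w -> wdensity w) : Prop :=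
  forall w (psi : wdensity w) i x, chart_dom i x ->
    Delta w psi i x = pencil_expr (lb_coef B i) w (psi i) x.

Definition vfield_expr (X : crd -> superfun) (f : superfun) : superfun :=
  fun x => \sum_a X a x * pd a f x.

Record even_vfield := EvenVfield {
  vf_coef : idx -> crd -> superfun;
  vf_act :> function -> function;
  vf_smooth : forall i a, ssmooth_on (chart_dom i) (vf_coef i a);
  vf_parity : forall i a x, chart_dom i x -> has_parity (par a) (vf_coef i a x);
  vf_actE : forall f i x, chart_dom i x ->
    vf_act f i x = vfield_expr (vf_coef i) (f i) x
}.

(* {f, g}, the restriction of the long bracket to functions *)
Definition fun_bracket_expr (c : lb_coefs) (f g : superfun) : superfun := fun x =>
  \sum_a \sum_b
    lb_S c a b x * (pd b (fun y => gsign (par a) (f y)) x * pd a g x).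

Definition poisson (B : long_bracket) (X : even_vfield) : Prop :=
  forall (f g : function) i x, chart_dom i x ->
    vfield_expr (vf_coef X i) (fun_bracket_expr (lb_coef B i) (f i) (g i)) x =
    fun_bracket_expr (lb_coef B i) (X f i) (g i) x
  + fun_bracket_expr (lb_coef B i) (f i) (X g i) x.

(* L_X = X^a d_a + w div X, where div X = (-1)^a d_a X^a since X is even *)
Definition lie_expr (X : crd -> superfun) (w : R) (f : superfun) : superfun :=
  fun x => vfield_expr X f x
         + w *: (\sum_a (-1) ^+ par a * pd a (X a) x) * f x.

End Geometry.

(* Main.v *)
Require Import Defs.
From HB Require Import structures.
From mathcomp Require Import all_boot all_order all_algebra.
From mathcomp Require Import ring lra.

(** A density of weight -n is written f s^n, where s = t^(-1). In the
    variables x^a and s the long bracket is an odd bracket with matrix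
      S^(ab),   S^(as) = - gamma^a s,   S^(ss) = theta s^2,
    and twice the canonical pencil becomes one operator in divergence form
    without a zeroth-order term,
      L f = sum_(I, J) d_I (S^(IJ) d_J f),
    whose restriction to s^n is 2 Delta_(-n) ([monom_laplace], [pencilw_nat]).

    The square of such an L is computed in [laplace_laplace]. The terms in which
    all outer derivatives fall on f cancel since L is odd. The third-order terms
    cancel by the Jacobi identity for the S^(IJ), and the second-order terms by
    its divergence [laplaceS]. With V^J = sum_I d_I S^(IJ) what is left is the
    vector field
      L^2 = sum_J L(V^J) d_J.
    The double divergence of the Jacobi identity shows that this field has zero
    divergence in the variables (x, s) ([divergence_laplaceV]). Its component
    along d_s is therefore minus s times the divergence of its components 4 X^a
    along the d_a, which makes it 4 times the Lie derivative along X on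
    densities ([pencil_pencil]); the factor is that of L^2 = 4 Delta^2. A
    derivation commuting with L preserves the bracket, because L generates the
    bracket by
      L(f g) = L(f) g + sigma(f) L(g) + 2 {f, g},
    sigma being the parity involution; so X is Poisson ([laplace2_bracket]).
    This settles the weights -n. At a fixed point and for a fixed density, both
    sides of the theorem are polynomials in w, so that they agree for all real
    w ([pencilw_pencilw]).

    All of this is algebra over a ring with supercommuting derivations
    ([superdiff]). It applies to the superfunctions of a chart once mixed
    partial derivatives are known to commute ([partialC]). The hypothesis speaks
    of global densities only, whereas the argument needs the Jacobi identity for
    the local coordinates x^a and s. By means of bump functions each of them is
    extended from a neighbourhood of a given point to a density on the manifold
    ([bump_density], [chart_jacobi]). Finally, X acts on functions as
    (Delta_0)^2, since densities of weight 0 are functions; this makes it a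
    global field. *)

Set Implicit Arguments.
Unset Strict Implicit.
Unset Printing Implicit Defensive.

Import Order.TTheory GRing.Theory Num.Theory.
Local Open Scope ring_scope.

(** * Signs *)

Section Sign.
Variable V : zmodType.
Implicit Types (b c : bool) (x y : V).

(** The signs of the super calculus are exponents of -1 which are sums of
    products of parities. Keeping them as one boolean makes every sign
    comparison a finite case analysis. *)
Definition sg b x : V := if b then - x else x.

Lemma sgsg b c x : sg b (sg c x) = sg (b (+) c) x.
Proof. by case: b; case: c; rewrite /= ?opprK. Qed.

Lemma sgD b x y : sg b (x + y) = sg b x + sg b y.
Proof. by case: b; rewrite /= ?opprD. Qed.

Lemma sgN b x : sg b (- x) = sg (~~ b) x.
Proof. by case: b; rewrite /= ?opprK. Qed.

Lemma opp_sg b x : - sg b x = sg (~~ b) x.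
Proof. by case: b; rewrite /= ?opprK. Qed.

Lemma sg0 b : sg b (0 : V) = 0.
Proof. by case: b; rewrite /= ?oppr0. Qed.

Lemma sg_sum b (J : Type) (r : seq J) (P : pred J) (F : J -> V) :
  sg b (\sum_(j <- r | P j) F j) = \sum_(j <- r | P j) sg b (F j).
Proof. by case: b; rewrite /= ?sumrN. Qed.

Lemma sg_opp_add0 b c x : b = ~~ c -> sg b x + sg c x = 0.
Proof. by move=> ->; case: c; rewrite /= ?addNr ?subrr. Qed.

End Sign.

Lemma sg_additive (V W : zmodType) (f : {additive V -> W}) b x :
  f (sg b x) = sg b (f x).
Proof. by case: b; rewrite /= ?raddfN. Qed.

Section SignRing.
Variable A : pzRingType.
Implicit Types (b : bool) (x y : A).

Lemma sg_mull b x y : sg b x * y = sg b (x * y).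
Proof. by case: b; rewrite /= ?mulNr. Qed.

Lemma sg_mulr b x y : x * sg b y = sg b (x * y).
Proof. by case: b; rewrite /= ?mulrN. Qed.

Lemma sgE b x : sg b x = (-1) ^+ b * x.
Proof. by case: b; rewrite /= ?mulN1r ?mul1r. Qed.

End SignRing.

(** * Odd operators of second order in divergence form *)

(** Superfunctions of coordinates indexed by [I]: [sd_sig] is the parity
    involution and the [sd_d i] are left derivatives. Supercommutativity is
    only required of products with a homogeneous factor, so that no grading has
    to be chosen. Cyclic and antisymmetric sums are handled by summing three,
    respectively two copies, whence the conditions on torsion. *)
Record superdiff (I : finType) (par : I -> bool) := Superdiff {
  sd_ring :> nzRingType;
  sd_sig : {rmorphism sd_ring -> sd_ring};
  sd_d : I -> {additive sd_ring -> sd_ring};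
  sd_sigK : forall f, sd_sig (sd_sig f) = f;
  sd_comm : forall b u f, sd_sig u = sg b u ->
    u * f = (if b then sd_sig f else f) * u;
  sd_dM : forall i f g, sd_d i (f * g) =
    sd_d i f * g + (if par i then sd_sig f else f) * sd_d i g;
  sd_dC : forall i j f,
    sd_d i (sd_d j f) = sg (par i && par j) (sd_d j (sd_d i f));
  sd_dsig : forall i f, sd_sig (sd_d i f) = sg (par i) (sd_d i (sd_sig f));
  sd_tf2 : forall f : sd_ring, f *+ 2 = 0 -> f = 0;
  sd_tf3 : forall f : sd_ring, f *+ 3 = 0 -> f = 0
}.

Section OddLaplacian.
Variables (I : finType) (par : I -> bool) (A : superdiff par).
Local Notation d := (@sd_d I par A).
Local Notation sig := (@sd_sig I par A).
Implicit Types (f g u v : A) (i j k l m : I) (b c : bool).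

(** Passing an odd object across [f] applies the parity involution to [f]; this
    is how the sign (-1)^(b * parity of f) is written for inhomogeneous [f]. *)
Definition twist b f : A := if b then sig f else f.
Definition homog b u : Prop := sig u = sg b u.

Lemma twist_twist b c f : twist b (twist c f) = twist (b (+) c) f.
Proof. by case: b; case: c; rewrite //= sd_sigK. Qed.

Lemma twistM b f g : twist b (f * g) = twist b f * twist b g.
Proof. by case: b; rewrite //= rmorphM. Qed.

Lemma twist_homog b c u : homog c u -> twist b u = sg (b && c) u.
Proof. by case: b => //= ->. Qed.

Lemma twist_d b i f : twist b (d i f) = sg (b && par i) (d i (twist b f)).
Proof. by case: b => //=; rewrite sd_dsig. Qed.

Lemma hom_comm b u f : homog b u -> u * f = twist b f * u.
Proof. exact: sd_comm. Qed.

Lemma hom_commC b u f : homog b u -> f * u = u * twist b f.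
Proof. by move=> hu; rewrite (hom_comm _ hu) twist_twist addbb. Qed.

Lemma hom_swap b c u v : homog b u -> homog c v -> u * v = sg (b && c) (v * u).
Proof. by move=> hu hv; rewrite (hom_comm _ hu) (twist_homog b hv) sg_mull. Qed.

Lemma hom_d b i u : homog b u -> homog (b (+) par i) (d i u).
Proof. by rewrite /homog sd_dsig => ->; rewrite sg_additive sgsg addbC. Qed.

Lemma hom_sum b (J : finType) (F : J -> A) :
  (forall t, homog b (F t)) -> homog b (\sum_t F t).
Proof.
by move=> hF; rewrite /homog rmorph_sum sg_sum; apply: eq_bigr => t _; exact: hF.
Qed.

Lemma hom_eq b c u : homog b u -> b = c -> homog c u.
Proof. by move=> ? <-. Qed.

Lemma dM i f g : d i (f * g) = d i f * g + twist (par i) f * d i g.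
Proof. exact: sd_dM. Qed.

Lemma dM_hom b i u g : homog b u ->
  d i (u * g) = d i u * g + sg (par i && b) (u * d i g).
Proof. by move=> hu; rewrite dM (twist_homog _ hu) sg_mull. Qed.

Variable S : I -> I -> A.
Hypothesis hom_S : forall i j, homog (~~ (par i (+) par j)) (S i j).
Hypothesis symS : forall i j, S i j = sg (par i && par j) (S j i).

Definition laplace f : A := \sum_j \sum_i d i (S i j * d j f).

Definition bracket f g : A :=
  \sum_i \sum_j S i j * (d j (twist (par i) f) * d i g).

Definition divS j : A := \sum_i d i (S i j).

Local Notation L := laplace.
Local Notation V := divS.

Lemma hom_V j : homog (~~ par j) (V j).
Proof.
apply: hom_sum => i; apply: hom_eq (hom_d i (hom_S i j)) _.
by case: (par i); case: (par j).
Qed.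

Lemma laplaceD f g : L (f + g) = L f + L g.
Proof.
rewrite /L -big_split; apply: eq_bigr => j _ /=.
by rewrite -big_split; apply: eq_bigr => i _; rewrite /= -raddfD -mulrDr -raddfD.
Qed.

Lemma laplaceN f : L (- f) = - L f.
Proof.
apply: (addrI (L f)); rewrite -laplaceD !subrr /L big1 // => j _.
by rewrite big1 // => i _; rewrite raddf0 mulr0 raddf0.
Qed.

Lemma laplace_sum (J : finType) (F : J -> A) : L (\sum_t F t) = \sum_t L (F t).
Proof.
elim/big_ind2: _ => //; last by move=> x x' y y' <- <-; rewrite laplaceD.
rewrite /L big1 // => j _; rewrite big1 // => i _.
by rewrite raddf0 mulr0 raddf0.
Qed.

Lemma laplaceE f :
  L f = \sum_j V j * d j f + \sum_i \sum_j S i j * d j (d i f).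
Proof.
rewrite [X in _ + X]exchange_big -big_split; apply: eq_bigr => j _ /=.
rewrite /V mulr_suml -big_split; apply: eq_bigr => i _ /=.
rewrite (dM_hom _ _ (hom_S i j)); congr (_ + _).
rewrite [X in _ = _ * X]sd_dC sg_mulr; congr (sg _ _).
by case: (par i); case: (par j).
Qed.

(** The generating identity. Both orders of a mixed term d_i f d_j g give the
    same contribution by the symmetry of [S], so that the bracket appears
    twice. *)
Lemma laplaceM f g : L (f * g) = L f * g + sig f * L g + bracket f g *+ 2.
Proof.
have E1 i j : d i (S i j * d j f * g) =
    d i (S i j * d j f) * g + S i j * (d j (twist (par i) f) * d i g).
  rewrite dM; congr (_ + _); rewrite twistM (twist_homog _ (hom_S i j)) twist_d.
  rewrite !(sg_mulr, sg_mull) sgsg mulrA.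
  by case: (par i); case: (par j).
have E2 i j : d i (S i j * (twist (par j) f * d j g)) =
    sig f * d i (S i j * d j g) + S j i * (d i (twist (par j) f) * d j g).
  rewrite mulrA (hom_comm _ (hom_S i j)) twist_twist -mulrA dM twist_twist addrC.
  congr (_ + _).
    by case: (par i); case: (par j).
  rewrite [S j i]symS !mulrA (hom_commC _ (hom_S i j)) twist_d twist_twist.
  rewrite !(sg_mulr, sg_mull).
  by case: (par i); case: (par j).
have E i j : d i (S i j * d j (f * g)) =
    d i (S i j * d j f) * g + sig f * d i (S i j * d j g)
    + (S i j * (d j (twist (par i) f) * d i g) +
      S j i * (d i (twist (par j) f) * d j g)).
  by rewrite (dM j) mulrDr raddfD /= mulrA E1 E2 addrACA.
rewrite /L mulr_suml mulr_sumr -big_split /= mulr2n.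
rewrite [X in _ + (X + _)]exchange_big -!big_split; apply: eq_bigr => j _ /=.
rewrite mulr_suml mulr_sumr -!big_split; apply: eq_bigr => i _ /=.
by rewrite E.
Qed.

(** For homogeneous [u], the field [nabla k] is up to sign the bracket of [u]
    with the k-th coordinate: the Hamiltonian field of that coordinate. *)
Definition nabla k u : A := \sum_m S k m * d m u.

Lemma nabla_sg b k u : nabla k (sg b u) = sg b (nabla k u).
Proof.
by rewrite /nabla sg_sum; apply: eq_bigr => m _; rewrite sg_additive sg_mulr.
Qed.

Lemma bracket_hom b u g : homog b u ->
  bracket u g = \sum_k sg (par k && b) (nabla k u * d k g).
Proof.
move=> hu; apply: eq_bigr => k _.
rewrite mulr_suml sg_sum; apply: eq_bigr => m _.
by rewrite (twist_homog _ hu) sg_additive sg_mull sg_mulr mulrA.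
Qed.

(** The Jacobi identity for three coordinates: [S i j] is the bracket of the
    coordinates i and j, and [nabla k] brackets it with the coordinate k. *)
Hypothesis jacS : forall i j k,
  sg (par i && par k) (nabla k (twist (par k) (S i j)))
  + sg (par k && par j) (nabla j (twist (par j) (S k i)))
  + sg (par j && par i) (nabla i (twist (par i) (S j k))) = 0.

(** The Jacobi identity is cyclic in (i, j, k). The sign included here makes
    its three terms images of each other under cyclic permutation in
    [jac_cyc], where the remaining signs are those of permuting i, j, k. *)
Definition jac i j k : A := sg (par i) (nabla i (S j k)).

Lemma jac_cyc i j k :
  jac i j k + sg (par i && (par j (+) par k)) (jac j k i)
  + sg (par k && (par i (+) par j)) (jac k i j) = 0.
Proof.
have := jacS i j k; rewrite /jac.
rewrite !(twist_homog _ (hom_S _ _)) !nabla_sg !sgsg => h.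
rewrite -[RHS](sg0 _ (par i && par k)) -h !sgD !sgsg [RHS]addrC [X in _ = _ + X]addrC addrA.
congr (_ + _ + _); congr (sg _ _).
all: by case: (par i); case: (par j); case: (par k).
Qed.

Lemma cyc_sum0 (F : I -> I -> I -> A) :
  (forall i j k, F i j k + F j k i + F k i j = 0) ->
  \sum_i \sum_j \sum_k F i j k = 0.
Proof.
move=> h; apply: (@sd_tf3 _ _ A).
have E1 : \sum_i \sum_j \sum_k F j k i = \sum_i \sum_j \sum_k F i j k.
  rewrite exchange_big; apply: eq_bigr => j _; exact: exchange_big.
have E2 : \sum_i \sum_j \sum_k F k i j = \sum_i \sum_j \sum_k F i j k.
  rewrite -E1 exchange_big; apply: eq_bigr => j _; exact: exchange_big.
rewrite !mulrSr mulr0n add0r -{2}E1 -{2}E2 -!big_split.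
rewrite big1 // => i _; rewrite /= -!big_split big1 // => j _.
by rewrite /= -!big_split big1 // => k _; exact: h.
Qed.

Lemma anti_sum0 (J : finType) (F : J -> J -> A) :
  (forall s t, F s t + F t s = 0) -> \sum_s \sum_t F s t = 0.
Proof.
move=> h; apply: (@sd_tf2 _ _ A).
rewrite mulr2n {2}exchange_big -big_split big1 // => s _.
by rewrite /= -big_split big1 // => t _; exact: h.
Qed.

Lemma laplace_nabla j k : L (S j k) = \sum_i d i (nabla i (S j k)).
Proof.
rewrite /L exchange_big; apply: eq_bigr => i _ /=.
by rewrite /nabla raddf_sum.
Qed.

(** The divergence of the Jacobi identity. When d_i meets a product
    S^(am) d_m S^(li), either it differentiates the second factor, which gives
    [nabla] of the divergence [V], or it gives products of first derivatives
    of [S], which cancel in pairs. *)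
Lemma laplaceS j k :
  L (S j k) + sg (par j) (nabla j (V k)) +
    sg (par k (+) (par j && par k)) (nabla k (V j)) = 0.
Proof.
have J : \sum_i sg (par i) (d i (jac i j k
    + sg (par i && (par j (+) par k)) (jac j k i)
    + sg (par k && (par i (+) par j)) (jac k i j))) = 0.
  by rewrite big1 // => i _; rewrite jac_cyc raddf0 sg0.
rewrite -[RHS]J => {J}.
under [RHS]eq_bigr => i _.
  rewrite !raddfD /= !sgD !sg_additive !sgsg addbb /=. over.
rewrite !big_split -laplace_nabla /= -!addrA; congr (_ + _).
have dnabla i a l : d i (nabla a (S l i)) =
    \sum_m d i (S a m) * d m (S l i) +
    sg (par i && ~~ par a (+) (par i && par l)) (\sum_m S a m * d m (d i (S i l))).
  rewrite /nabla raddf_sum sg_sum -big_split; apply: eq_bigr => m _ /=.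
  rewrite (dM_hom _ _ (hom_S a m)); congr (_ + _).
  rewrite [d i (d m _)]sd_dC [S l i]symS !sg_additive !sg_mulr !sgsg.
  congr (sg _ _).
  by case: (par i); case: (par a); case: (par m); case: (par l).
have dnabla' i a l : d i (nabla a (S i l)) =
    \sum_m d i (S a m) * d m (S i l) +
    sg (par i && ~~ par a) (\sum_m S a m * d m (d i (S i l))).
  rewrite /nabla raddf_sum sg_sum -big_split; apply: eq_bigr => m _ /=.
  rewrite (dM_hom _ _ (hom_S a m)); congr (_ + _).
  rewrite [d i (d m _)]sd_dC !sg_mulr !sgsg.
  congr (sg _ _).
  by case: (par i); case: (par a); case: (par m).
have nablaV a l : nabla a (V l) = \sum_i \sum_m S a m * d m (d i (S i l)).
  rewrite exchange_big; apply: eq_bigr => m _ /=.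
  by rewrite raddf_sum mulr_sumr.
rewrite !nablaV !sg_sum.
under [X in _ = X + _]eq_bigr => i _ do rewrite dnabla sgD sgsg.
under [X in _ = _ + X]eq_bigr => i _ do rewrite dnabla' sgD sgsg.
rewrite !big_split /= addrACA.
(* [Z1] and [Z2] collect the products of two first derivatives of S. *)
set Z1 := (X in _ = X + _ + _); set Z2 := (X in _ = _ + X + _).
have -> : Z1 + Z2 = 0.
  rewrite /Z1 /Z2; under eq_bigr => i _ do rewrite sg_sum.
  under [X in _ + X]eq_bigr => i _ do rewrite sg_sum.
  rewrite [X in _ + X]exchange_big -big_split big1 // => i _ /=.
  rewrite -big_split big1 // => m _ /=.
  rewrite [d m (S k i) * _](hom_swap (hom_d _ (hom_S _ _)) (hom_d _ (hom_S _ _))).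
  rewrite [S m j]symS sg_additive sg_mull !sgsg.
  apply: sg_opp_add0.
  by case: (par i); case: (par j); case: (par k); case: (par m).
rewrite add0r; congr (_ + _); apply: eq_bigr => i _; congr (sg _ _).
all: by case: (par i); case: (par j); case: (par k).
Qed.

Lemma dC3 i j l f :
  d j (d i (d l f)) = sg (par l && (par i (+) par j)) (d l (d j (d i f))).
Proof.
rewrite [d i (d l _)]sd_dC sg_additive [d j (d l _)]sd_dC sgsg; congr (sg _ _).
by case: (par i); case: (par j); case: (par l).
Qed.

Lemma laplaceM_hom b u g : homog b u ->
  L (u * g) = L u * g + sg b (u * L g) +
    (\sum_k sg (par k && b) (nabla k u * d k g)) *+ 2.
Proof. by move=> hu; rewrite laplaceM hu sg_mull (bracket_hom _ hu). Qed.

(** The third derivatives of [f] are supersymmetric in their indices, hence see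
    only the cyclic part of their coefficients. *)
Lemma jac3_sum0 f :
  \sum_i \sum_j \sum_k sg (par k && ~~ (par i (+) par j))
    (nabla k (S i j) * d k (d j (d i f))) = 0.
Proof.
apply: cyc_sum0 => i j k.
rewrite [d i (d k (d j f))]dC3 [d j (d i (d k f))]dC3.
rewrite -[RHS](mul0r (d k (d j (d i f)))) -(jac_cyc i j k) !mulrDl.
rewrite /jac !(sg_mulr, sg_mull, sgsg) [RHS]addrC -addrA.
congr (_ + (_ + _)); congr (sg _ _).
all: by case: (par i); case: (par j); case: (par k).
Qed.

(** The square of L is of first order; [laplaceM] distributes the outer L over
    the products of coefficients and derivatives of [f] in the inner one. *)
Lemma laplace_laplace f : L (L f) = \sum_l L (V l) * d l f.
Proof.
rewrite [L f]laplaceE laplaceD !laplace_sum.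
under eq_bigr => l _ do rewrite (laplaceM_hom _ (hom_V l)).
under [X in _ + X]eq_bigr => i _.
  rewrite laplace_sum.
  under eq_bigr => j _ do rewrite (laplaceM_hom _ (hom_S i j)).
  rewrite !big_split /=; over.
rewrite !big_split /= -!addrA.
rewrite -[RHS]addr0; congr (_ + _).
rewrite !jac3_sum0 !addr0.
(* [E2] collects the second derivatives of [f] whose coefficient is
   differentiated; one of the two copies of [N] is put in each of the two forms
   in which [nabla] occurs in [laplaceS]. *)
pose N := \sum_l \sum_k sg (par k && ~~ par l) (nabla k (V l) * d k (d l f)).
have E2 : N + N + \sum_i \sum_j L (S i j) * d j (d i f) = 0.
  have N1 : N = \sum_i \sum_j sg (par i) (nabla i (V j) * d j (d i f)).
    rewrite /N exchange_big; apply: eq_bigr => i _; apply: eq_bigr => j _ /=.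
    rewrite [d i (d j f)]sd_dC sg_mulr sgsg; congr (sg _ _).
    by case: (par i); case: (par j).
  have N2 : N = \sum_i \sum_j
      sg (par j (+) (par i && par j)) (nabla j (V i) * d j (d i f)).
    rewrite /N; apply: eq_bigr => i _; apply: eq_bigr => j _ /=.
    congr (sg _ _).
    by case: (par i); case: (par j).
  rewrite {1}N1 {1}N2 -!big_split big1 // => i _ /=.
  rewrite -!big_split big1 // => j _ /=.
  by rewrite -!sg_mull -!mulrDl [_ + L _]addrC addrA laplaceS mul0r.
(* [E1] collects the terms where no coefficient is differentiated by the outer
   L. They are quadratic in [V] and [S] and cancel in pairs, L being odd. *)
have E1 : \sum_l sg (~~ par l) (V l * L (d l f)) +
    \sum_i \sum_j sg (~~ (par i (+) par j)) (S i j * L (d j (d i f))) = 0.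
  have -> : \sum_l sg (~~ par l) (V l * L (d l f)) =
      \sum_l \sum_i \sum_j sg (~~ par l) (V l * (S i j * d j (d i (d l f)))).
    transitivity (\sum_l \sum_j sg (~~ par l) (V l * (V j * d j (d l f))) +
        \sum_l \sum_i \sum_j sg (~~ par l) (V l * (S i j * d j (d i (d l f))))).
      rewrite -big_split; apply: eq_bigr => l _ /=.
      rewrite laplaceE mulrDr sgD mulr_sumr sg_sum mulr_sumr sg_sum.
      congr (_ + _); apply: eq_bigr => i _.
      by rewrite mulr_sumr sg_sum.
    rewrite (anti_sum0 (F := fun l j => _)) ?add0r // => l j.
    rewrite !mulrA (hom_swap (hom_V j) (hom_V l)) [d l (d j f)]sd_dC.
    rewrite sg_mull sg_mulr !sgsg; apply: sg_opp_add0.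
    by case: (par j); case: (par l).
  have -> : \sum_i \sum_j sg (~~ (par i (+) par j)) (S i j * L (d j (d i f))) =
      \sum_i \sum_j \sum_l
        sg (~~ (par i (+) par j)) (S i j * (V l * d l (d j (d i f)))).
    transitivity (\sum_i \sum_j \sum_l
        sg (~~ (par i (+) par j)) (S i j * (V l * d l (d j (d i f)))) +
      \sum_i \sum_j \sum_k \sum_l sg (~~ (par i (+) par j))
         (S i j * (S k l * d l (d k (d j (d i f)))))).
      rewrite -big_split; apply: eq_bigr => i _ /=.
      rewrite -big_split; apply: eq_bigr => j _ /=.
      rewrite laplaceE mulrDr sgD mulr_sumr sg_sum mulr_sumr sg_sum.
      congr (_ + _); apply: eq_bigr => k _.
      by rewrite mulr_sumr sg_sum.
    rewrite -[RHS]addr0; congr (_ + _).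
    rewrite pair_bigA /=; under eq_bigr => s _ do rewrite pair_bigA /=.
    apply: anti_sum0 => -[i j] [k l] /=.
    rewrite !mulrA (hom_swap (hom_S k l) (hom_S i j)) [d j (d i (d l _))]dC3.
    rewrite [d j (d i (d k f))]dC3 !(sg_mulr, sg_mull, sgsg, sg_additive).
    apply: sg_opp_add0.
    by case: (par i); case: (par j); case: (par k); case: (par l).
  rewrite exchange_big -big_split big1 // => i _ /=.
  rewrite exchange_big -big_split big1 // => j _ /=.
  rewrite -big_split big1 // => l _ /=.
  rewrite !mulrA (hom_swap (hom_S i j) (hom_V l)) dC3.
  rewrite !(sg_mulr, sg_mull, sgsg); apply: sg_opp_add0.
  by case: (par i); case: (par j); case: (par l).
by rewrite addrCA [_ + (N + _)]addrCA [X in N + (N + X)]addrCA E1 addr0 addrA.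
Qed.

(** The divergence of [laplaceS] expresses the sum in question, taken twice,
    through the double divergence of L(S^(kl)). The latter is a triple
    divergence of the Jacobi identity, which vanishes by cyclicity. *)
Lemma divergence_laplaceV : \sum_l sg (par l) (d l (L (V l))) = 0.
Proof.
set W := LHS; apply: (@sd_tf2 _ _ A); rewrite mulr2n.
have LV l : L (V l) = \sum_k d k (nabla k (V l)).
  rewrite /L exchange_big; apply: eq_bigr => k _ /=.
  by rewrite /nabla raddf_sum.
have W1 : W = \sum_l \sum_k sg (par l) (d l (d k (nabla k (V l)))).
  by apply: eq_bigr => l _; rewrite LV raddf_sum sg_sum.
have W2 : W = \sum_l \sum_k sg (par k) (d k (d l (nabla l (V k)))).
  by rewrite W1 exchange_big.
have Z : \sum_l \sum_k sg (par l (+) par k) (d l (d k (L (S k l)))) = 0.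
  pose F i k l :=
    sg (par l (+) par k (+) par i) (d l (d k (d i (jac i k l)))).
  transitivity (\sum_l \sum_k \sum_i F i k l).
    apply: eq_bigr => l _; apply: eq_bigr => k _.
    rewrite laplace_nabla 2!raddf_sum sg_sum; apply: eq_bigr => i _ /=.
    rewrite /F /jac !sg_additive sgsg; congr (sg _ _).
    by case: (par i); case: (par l); case: (par k).
  have F0 : \sum_i \sum_k \sum_l F i k l = 0.
    apply: cyc_sum0 => i k l; rewrite /F.
    rewrite [d i (d l (d k _))]dC3 [d k (d i (d l _))]dC3.
    rewrite [d k (d i (d l _))]dC3 sgsg.
    rewrite -[RHS](sg0 _ (par l (+) par k (+) par i)).
    rewrite -[in RHS](raddf0 (d l)) -[in RHS](raddf0 (d k)) -[in RHS](raddf0 (d i)).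
    rewrite -(jac_cyc i k l) !raddfD /= !sgD !sg_additive !sgsg.
    congr (_ + _ + _); congr (sg _ _);
      by case: (par i); case: (par k); case: (par l).
  rewrite -[RHS]F0 exchange_big [RHS]exchange_big.
  apply: eq_bigr => k _ /=; exact: exchange_big.
rewrite {1}W1 W2 -[LHS]add0r -{1}Z addrA -!big_split big1 // => l _ /=.
rewrite -!big_split big1 // => k _ /=.
rewrite -[RHS](sg0 _ (par l (+) par k)) -(raddf0 (d l)) -(raddf0 (d k)).
rewrite -(laplaceS k l) !raddfD /= !sgD !sg_additive !sgsg.
rewrite [d k (d l (nabla l _))]sd_dC sgsg.
congr (_ + _ + _); congr (sg _ _).
all: by case: (par k); case: (par l).
Qed.

Lemma laplace_sig f : L (sig f) = - sig (L f).
Proof.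
rewrite /L rmorph_sum -sumrN; apply: eq_bigr => j _.
rewrite rmorph_sum -sumrN; apply: eq_bigr => i _ /=.
rewrite sd_dsig rmorphM hom_S sd_dsig !(sg_mull, sg_mulr, sgsg, sg_additive).
by case: (par i); case: (par j); rewrite /= ?raddfN ?opprK.
Qed.

Lemma hom_laplaceV l : homog (par l) (L (V l)).
Proof.
rewrite /homog -[LHS]opprK -laplace_sig hom_V.
by case: (par l); rewrite //= laplaceN opprK.
Qed.

Lemma laplace2M f g : L (L (f * g)) = L (L f) * g + f * L (L g).
Proof.
rewrite !laplace_laplace mulr_suml mulr_sumr -big_split; apply: eq_bigr => l _ /=.
rewrite dM mulrDr !mulrA; congr (_ + _); congr (_ * _).
by rewrite (hom_commC f (hom_laplaceV l)).
Qed.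

(** The bracket is the defect of L from being a derivation, and L^2 is a
    derivation commuting with L. *)
Lemma laplace2_bracket f g :
  L (L (bracket f g)) = bracket (L (L f)) g + bracket f (L (L g)).
Proof.
have E u v : bracket u v *+ 2 = L (u * v) - L u * v - sig u * L v.
  by rewrite laplaceM -addrA -opprD addrAC subrr add0r.
apply/eqP; rewrite -subr_eq0; apply/eqP; apply: (@sd_tf2 _ _ A).
rewrite mulrnBl mulrnDl !E.
have -> : L (L (bracket f g)) *+ 2 = L (L (bracket f g *+ 2)).
  by rewrite !mulr2n !laplaceD.
rewrite E !(laplaceD, laplaceN, laplace2M) !laplace_sig !laplaceN !laplace_sig.
rewrite !mulNr !opprK.
set a1 := L (_ * g); set a2 := L (f * _); set b1 := _ * g; set b2 := L f * _.
by rewrite [in X in _ - X]addrACA [X in _ - (X + _)]addrACA -!opprD subrr.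
Qed.
End OddLaplacian.

(** * Left derivatives on a Grassmann algebra *)

Section GrassmannSigns.
Variables (q : nat).
Implicit Types (A B C : {set 'I_q}) (l m : 'I_q).

(** Each pair in A x B is an inversion for exactly one of the two orders. *)
Lemma odd_ninvC A B : [disjoint A & B] ->
  odd (ninv A B) = odd (ninv B A) (+) (odd #|A| && odd #|B|).
Proof.
move=> dAB; rewrite -oddM.
have <- : (ninv A B + ninv B A = #|A| * #|B|)%N.
  rewrite /ninv [X in (_ + X)%N]exchange_big -big_split -sum_nat_const /=.
  apply: eq_bigr => i iA; rewrite -big_split -sum1_card.
  apply: eq_bigr => j jB /=.
  case: (ltngtP j i) => // /val_inj ij; move: (disjointFr dAB iA).
  by rewrite -ij jB.
by rewrite oddD addbCA addbb addbF.
Qed.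

Lemma card_lt_ninv l A : #|[set j in A | (j < l)%N]| = ninv [set l] A.
Proof.
rewrite /ninv big_set1 -sum1_card.
under eq_bigl => j do rewrite inE.
by rewrite big_mkcondr; apply: eq_bigr => j _; case: ltnP.
Qed.

Lemma odd_ninv_pair l m : l != m ->
  odd (ninv [set l] [set m]) = ~~ odd (ninv [set m] [set l]).
Proof.
move=> lm; rewrite odd_ninvC ?cards1 ?addbT //.
by rewrite disjoints1 inE.
Qed.

End GrassmannSigns.

Lemma sgX (A : pzRingType) n (x : A) : (-1) ^+ n * x = sg (odd n) x.
Proof. by rewrite -signr_odd sgE. Qed.

Section GrassmannDerivations.
Variables (K : comNzRingType) (q : nat).
Implicit Types (A B C : {set 'I_q}) (u v : grassmann K q) (l m : 'I_q).

Lemma gmulE u v C : (u * v) C =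
  \sum_(A : {set 'I_q} | A \subset C)
     sg (odd (ninv A (C :\: A))) (u A * v (C :\: A)).
Proof. by rewrite ffunE; apply: eq_bigr => A _; rewrite sgX. Qed.

Lemma gderivE l u A : gderiv l u A =
  if l \in A then 0 else sg (odd (ninv [set l] A)) (u (l |: A)).
Proof. by rewrite ffunE card_lt_ninv sgX. Qed.

Lemma gsignE b u A : gsign b u A = sg (b && odd #|A|) (u A).
Proof. by rewrite ffunE sgE. Qed.

Lemma gsign0 u : gsign false u = u.
Proof. by apply/ffunP => A; rewrite gsignE. Qed.

Lemma gsignK b : involutive (gsign b : grassmann K q -> _).
Proof. by move=> u; apply/ffunP => A; rewrite !gsignE sgsg addbb. Qed.

Lemma gsign_zmod_morphism b :
  zmod_morphism (gsign b : grassmann K q -> grassmann K q).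
Proof.
by move=> u v; apply/ffunP => A; rewrite !ffunE mulrDr mulrN.
Qed.

Lemma gsign_monoid_morphism b :
  monoid_morphism (gsign b : grassmann K q -> grassmann K q).
Proof.
split.
  apply/ffunP => A; rewrite !(gsignE, ffunE); case: eqP => [->|_].
    by rewrite cards0 andbF.
  by rewrite sg0.
move=> u v; apply/ffunP => C; rewrite gsignE !gmulE sg_sum.
apply: eq_bigr => A AC; rewrite !gsignE sg_mull sg_mulr !sgsg; congr (sg _ _).
rewrite -(cardsID A C) (setIidPr AC) oddD.
by case: b => //=; do 3!case: (odd _).
Qed.

HB.instance Definition _ b := GRing.isZmodMorphism.Build
  (grassmann K q) (grassmann K q) (gsign b) (gsign_zmod_morphism b).
HB.instance Definition _ b := GRing.isMonoidMorphism.Build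
  (grassmann K q) (grassmann K q) (gsign b) (gsign_monoid_morphism b).

Lemma gderiv_zmod_morphism l :
  zmod_morphism (gderiv l : grassmann K q -> grassmann K q).
Proof.
move=> u v; apply/ffunP => A; rewrite !(gderivE, ffunE).
by case: ifP => _; rewrite ?subr0 //; case: odd; rewrite //= opprD.
Qed.

HB.instance Definition _ l := GRing.isZmodMorphism.Build
  (grassmann K q) (grassmann K q) (gderiv l) (gderiv_zmod_morphism l).

Lemma gsign_gderiv l u :
  gsign true (gderiv l u) = - gderiv l (gsign true u).
Proof.
apply/ffunP => A; rewrite gsignE [RHS]ffunE !gderivE gsignE /=.
case: ifP => lA; first by rewrite sg0 oppr0.
by rewrite cardsU1 lA !sgsg opp_sg /=; congr (sg _ _); do 2!case: (odd _).
Qed.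

Lemma gderivC l m u : gderiv l (gderiv m u) = - gderiv m (gderiv l u).
Proof.
apply/ffunP => A; rewrite [RHS]ffunE !gderivE !inE.
case: (eqVneq l m) => [->|lm] /=; first by rewrite sg0 if_same oppr0.
case: ifP => lA; case: ifP => mA; rewrite ?sg0 ?oppr0 //.
rewrite setUCA !sgsg opp_sg; congr (sg _ _).
rewrite !ninvUr ?disjoints1 ?lA ?mA // !oddD (odd_ninv_pair lm).
by do 3!case: (odd _).
Qed.

Lemma gsupercomm b u v : gsign true u = sg b u -> u * v = gsign b v * u.
Proof.
move=> hu; apply/ffunP => C; rewrite !gmulE.
rewrite (reindex_onto (fun A => C :\: A) (fun A => C :\: A)) /=; last first.
  by move=> A AC; rewrite setDDr setDv set0U; apply/setIidPr.
apply: eq_big => [A|A].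
  rewrite subsetDl /= setDDr setDv set0U.
  by apply/eqP/idP => [<-|/setIidPr //]; rewrite subsetIl.
move=> /andP[_ /eqP ->].
have h : sg (odd #|A| && odd #|C :\: A|) (u (C :\: A)) =
    sg (b && odd #|A|) (u (C :\: A)).
  have := congr1 (fun w : grassmann K q => w (C :\: A)) hu; rewrite gsignE /=.
  case: (odd #|A|); rewrite ?andbF ?andbT //= => ->.
  by case: (b); rewrite //= ffunE.
rewrite odd_ninvC; last first.
  by rewrite disjoint_sym disjoints_subset setDE setCI setCK subsetUr.
by rewrite -sgsg -sg_mull andbC h gsignE !sg_mull !sgsg mulrC.
Qed.

(** In the coefficient of [C] the terms match one to one when [l] is not in [C].
    When [l] is in [C], the left side is zero, while on the right the generator
    xi_l comes from either factor, and these two contributions cancel. *)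
Lemma gderivM l u v :
  gderiv l (u * v) = gderiv l u * v + gsign true u * gderiv l v.
Proof.
apply/ffunP => C; rewrite gderivE [RHS]ffunE !gmulE.
have setU1K_eq A : ((l |: A) :\ l == A) = (l \notin A).
  apply/eqP/idP => [<-|]; first by rewrite !inE eqxx.
  exact: setU1K.
have dl A : l \notin A -> [disjoint [set l] & A] by rewrite disjoints1.
have dD A B : [disjoint A & B :\: A].
  by rewrite disjoint_sym disjoints_subset setDE subsetIr.
case: ifP => lC.
  rewrite (bigID (fun A : {set 'I_q} => l \in A)) /= big1 ?add0r; last first.
    by move=> A /andP[_ lA]; rewrite gderivE lA mul0r sg0.
  rewrite [X in _ + X](bigID (fun A : {set 'I_q} => l \notin A)) /=.
  rewrite [X in _ + (X + _)]big1 ?add0r; last first.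
    by move=> A /andP[_ lA]; rewrite gderivE inE lA lC mulr0 sg0.
  rewrite [X in _ + X](reindex_onto (fun A => l |: A) (fun A => A :\ l)) /=; last first.
    by move=> A /andP[_]; rewrite negbK; exact: setD1K.
  under [X in _ + X]eq_bigl => A.
    rewrite setU1K_eq subUset sub1set lC setU11 /= andbT. over.
  rewrite -big_split big1 // => A /andP[AC lA] /=.
  have lB : l \notin C :\: (l |: A) by rewrite !inE eqxx.
  have -> : C :\: A = l |: (C :\: (l |: A)).
    by apply/setP => x; rewrite !inE; case: eqVneq => [->|]; rewrite ?lA ?lC.
  rewrite !gderivE (negbTE lA) (negbTE lB) gsignE cardsU1 lA.
  rewrite !(sg_mull, sg_mulr, sgsg); apply: sg_opp_add0.
  rewrite ninvUl ?dl // ninvUr ?dl // !oddD /= [odd (ninv A [set l])]odd_ninvC; last first.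
    by rewrite disjoint_sym dl.
  by rewrite cards1 andbT; do 4!case: (odd _).
rewrite (bigID (fun A : {set 'I_q} => l \in A)) /= sgD !sg_sum.
have AlC A : A \subset C -> l \notin A.
  by move=> /subsetP AC; apply/negP => /AC; rewrite lC.
congr (_ + _).
  rewrite (reindex_onto (fun A => l |: A) (fun A => A :\ l)) /=; last first.
    by move=> A /andP[_]; exact: setD1K.
  apply: eq_big => [A|A].
    rewrite setU1K_eq setU11 andbT subUset sub1set setU11 /= -subsetD1.
    by rewrite setU1K ?lC.
  rewrite setU1K_eq => /andP[/andP[AC _] lA].
  have -> : (l |: C) :\: (l |: A) = C :\: A.
    by apply/setP => x; rewrite !inE; case: eqVneq => [->|]; rewrite ?lA ?lC.
  have AC' : A \subset C.
    rewrite -(setU1K (negbT lC)) subsetD1 lA andbT.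
    exact: subset_trans (subsetUr _ _) AC.
  rewrite gderivE (negbTE lA) sg_mull !sgsg; congr (sg _ _).
  rewrite ninvUl ?dl // -[in ninv _ C](setID C A) (setIidPr AC').
  rewrite ninvUr // !oddD.
  by do 3!case: (odd _).
apply: eq_big => [A|A].
  by rewrite -subsetD1 setU1K ?lC.
move=> /andP[AC lA].
have AC' : A \subset C by rewrite -(setU1K (negbT lC)) subsetD1 lA andbT.
have lB : l \notin C :\: A by rewrite inE lC andbF.
have -> : (l |: C) :\: A = l |: (C :\: A).
  by apply/setP => x; rewrite !inE; case: eqVneq => [->|]; rewrite ?lA ?lC.
rewrite gderivE (negbTE lB) gsignE !(sg_mull, sg_mulr, sgsg); congr (sg _ _).
rewrite -[in ninv _ C](setID C A) (setIidPr AC') !ninvUr ?dl // !oddD.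
rewrite [odd (ninv A [set l])]odd_ninvC; last by rewrite disjoint_sym dl.
by rewrite cards1 andbT /=; do 4!case: (odd _).
Qed.

Lemma gderivZ l (k : K) u : gderiv l (k *: u) = k *: gderiv l u.
Proof.
apply/ffunP => A; rewrite [RHS]ffunE !gderivE ffunE /GRing.scale /=.
by case: ifP => _; rewrite ?mulr0 // sg_mulr.
Qed.

Lemma gsign1 b : gsign b (1 : grassmann K q) = 1.
Proof. by have [] := gsign_monoid_morphism b. Qed.

Lemma gderiv1 l : gderiv l (1 : grassmann K q) = 0.
Proof.
apply/ffunP => A; rewrite gderivE !ffunE; case: ifP => // lA.
suff -> : l |: A == set0 = false by rewrite sg0.
by apply/negbTE/set0Pn; exists l; rewrite !inE eqxx.
Qed.

Lemma gderiv_gen l l' : gderiv l (ggen K l') = (l == l')%:R.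
Proof.
apply/ffunP => A; rewrite gderivE ffunE.
have E1 : ((1 : grassmann K q) *+ (l == l')) A = ((l == l') && (A == set0))%:R.
  by rewrite ffunMnE ffunE; case: (l == l').
rewrite E1; case: ifP => lA.
  have /negbTE -> : A != set0 by apply/set0Pn; exists l.
  by rewrite andbF.
case: (eqVneq l l') => [<-|ll'] /=.
  have -> : (l |: A == [set l]) = (A == set0).
    apply/eqP/eqP => [h|->]; last by rewrite setU0.
    by rewrite -(setU1K (negbT lA)) h setDv.
  case: eqP => [->|_]; last by rewrite sg0.
  by rewrite /ninv big_set1 big_set0.
have -> : (l |: A == [set l']) = false.
  apply/negbTE/eqP => h; have : l \in l |: A by rewrite !inE eqxx.
  by rewrite h inE (negbTE ll').
by rewrite sg0.
Qed.

Lemma gsign_gen l : gsign true (ggen K l) = - ggen K l.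
Proof.
apply/ffunP => A; rewrite gsignE [RHS]ffunE !ffunE /=.
by case: eqP => [->|_]; rewrite ?cards1 // sg0 oppr0.
Qed.

End GrassmannDerivations.

(** * Grassmann algebras over differential rings *)

Section Coefficientwise.
Variables (q : nat).

Definition gmap (K K' : comNzRingType) (f : K -> K') (u : grassmann K q) :
    grassmann K' q := [ffun A => f (u A)].

Section Maps.
Variables (K K' : comNzRingType) (f : {additive K -> K'}).
Implicit Types (u v : grassmann K q).

Lemma gmap_zmod_morphism : zmod_morphism (gmap f).
Proof. by move=> u v; apply/ffunP => A; rewrite !ffunE raddfB. Qed.

Lemma gmap_gsign b u : gmap f (gsign b u) = gsign b (gmap f u).
Proof. by apply/ffunP => A; rewrite ffunE !gsignE sg_additive ffunE. Qed.

Lemma gmap_gderiv l u : gmap f (gderiv l u) = gderiv l (gmap f u).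
Proof.
apply/ffunP => A; rewrite ffunE !gderivE; case: ifP => _; first exact: raddf0.
by rewrite sg_additive ffunE.
Qed.

End Maps.

Lemma gmap_monoid_morphism (K K' : comNzRingType) (f : {rmorphism K -> K'}) :
  monoid_morphism (gmap f).
Proof.
split; first by apply/ffunP => A; rewrite !ffunE rmorph_nat.
move=> u v; apply/ffunP => C; rewrite ffunE !gmulE raddf_sum.
by apply: eq_bigr => A AC; rewrite sg_additive !ffunE; congr (sg _ _); exact: (rmorphM f).
Qed.

HB.instance Definition _ (K K' : comNzRingType) (f : {additive K -> K'}) :=
  GRing.isZmodMorphism.Build (grassmann K q) (grassmann K' q) (gmap f)
    (gmap_zmod_morphism f).
HB.instance Definition _ (K K' : comNzRingType) (f : {rmorphism K -> K'}) :=
  GRing.isMonoidMorphism.Build (grassmann K q) (grassmann K' q) (gmap f)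
    (gmap_monoid_morphism f).

Lemma gmap_derivM (K : comNzRingType) (D : {additive K -> K}) :
  (forall x y, D (x * y) = D x * y + x * D y) ->
  forall u v, gmap D (u * v) = gmap D u * v + u * gmap D v.
Proof.
move=> DM u v; apply/ffunP => C; rewrite [RHS]ffunE ffunE !gmulE raddf_sum.
rewrite -big_split; apply: eq_bigr => A _ /=.
by rewrite sg_additive DM sgD !ffunE.
Qed.

End Coefficientwise.

Record dring (E : finType) := Dring {
  dr_ring :> comNzRingType;
  dr_d : E -> {additive dr_ring -> dr_ring};
  dr_dM : forall e x y, dr_d e (x * y) = dr_d e x * y + x * dr_d e y;
  dr_dC : forall e e' x, dr_d e (dr_d e' x) = dr_d e' (dr_d e x);
  dr_tf : forall n (x : dr_ring), x *+ n.+1 = 0 -> x = 0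
}.

Section GrassmannSuperdiff.
Variables (E : finType) (K : dring E) (q : nat).

Definition spar (a : E + 'I_q) : bool := if a is inr _ then true else false.

Definition gpd (a : E + 'I_q) : grassmann K q -> grassmann K q :=
  match a with inl e => gmap (dr_d K e) | inr l => gderiv l end.

Lemma gpd_zmod_morphism a : zmod_morphism (gpd a).
Proof. by case: a => [e|l] u v; rewrite /= raddfB. Qed.

HB.instance Definition _ a := GRing.isZmodMorphism.Build
  (grassmann K q) (grassmann K q) (gpd a) (gpd_zmod_morphism a).

Lemma gpdM a u v :
  gpd a (u * v) = gpd a u * v + (if spar a then gsign true u else u) * gpd a v.
Proof.
case: a => [e|l] /=; last exact: gderivM.
by apply: gmap_derivM; exact: dr_dM.
Qed.

Lemma gpdC a b u :
  gpd a (gpd b u) = sg (spar a && spar b) (gpd b (gpd a u)).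
Proof.
case: a b => [e|l] [e'|l'] /=.
- by apply/ffunP => A; rewrite !ffunE dr_dC.
- by rewrite gmap_gderiv.
- by rewrite gmap_gderiv.
- by rewrite gderivC.
Qed.

Lemma gpd_gsign a u : gsign true (gpd a u) = sg (spar a) (gpd a (gsign true u)).
Proof. by case: a => [e|l] /=; rewrite ?gmap_gsign ?gsign_gderiv. Qed.

Lemma grassmann_tf n (u : grassmann K q) : u *+ n.+1 = 0 -> u = 0.
Proof.
move=> u0; apply/ffunP => A; rewrite ffunE; apply: (@dr_tf _ K n).
have := congr1 (fun w : grassmann K q => w A) u0.
by rewrite ffunMnE ffunE.
Qed.

(** Superfunctions: Grassmann algebra over a ring of even functions, with the
    derivations of that ring acting on coefficients. *)
Definition grassmann_superdiff : superdiff spar :=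
  @Superdiff _ spar (grassmann K q) (gsign true) gpd (@gsignK _ _ true)
    (fun b u f h => etrans (gsupercomm f h) (congr1 (fun w => w * u)
       (if b as b0 return gsign b0 f = if b0 then gsign true f else f
        then erefl else gsign0 f)))
    gpdM gpdC gpd_gsign (@grassmann_tf 1) (@grassmann_tf 2).

End GrassmannSuperdiff.

(** * Densities of integral weight as polynomials *)

Section PolyDring.
Variables (E : finType) (K : dring E).

(** [None] is the index of the additional even coordinate s = t^(-1). Only
    polynomials in s are considered, that is, weights which are non-positive
    integers. *)
Definition poly_d (e : option E) : {poly K} -> {poly K} :=
  if e is Some e' then map_poly (dr_d K e') else deriv.

Lemma poly_d_zmod_morphism e : zmod_morphism (poly_d e).
Proof. by case: e => [e|] x y; rewrite /= ?derivB //; exact: raddfB. Qed.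

HB.instance Definition _ e := GRing.isZmodMorphism.Build
  {poly K} {poly K} (poly_d e) (poly_d_zmod_morphism e).

Lemma poly_dM e x y : poly_d e (x * y) = poly_d e x * y + x * poly_d e y.
Proof.
case: e => [e|] /=; last by rewrite derivM.
apply/polyP => n; rewrite coef_map coefD !coefM raddf_sum -big_split.
by apply: eq_bigr => i _ /=; rewrite dr_dM !coef_map.
Qed.

Lemma poly_dC e e' x : poly_d e (poly_d e' x) = poly_d e' (poly_d e x).
Proof.
apply/polyP => n; case: e e' => [e|] [e'|] //=.
- by rewrite !coef_map /= dr_dC.
- by rewrite coef_map !coef_deriv coef_map /= raddfMn.
- by rewrite coef_map !coef_deriv coef_map /= raddfMn.
Qed.

Lemma poly_tf n (x : {poly K}) : x *+ n.+1 = 0 -> x = 0.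
Proof.
move=> x0; apply/polyP => i; rewrite coef0; apply: (@dr_tf _ K n).
by rewrite -coefMn x0 coef0.
Qed.

Definition poly_dring : dring (option E) :=
  @Dring _ {poly K} poly_d poly_dM poly_dC poly_tf.

End PolyDring.

Section Homogeneous.
Variables (E : finType) (K : dring E) (q : nat).
Local Notation A := (grassmann_superdiff K q).
Local Notation H := (grassmann_superdiff (poly_dring K) q).
Local Notation I := (E + 'I_q)%type.
Implicit Types (u v f g : A) (a b : I) (n m : nat).

Definition mulXn n (x : K) : {poly K} := x%:P * 'X^n.

Lemma mulXn_zmod_morphism n : zmod_morphism (mulXn n).
Proof. by move=> x y; rewrite /mulXn polyCB mulrBl. Qed.

HB.instance Definition _ n := GRing.isZmodMorphism.Build
  K {poly K} (mulXn n) (mulXn_zmod_morphism n).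

(** The density of weight [- n] with coefficient [u], as a function u s^n. *)
Definition monom n : A -> H := gmap (mulXn n).

Lemma monom_zmod_morphism n : zmod_morphism (monom n).
Proof. exact: raddfB. Qed.

HB.instance Definition _ n := GRing.isZmodMorphism.Build
  A H (monom n) (monom_zmod_morphism n).

Lemma monom_inj n u : monom n u = 0 -> u = 0.
Proof.
move=> h; apply/ffunP => B.
have := congr1 (fun w : grassmann {poly K} q => (w B)`_n) h.
by rewrite !ffunE /= /mulXn coefMXn ltnn subnn coefC coef0.
Qed.

Lemma monomM n m u v : monom n u * monom m v = monom (n + m) (u * v).
Proof.
apply/ffunP => C; rewrite [RHS]ffunE !gmulE raddf_sum.
apply: eq_bigr => B _; rewrite sg_additive; congr (sg _ _).
by rewrite !ffunE /= /mulXn polyCM exprD mulrACA.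
Qed.

Definition emb (a : I) : option E + 'I_q :=
  match a with inl e => inl (Some e) | inr l => inr l end.

Lemma monom_d n a u : sd_d H (emb a) (monom n u) = monom n (sd_d A a u).
Proof.
case: a => [e|l] /=; last by rewrite /monom gmap_gderiv.
apply/ffunP => B; rewrite !ffunE /= /mulXn; apply/polyP => i.
rewrite coef_map !coefMXn !coefC; case: ifP => _; first exact: raddf0.
by case: ifP => _ //; exact: raddf0.
Qed.

Lemma monom_ds n u : sd_d H (inl None) (monom n u) = monom n.-1 (u *+ n).
Proof.
apply/ffunP => B; rewrite !ffunE ffunMnE /= /mulXn.
by rewrite derivM derivC mul0r add0r derivXn polyCMn mulrnAr mulrnAl.
Qed.

Lemma monom_sig n (b : bool) u : twist b (monom n u) = monom n (twist b u).
Proof. by case: b => //=; rewrite /monom gmap_gsign. Qed.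

Lemma sum_emb (V : nmodType) (F : option E + 'I_q -> V) :
  \sum_i F i = \sum_a F (emb a) + F (inl None).
Proof.
rewrite !big_sumType /= addrAC; congr (_ + _).
rewrite (bigD1 None) //= addrC; congr (_ + _).
rewrite (reindex_omap Some id) /=; last by case.
by apply: eq_bigl => e; rewrite eqxx.
Qed.

Section Pencil.
Variables (S : I -> I -> A) (gam : I -> A) (theta : A).
Local Notation par := (@spar E q).
Local Notation d := (sd_d A).
Hypothesis hom_S : forall a b, homog (~~ (par a (+) par b)) (S a b).
Hypothesis hom_gam : forall a, homog (~~ par a) (gam a).
Hypothesis hom_theta : homog true theta.
Hypothesis symS : forall a b, S a b = sg (par a && par b) (S b a).

(** The index set of (x, s) has two forms: [option E + 'I_q] is the one of a
    Grassmann algebra over polynomials, and [option I] singles out s. *)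
Definition xindex (i : option E + 'I_q) : option I :=
  match i with
  | inl (Some e) => Some (inl e)
  | inl None => None
  | inr l => Some (inr l)
  end.

Definition xdeg (i : option I) : nat := ~~ i.
Definition xpar (i : option I) : bool := if i is Some a then par a else false.

(** The coefficients of the matrix of the long bracket in the variables (x, s),
    without their powers of s. The minus sign of [gam] is that of
    t ds/dt = - s. *)
Definition ext (i j : option I) : A :=
  match i, j with
  | Some a, Some b => S a b
  | Some a, None | None, Some a => - gam a
  | None, None => theta
  end.

Definition extS i j : H :=
  monom (xdeg (xindex i) + xdeg (xindex j)) (ext (xindex i) (xindex j)).

Definition ext_divS a : A := \sum_b d b (S b a) - gam a.
Definition divgam : A := \sum_a d a (gam a).

(** Twice the canonical pencil in weight [w = - n]: here 2 w - 1 = - (2 n + 1)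
    and w (w - 1) = n (n + 1). *)
Definition pencil n u : A :=
  \sum_a \sum_b S a b * d b (d a u)
  + \sum_a (\sum_b d b (S b a) - gam a *+ n.*2.+1) * d a u
  - (divgam * u) *+ n + (theta * u) *+ (n * n.+1).

(** The effect of [nabla] for the matrix [extS] on a density of weight [- m]. *)
Definition ext_nabla (k : option I) m u : A :=
  match k with
  | Some a => \sum_b S a b * d b u - gam a * u *+ m
  | None => - (\sum_a gam a * d a u) + theta * u *+ m
  end.

Lemma xpar_index i : xpar (xindex i) = spar i.
Proof. by case: i => [[e|]|l]. Qed.

Lemma xindex_emb a : xindex (emb a) = Some a.
Proof. by case: a. Qed.

Lemma hom_monom n (b : bool) u : homog b u -> homog b (monom n u : H).
Proof.
by rewrite /homog => hu; rewrite -sg_additive -hu; exact: (monom_sig n true u).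
Qed.

Lemma hom_ext i j : homog (~~ (xpar i (+) xpar j)) (ext i j).
Proof.
case: i j => [a|] [b|] //=; rewrite /homog ?rmorphN /= ?addbF ?hom_gam ?sgN ?opp_sg //.
Qed.

Lemma sym_ext i j : ext i j = sg (xpar i && xpar j) (ext j i).
Proof. by case: i j => [a|] [b|] //=; rewrite ?andbF. Qed.

Lemma hom_extS i j : homog (~~ (spar i (+) spar j)) (extS i j).
Proof. by rewrite -!xpar_index; exact/hom_monom/hom_ext. Qed.

Lemma sym_extS i j : extS i j = sg (spar i && spar j) (extS j i).
Proof. by rewrite /extS sym_ext sg_additive !xpar_index addnC. Qed.

(** At m = 0 both sides vanish, so that truncation of [m.-1] is harmless. *)
Lemma monom_pred n m u : monom (n.+1 + m.-1) (u *+ m) = monom (n + m) (u *+ m).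
Proof. by case: m => [|m]; rewrite ?mulr0n ?raddf0 // addSnnS. Qed.

Lemma monom_nabla k m u : nabla extS k (monom m u) =
  monom (xdeg (xindex k) + m) (ext_nabla (xindex k) m u).
Proof.
rewrite /nabla sum_emb /extS monom_ds monomM mulrnAr /=.
under eq_bigr => b _ do rewrite monom_d xindex_emb monomM addn0.
rewrite -raddf_sum addn1 monom_pred -raddfD /=; congr monom.
case: (xindex k) => [a|] /=; first by rewrite mulNr mulNrn.
by rewrite -sumrN; congr (_ + _); apply: eq_bigr => a _; rewrite mulNr.
Qed.

Lemma monom_bracket f g : bracket extS (monom 0 f) (monom 0 g) = monom 0 (bracket S f g).
Proof.
have ds0 u : sd_d H (inl None) (monom 0 u) = 0 by rewrite monom_ds mulr0n raddf0.
rewrite /bracket sum_emb [X in _ + X]big1 ?addr0; last first.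
  by move=> j _; rewrite ds0 !mulr0.
rewrite raddf_sum; apply: eq_bigr => a _.
rewrite raddf_sum sum_emb monom_sig ds0 mul0r mulr0 addr0; apply: eq_bigr => b _.
rewrite -!xpar_index xindex_emb !monom_d /extS !xindex_emb !monomM /=.
by [].
Qed.

Lemma divS_emb a : divS extS (emb a) = monom 0 (ext_divS a).
Proof.
rewrite /divS sum_emb /extS xindex_emb monom_ds /= mulr1n raddfD raddf_sum /=.
by congr (_ + _); apply: eq_bigr => b _; rewrite xindex_emb monom_d.
Qed.

Lemma divS_s : divS extS (inl None) = monom 1 (theta *+ 2 - divgam).
Proof.
rewrite /divS sum_emb /extS monom_ds /= addrC [RHS]raddfD; congr (_ + _).
rewrite /divgam [RHS]raddfN raddf_sum -sumrN; apply: eq_bigr => b _.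
by rewrite xindex_emb monom_d /= -!raddfN.
Qed.

(* The additive identity to which [monom_laplace] reduces. *)
Let regroup (V : zmodType) (v g x e t g' y : V) :
  v - g + (x - e) + (t - g' + (- g' + y)) = t + (v - g - g' - g') - e + (x + y).
Proof.
rewrite addrACA [X in X + _ = _]addrCA [x - _]addrC.
by rewrite [X in _ + X]addrACA [- e - _]addrC !addrA.
Qed.

(** In the variables (x, s) the pencil is the operator in divergence form: the
    coefficients of the pencil are precisely those produced by differentiating
    the powers of s. *)
Lemma monom_laplace n u : laplace extS (monom n u) = monom n (pencil n u).
Proof.
have T1 a : \sum_j extS (emb a) j * sd_d H j (sd_d H (emb a) (monom n u)) =
    monom n (\sum_b S a b * d b (d a u) - (gam a * d a u) *+ n).
  rewrite sum_emb raddfD raddf_sum /=; congr (_ + _).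
    by apply: eq_bigr => b _; rewrite !monom_d /extS !xindex_emb monomM.
  by rewrite monom_d monom_ds /extS !xindex_emb monomM mulrnAr (monom_pred 0) /=
    mulNr mulNrn.
have T2 a :
    extS (inl None) (emb a) * sd_d H (emb a) (sd_d H (inl None) (monom n u)) =
    monom n (- (gam a * d a u) *+ n).
  by rewrite monom_ds monom_d /extS !xindex_emb monomM raddfMn mulrnAr (monom_pred 0) mulNr.
have T3 : divS extS (inl None) * sd_d H (inl None) (monom n u) =
    monom n ((theta * u) *+ (2 * n) - (divgam * u) *+ n).
  rewrite divS_s monom_ds monomM mulrnAr (monom_pred 0) mulrBl mulrnBl mulrnAl -mulrnA.
  by [].
have T4 m : extS (inl None) (inl None) *
    sd_d H (inl None) (sd_d H (inl None) (monom m u)) =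
    monom m ((theta * u) *+ (m * m.-1)).
  rewrite monom_ds monom_ds /extS monomM /=.
  case: m => [|[|m]]; rewrite ?mulr0n ?mulr0 ?muln0 ?mulr0n ?raddf0 //=.
  by rewrite -mulrnA mulrnAr.
have T0 a : divS extS (emb a) * sd_d H (emb a) (monom n u) =
    monom n (ext_divS a * d a u).
  by rewrite divS_emb monom_d monomM.
rewrite (laplaceE hom_extS) !sum_emb T3 T4.
rewrite (eq_bigr _ (fun a _ => T0 a)) (eq_bigr _ (fun a _ => T1 a)).
rewrite (eq_bigr _ (fun a _ => T2 a)).
rewrite -!raddf_sum -!raddfD; congr monom; rewrite /pencil.
have -> : (n * n.+1 = 2 * n + n * n.-1)%N.
  by clear; case: n => // n; rewrite /= [(2 * _)%N]mulnC -mulnDr.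
have -> : n.*2.+1 = (1 + n + n)%N by rewrite -addnn.
pose G := \sum_a gam a * d a u; pose W := \sum_a (\sum_b d b (S b a)) * d a u.
have E1 : \sum_a (\sum_b d b (S b a) - gam a) * d a u = W - G.
  by rewrite -sumrB; apply: eq_bigr => a _; rewrite mulrBl.
have E2 : \sum_a (\sum_b S a b * d b (d a u) - gam a * d a u *+ n) =
    \sum_a \sum_b S a b * d b (d a u) - G *+ n.
  by rewrite sumrB sumrMnl.
have E3 : \sum_a - (gam a * d a u) *+ n = - (G *+ n).
  by rewrite sumrMnl sumrN mulNrn.
have E4 : \sum_a (\sum_b d b (S b a) - gam a *+ (1 + n + n)) * d a u =
    W - G - G *+ n - G *+ n.
  rewrite -!addrA -!opprD addrA -!mulrS -mulrnDr -sumrMnl -sumrB.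
  by apply: eq_bigr => a _; rewrite mulrBl mulrnAl.
rewrite E1 E2 E3 E4 [in RHS]mulrnDr; exact: regroup.
Qed.

(** The Jacobi identity for the coordinates x^a and s, coefficient of the common
    power of s. *)
Hypothesis jac_ext : forall i j k : option I,
  sg (xpar i && xpar k)
     (ext_nabla k (xdeg i + xdeg j) (twist (xpar k) (ext i j)))
  + sg (xpar k && xpar j)
     (ext_nabla j (xdeg k + xdeg i) (twist (xpar j) (ext k i)))
  + sg (xpar j && xpar i)
     (ext_nabla i (xdeg j + xdeg k) (twist (xpar i) (ext j k))) = 0.

Lemma jac_extS i j k :
  sg (spar i && spar k) (nabla extS k (twist (spar k) (extS i j)))
  + sg (spar k && spar j) (nabla extS j (twist (spar j) (extS k i)))
  + sg (spar j && spar i) (nabla extS i (twist (spar i) (extS j k))) = 0.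
Proof.
rewrite /extS !monom_sig -/extS !monom_nabla -!xpar_index.
set i' := xindex i; set j' := xindex j; set k' := xindex k.
have rot (x y z : nat) : (x + (y + z) = y + (z + x))%N by rewrite addnCA [(x + z)%N]addnC.
have Ej x : monom (xdeg j' + (xdeg k' + xdeg i')) x =
    monom (xdeg k' + (xdeg i' + xdeg j')) x :> H by rewrite rot.
have Ei x : monom (xdeg i' + (xdeg j' + xdeg k')) x =
    monom (xdeg k' + (xdeg i' + xdeg j')) x :> H by rewrite rot rot.
by rewrite Ej Ei -!sg_additive -!raddfD jac_ext raddf0.
Qed.

(** The component along d_a of the field L^2. It has weight 0, like the
    divergence [ext_divS a] from which it is obtained by applying L. *)
Definition ham a : A := pencil 0 (ext_divS a).

Lemma monomI n u v : monom n u = monom n v -> u = v.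
Proof.
by move=> h; apply: subr0_eq; apply: (@monom_inj n); rewrite raddfB /= h subrr.
Qed.

Lemma monom_ham a : laplace extS (divS extS (emb a)) = monom 0 (ham a).
Proof. by rewrite divS_emb monom_laplace. Qed.

Lemma hom_ham a : homog (par a) (ham a).
Proof.
have := hom_laplaceV hom_extS (emb a).
rewrite monom_ham -xpar_index xindex_emb /homog -sg_additive => h.
by apply: (@monomI 0); rewrite -h -(monom_sig 0 true).
Qed.

(** The s-component of L^2 is - s times the divergence of the [ham a] because
    the whole field is divergence-free; applied to u s^n it gives a factor n. *)
Lemma pencil_pencil n u : pencil n (pencil n u) =
  \sum_a ham a * d a u - ((\sum_a sg (par a) (d a (ham a))) * u) *+ n.
Proof.
have D := divergence_laplaceV hom_extS sym_extS jac_extS.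
have := laplace_laplace hom_extS sym_extS jac_extS (monom n u).
rewrite !monom_laplace !sum_emb divS_s monom_laplace in D *.
(* [y] is the coefficient of s in the s-component of L^2. *)
set y := pencil 1 _ in D *.
rewrite !monom_ds mulr1n in D *.
have Dy : y = - \sum_a sg (par a) (d a (ham a)).
  apply/eqP; rewrite -addr_eq0 addrC; apply/eqP; apply: (@monomI 0).
  rewrite raddf0 -[RHS]D raddfD raddf_sum; congr (_ + _).
  apply: eq_bigr => a _.
  by rewrite monom_ham monom_d sg_additive -xpar_index xindex_emb.
rewrite (eq_bigr (fun a => monom n (ham a * d a u))); last first.
  by move=> a _; rewrite monom_ham monom_d monomM.
rewrite monomM mulrnAr (monom_pred 0) -raddf_sum -raddfD => /monomI ->.
by rewrite Dy mulNr mulNrn.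
Qed.

Lemma pencil_pencil_bracket f g :
  pencil 0 (pencil 0 (bracket S f g)) =
  bracket S (pencil 0 (pencil 0 f)) g + bracket S f (pencil 0 (pencil 0 g)).
Proof.
have LL t : monom 0 (pencil 0 (pencil 0 t)) = laplace extS (laplace extS (monom 0 t)).
  by rewrite !monom_laplace.
apply: (@monomI 0); apply: (etrans (LL _)).
rewrite -monom_bracket (laplace2_bracket hom_extS sym_extS jac_extS) -!LL !monom_bracket.
exact: (esym (raddfD _ _ _)).
Qed.

End Pencil.
End Homogeneous.

(** * From integral to real weights *)

Lemma poly_negnat_roots (R : numDomainType) (P : {poly R}) :
  (forall n : nat, P.[- n%:R] = 0) -> P = 0.
Proof.
move=> h; apply/eqP; apply: contraT => P0.
have := @max_poly_roots R P [seq - n%:R | n <- iota 0 (size P)] P0.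
rewrite size_map size_iota ltnn; apply.
  by apply/allP => _ /mapP[n _ ->]; apply/rootP.
rewrite map_inj_uniq ?iota_uniq // => m n /oppr_inj /eqP.
by rewrite eqr_nat => /eqP.
Qed.

Section Weights.
Variables (E : finType) (K : dring E) (q : nat) (R : numDomainType).
(** Weights are scalars of [R], embedded by [kappa] as constant functions. *)
Variable kappa : {rmorphism R -> K}.
Hypothesis d_kappa : forall e w, dr_d K e (kappa w) = 0.
Local Notation A := (grassmann_superdiff K q).
Local Notation I := (E + 'I_q)%type.
Local Notation d := (sd_d A).
Implicit Types (u v : A) (a b : I) (n : nat) (w : R).

Definition kscale w u : A := (kappa w *: (u : grassmann K q)).

Lemma kscale_sum w (J : finType) (F : J -> A) :
  kscale w (\sum_j F j) = \sum_j kscale w (F j).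
Proof. exact: scaler_sumr. Qed.

Lemma kscaleDr w u v : kscale w (u + v) = kscale w u + kscale w v.
Proof. exact: scalerDr. Qed.

Lemma kscaleNr w u : kscale w (- u) = - kscale w u.
Proof. exact: scalerN. Qed.

Lemma kscaleBl w w' u : kscale (w - w') u = kscale w u - kscale w' u.
Proof. by rewrite /kscale rmorphB; exact: scalerBl. Qed.

Lemma kscale1 u : kscale 1 u = u.
Proof. by rewrite /kscale rmorph1; exact: scale1r. Qed.

Lemma kscale_nat n u : kscale n%:R u = u *+ n.
Proof. by rewrite /kscale rmorph_nat; exact: scaler_nat. Qed.

Lemma kscaleNl w u : kscale (- w) u = - kscale w u.
Proof. by rewrite /kscale rmorphN; exact: scaleNr. Qed.

Lemma kscaleA w w' u : kscale w (kscale w' u) = kscale (w * w') u.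
Proof. by rewrite /kscale rmorphM; exact: scalerA. Qed.

Lemma kscale_mull w u v : kscale w u * v = kscale w (u * v).
Proof. by apply/esym; exact: (@scalerAl _ (grassmann K q)). Qed.

Lemma kscale_mulr w u v : u * kscale w v = kscale w (u * v).
Proof. by apply/esym; exact: (@scalerAr _ (grassmann K q)). Qed.

Lemma kscale_d w a u : d a (kscale w u) = kscale w (d a u).
Proof.
apply/ffunP => B; case: a => [k|l].
  by rewrite !ffunE /= /GRing.scale /= dr_dM d_kappa mul0r add0r.
rewrite /= [RHS]ffunE !gderivE /GRing.scale /= ffunE.
by case: ifP => _; rewrite ?mulr0 // sg_mulr.
Qed.

Variables (S : I -> I -> A) (gam : I -> A) (theta : A).

Definition pencilw w u : A :=
  \sum_a \sum_b S a b * d b (d a u)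
  + \sum_a (\sum_b d b (S b a) + kscale (2 * w - 1) (gam a)) * d a u
  + kscale w (\sum_a d a (gam a)) * u + kscale (w * (w - 1)) theta * u.

(** The coefficients of the pencil as a quadratic polynomial in the weight. *)
Definition pcoef0 u : A :=
  \sum_a \sum_b S a b * d b (d a u)
  + \sum_a (\sum_b d b (S b a) - gam a) * d a u.
Definition pcoef1 u : A :=
  \sum_a gam a * d a u *+ 2 + (\sum_a d a (gam a)) * u - theta * u.
Definition pcoef2 u : A := theta * u.

Lemma pencilwE w u :
  pencilw w u = pcoef0 u + kscale w (pcoef1 u) + kscale (w * w) (pcoef2 u).
Proof.
rewrite /pencilw /pcoef0 /pcoef1 /pcoef2 !kscaleDr kscaleNr !kscale_mull.
have -> : \sum_a (\sum_b d b (S b a) + kscale (2 * w - 1) (gam a)) * d a u =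
   \sum_a (\sum_b d b (S b a) - gam a) * d a u + kscale w (\sum_a gam a * d a u *+ 2).
  rewrite kscale_sum -big_split; apply: eq_bigr => a _ /=.
  rewrite kscaleBl kscale1 [kscale _ _ - _]addrC addrA mulrDl; congr (_ + _).
  by rewrite kscale_mull -kscale_nat kscaleA [2 * w]mulrC.
rewrite mulrBr mulr1 kscaleBl -!addrA; do 4!congr (_ + _).
by rewrite addrC.
Qed.

Lemma pencilw_nat n u : pencilw (- n%:R) u = pencil S gam theta n u.
Proof.
have e1 : 2 * - n%:R - 1 = - (n.*2.+1)%:R :> R.
  by rewrite -[in RHS]natr1 -mul2n natrM opprD mulrN.
have e2 : - n%:R * (- n%:R - 1) = (n * n.+1)%:R :> R.
  by rewrite natrM -natr1 -opprD mulrNN.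
rewrite /pencilw e1 e2 kscaleNl !kscale_nat mulNr !mulrnAl.
under [X in _ + X - _ + _]eq_bigr => a _ do rewrite kscaleNl kscale_nat.
by [].
Qed.

Lemma pcoef0_kscale w u : pcoef0 (kscale w u) = kscale w (pcoef0 u).
Proof.
rewrite /pcoef0 kscaleDr !kscale_sum; congr (_ + _); apply: eq_bigr => a _.
  by rewrite kscale_sum; apply: eq_bigr => b _; rewrite !kscale_d kscale_mulr.
by rewrite kscale_d kscale_mulr.
Qed.

Lemma pcoef1_kscale w u : pcoef1 (kscale w u) = kscale w (pcoef1 u).
Proof.
rewrite /pcoef1 !kscaleDr kscaleNr !kscale_sum !kscale_mulr; congr (_ + _ + _).
apply: eq_bigr => a _.
by rewrite kscale_d kscale_mulr -!kscale_nat !kscaleA mulrC.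
Qed.

Lemma pcoef2_kscale w u : pcoef2 (kscale w u) = kscale w (pcoef2 u).
Proof. exact: kscale_mulr. Qed.

Lemma pcoef0D u v : pcoef0 (u + v) = pcoef0 u + pcoef0 v.
Proof.
rewrite /pcoef0 [RHS]addrACA; congr (_ + _); rewrite -big_split; apply: eq_bigr => a _ /=.
  by rewrite -big_split; apply: eq_bigr => b _; rewrite !raddfD /= mulrDr.
by rewrite raddfD mulrDr.
Qed.

Lemma pcoef1D u v : pcoef1 (u + v) = pcoef1 u + pcoef1 v.
Proof.
rewrite /pcoef1 !mulrDr opprD [RHS]addrACA; congr (_ + _).
rewrite [RHS]addrACA; congr (_ + _); rewrite -big_split; apply: eq_bigr => a _ /=.
by rewrite raddfD mulrDr mulrnDl.
Qed.

Lemma pcoef2D u v : pcoef2 (u + v) = pcoef2 u + pcoef2 v.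
Proof. exact: mulrDr. Qed.

Lemma pencilw_kscale w r u : pencilw w (kscale r u) = kscale r (pencilw w u).
Proof.
rewrite !pencilwE pcoef0_kscale pcoef1_kscale pcoef2_kscale.
move: (pcoef0 u) (pcoef1 u) (pcoef2 u) => x y z.
by rewrite !kscaleDr !kscaleA [r * w]mulrC [r * _]mulrC.
Qed.

(** The functional [psi] reads off one scalar of a superfunction. With it the
    square of a quadratic family of operators becomes a polynomial over the
    ring of weights. *)
Lemma square_quadratic (psi : A -> R) (F : R -> A -> A) (f0 f1 f2 : A -> A) w u :
  (forall v v', psi (v + v') = psi v + psi v') ->
  (forall r v, psi (kscale r v) = r * psi v) ->
  {morph f0 : v v' / v + v'} -> {morph f1 : v v' / v + v'} ->
  {morph f2 : v v' / v + v'} ->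
  (forall r v, f0 (kscale r v) = kscale r (f0 v)) ->
  (forall r v, f1 (kscale r v) = kscale r (f1 v)) ->
  (forall r v, f2 (kscale r v) = kscale r (f2 v)) ->
  (forall r v, F r v = f0 v + kscale r (f1 v) + kscale (r * r) (f2 v)) ->
  psi (F w (F w u)) =
  psi (f0 (f0 u)) + w * (psi (f0 (f1 u)) + psi (f1 (f0 u))) +
  w ^+ 2 * (psi (f0 (f2 u)) + psi (f1 (f1 u)) + psi (f2 (f0 u))) +
  w ^+ 3 * (psi (f1 (f2 u)) + psi (f2 (f1 u))) + w ^+ 4 * psi (f2 (f2 u)).
Proof.
move=> psiD psi_kscale f0D f1D f2D f0s f1s f2s FE.
rewrite !FE !(f0D, f1D, f2D, f0s, f1s, f2s) !(psiD, psi_kscale).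
ring.
Qed.

Hypothesis hom_S : forall a b, homog (~~ (spar a (+) spar b)) (S a b).
Hypothesis hom_gam : forall a, homog (~~ spar a) (gam a).
Hypothesis hom_theta : homog true theta.
Hypothesis symS : forall a b, S a b = sg (spar a && spar b) (S b a).
Hypothesis jac_ext : forall i j k : option I,
  sg (xpar i && xpar k)
     (ext_nabla S gam theta k (xdeg i + xdeg j) (twist (xpar k) (ext S gam theta i j)))
  + sg (xpar k && xpar j)
     (ext_nabla S gam theta j (xdeg k + xdeg i) (twist (xpar j) (ext S gam theta k i)))
  + sg (xpar j && xpar i)
     (ext_nabla S gam theta i (xdeg j + xdeg k) (twist (xpar i) (ext S gam theta j k))) = 0.

Local Notation ham := (ham S gam theta).

(** The difference of the two sides is a polynomial in [w] which vanishes at all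
    non-positive integers by [pencil_pencil]. *)
Lemma pencilw_pencilw (psi : A -> R) w u :
  (forall v v', psi (v + v') = psi v + psi v') ->
  (forall r v, psi (kscale r v) = r * psi v) ->
  psi (pencilw w (pencilw w u)) =
  psi (\sum_a ham a * d a u + kscale w ((\sum_a sg (spar a) (d a (ham a))) * u)).
Proof.
move=> psiD psi_kscale; apply/eqP; rewrite -subr_eq0; apply/eqP.
set D := (\sum_a sg _ _) * u; set X := \sum_a _ * d a u.
pose c0 := psi (pcoef0 (pcoef0 u)) - psi X.
pose c1 := psi (pcoef0 (pcoef1 u)) + psi (pcoef1 (pcoef0 u)) - psi D.
pose c2 := psi (pcoef0 (pcoef2 u)) + psi (pcoef1 (pcoef1 u)) + psi (pcoef2 (pcoef0 u)).
pose c3 := psi (pcoef1 (pcoef2 u)) + psi (pcoef2 (pcoef1 u)).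
pose c4 := psi (pcoef2 (pcoef2 u)).
pose P := c0%:P + c1%:P * 'X + c2%:P * 'X^2 + c3%:P * 'X^3 + c4%:P * 'X^4.
have PE r : psi (pencilw r (pencilw r u)) - psi (X + kscale r D) = P.[r].
  rewrite [psi (X + _)]psiD psi_kscale.
  rewrite (square_quadratic r u psiD psi_kscale pcoef0D pcoef1D pcoef2D
    pcoef0_kscale pcoef1_kscale pcoef2_kscale pencilwE).
  by rewrite /P /c0 /c1 /c2 /c3 /c4 !(hornerD, hornerM, hornerC, hornerXn, hornerX); ring.
rewrite PE; suff -> : P = 0 by rewrite horner0.
apply: poly_negnat_roots => n; rewrite -PE !pencilw_nat pencil_pencil //.
by rewrite kscaleNl kscale_nat subrr.
Qed.

End Weights.

From mathcomp Require Import all_classical all_reals all_analysis.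

Import numFieldNormedType.Exports.
Local Open Scope classical_set_scope.

(** * Symmetry of mixed partial derivatives *)

Section DifferentiableLocal.
Variables (R : realType) (V W : normedModType R).
Implicit Types (f g : V -> W) (a : V).

Lemma near0_differentiable f a : (\forall y \near a, f y = 0) -> differentiable f a.
Proof.
move=> f0.
have E : f \o shift a = cst (f a) + (\0 : {linear V -> W}) +o_ (0 : V) id.
  apply/eqaddoP => e e0; near=> h.
  rewrite !fctE /= (nbhs_singleton f0) addr0 subr0.
  have -> : f (h + a) = 0.
    by near: h; have := f0; rewrite (near_shift 0 a) subr0; exact.
  by rewrite normr0 mulr_ge0 // ltW.
apply/diff_locallyP; have cst0 : continuous (\0 : {linear V -> W}) by exact: cst_continuous.
have Ed := diff_unique cst0 E; rewrite Ed; split => //.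
Unshelve. all: by end_near. Qed.

Lemma near_eq_differentiable f g a :
  (\forall y \near a, f y = g y) -> differentiable f a -> differentiable g a.
Proof.
move=> fg df; have -> : g = f + (g - f) by rewrite addrC subrK.
apply: differentiableD => //; apply: near0_differentiable.
by near do rewrite !fctE; near=> y; rewrite /= (near fg y) ?subrr.
Unshelve. all: by end_near. Qed.

End DifferentiableLocal.

Section MixedDerivatives.
Variables (R : realType) (V : normedModType R).
Implicit Types (f : V -> R) (x y u v : V) (h s t : R).

Lemma is_derive_line f y v s : derivable f (y + s *: v) v ->
  is_derive s 1 (fun r : R => f (y + r *: v)) ('D_v f (y + s *: v)).
Proof.
move=> df.
have E : (fun h : R => h^-1 *: (((fun r : R => f (y + r *: v)) \o shift s) (h *: (1 : R))
    - f (y + s *: v))) =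
  (fun h : R => h^-1 *: ((f \o shift (y + s *: v)) (h *: v) - f (y + s *: v))).
  apply/funext => h /=; congr (_ *: (f _ - _)).
  by rewrite /GRing.scale /= mulr1 -/(_ *: _) scalerDl addrCA.
by split; rewrite /derivable /derive E.
Qed.

(** The parallelogram spanned at [x] by [h *: u] and [h *: v]. *)
Definition in_square h x u v y :=
  exists s t, [/\ 0 <= s <= h, 0 <= t <= h & y = x + s *: u + t *: v].

(** Mean value theorem twice: first for the difference of [f] along the side
    [h *: v], as a function of the position on the side [h *: u], and then for
    'D_u f along [v]. *)
Lemma second_difference f x u v h : 0 < h ->
  (forall y, in_square h x u v y -> differentiable f y /\ differentiable ('D_u f) y) ->
  exists2 y, in_square h x u v y &
    f (x + h *: u + h *: v) - f (x + h *: u) - (f (x + h *: v) - f x) =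
    'D_v ('D_u f) y * h * h.
Proof.
move=> h0 good.
have sq s t : 0 <= s <= h -> 0 <= t <= h -> in_square h x u v (x + s *: u + t *: v).
  by move=> hs ht; exists s, t.
have h0h : 0 <= h <= h by apply/andP; split; [exact: ltW|exact: lexx].
have z0h : 0 <= (0:R) <= h by apply/andP; split; [exact: lexx|exact: ltW].
pose phi s := f (x + h *: v + s *: u) - f (x + s *: u).
pose dphi s := 'D_u f (x + h *: v + s *: u) - 'D_u f (x + s *: u).
have dphiP s : 0 <= s <= h -> is_derive s 1 phi (dphi s).
  move=> hs; apply: is_deriveB.
    apply: is_derive_line; apply: diff_derivable.
    by rewrite addrAC; exact: (good _ (sq _ _ hs h0h)).1.
  apply: is_derive_line; apply: diff_derivable.
  by have := (good _ (sq _ _ hs z0h)).1; rewrite scale0r addr0.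
have [s] : exists2 s, s \in `]0, h[%R & phi h - phi 0 = dphi s * (h - 0).
  apply: (@MVT R phi dphi 0 h h0).
    by move=> s; rewrite in_itv /= => /andP[/ltW a /ltW b]; apply: dphiP; rewrite a.
  apply: derivable_within_continuous => s; rewrite in_itv /= => hs.
  by have [] := dphiP s hs.
rewrite in_itv /= subr0 => /andP[/ltW s0 /ltW sh] E1.
have hs : 0 <= s <= h by rewrite s0.
pose psi t := 'D_u f (x + s *: u + t *: v).
pose dpsi t := 'D_v ('D_u f) (x + s *: u + t *: v).
have dpsiP t : 0 <= t <= h -> is_derive t 1 psi (dpsi t).
  move=> ht; apply: is_derive_line; apply: diff_derivable.
  exact: (good _ (sq _ _ hs ht)).2.
have [t] : exists2 t, t \in `]0, h[%R & psi h - psi 0 = dpsi t * (h - 0).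
  apply: (@MVT R psi dpsi 0 h h0).
    by move=> t; rewrite in_itv /= => /andP[/ltW a /ltW b]; apply: dpsiP; rewrite a.
  apply: derivable_within_continuous => t; rewrite in_itv /= => ht.
  by have [] := dpsiP t ht.
rewrite in_itv /= subr0 => /andP[/ltW t0 /ltW th] E2.
exists (x + s *: u + t *: v); first by apply: sq; rewrite ?s0 ?t0.
rewrite -/(dpsi t) -E2.
have -> : psi h - psi 0 = dphi s by rewrite /psi /dphi scale0r addr0 addrAC.
rewrite -E1 /phi !scale0r !addr0.
by rewrite [x + h *: v + _]addrAC.
Qed.

Lemma small_square x u v d : 0 < d -> exists2 h, 0 < h &
  forall y, in_square h x u v y -> ball_ Num.Def.normr x d y.
Proof.
move=> d0; have N0 : 0 < `|u| + `|v| + 1 :> R.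
  apply: ltr_wpDl; last exact: ltr01.
  exact: addr_ge0 (normr_ge0 _) (normr_ge0 _).
have h0 : 0 < d / (`|u| + `|v| + 1) by exact: divr_gt0.
exists (d / (`|u| + `|v| + 1)); first exact: h0.
move=> y [s [t [/andP[s0 sh] /andP[t0 th] ->]]] /=.
rewrite -addrA opprD addrA subrr add0r normrN.
apply: le_lt_trans (ler_normD _ _) _; rewrite !normrZ !ger0_norm //.
apply: (@le_lt_trans _ _ (d / (`|u| + `|v| + 1) * (`|u| + `|v|))).
  by rewrite mulrDr lerD // ler_wpM2r.
by rewrite mulrAC ltr_pdivrMr // ltr_pM2l // ltrDl.
Qed.

Lemma in_square_swap h x u v y : in_square h x v u y -> in_square h x u v y.
Proof. by move=> [s [t [a b ->]]]; exists t, s; split => //; rewrite addrAC. Qed.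

Let swap4 (a b c e : R) : a - b - (c - e) = a - c - (b - e).
Proof. ring. Qed.

Let dist_half (a b r : R) :
  `|b - r| < `|a - b| / 2 -> `|a - r| < `|a - b| / 2 -> False.
Proof.
move=> h1 h2; have : `|a - b| < `|a - b| / 2 + `|a - b| / 2.
  have {1}-> : a - b = (a - r) - (b - r) by ring.
  by apply: le_lt_trans (ler_normB _ _) _; rewrite ltrD.
by rewrite -splitr ltxx.
Qed.

(** The second difference is symmetric in [u] and [v], so that small
    parallelograms contain points where the two mixed derivatives take equal
    values; continuity excludes different limits at [x]. *)
Lemma derive_derive f x u v :
  (\forall y \near x, differentiable f y) ->
  (\forall y \near x, differentiable ('D_u f) y) ->
  (\forall y \near x, differentiable ('D_v f) y) ->
  {for x, continuous ('D_v ('D_u f))} -> {for x, continuous ('D_u ('D_v f))} ->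
  'D_u ('D_v f) x = 'D_v ('D_u f) x.
Proof.
move=> nf nu nv cu cv; apply/eqP; rewrite -subr_eq0; apply/negPn/negP => ne.
set e := `|'D_u ('D_v f) x - 'D_v ('D_u f) x|.
have e0 : 0 < e by rewrite normr_gt0.
have e20 : 0 < e / 2 by rewrite divr_gt0.
have nU : \forall y \near x, `|'D_v ('D_u f) x - 'D_v ('D_u f) y| < e / 2.
  exact: (@cvgr_dist_lt _ _ _ _ _ ('D_v ('D_u f)) _ cu _ e20).
have nV : \forall y \near x, `|'D_u ('D_v f) x - 'D_u ('D_v f) y| < e / 2.
  exact: (@cvgr_dist_lt _ _ _ _ _ ('D_u ('D_v f)) _ cv _ e20).
have [d /= d0 H] := (nbhs_normP x _).1
  (filterI nf (filterI nu (filterI nv (filterI nU nV)))).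
have [h h0 sqH] := small_square x u v d0.
have [y hy E1] := second_difference h0 (fun y hy =>
  conj (H y (sqH y hy)).1 (H y (sqH y hy)).2.1).
have [z hz E2] := second_difference h0 (fun y hy =>
  conj (H y (sqH y (in_square_swap hy))).1 (H y (sqH y (in_square_swap hy))).2.2.1).
have {E1 E2} E : 'D_v ('D_u f) y = 'D_u ('D_v f) z.
  apply: (mulIf (lt0r_neq0 h0)); apply: (mulIf (lt0r_neq0 h0)).
  apply: (etrans (esym E1)); apply: (etrans _ E2).
  rewrite [x + h *: v + _]addrAC; exact: swap4.
have h1 := (H y (sqH y hy)).2.2.2.1.
have h2 := (H z (sqH z (in_square_swap hz))).2.2.2.2.
rewrite E in h1; move: h1 h2; rewrite /e.
move: ('D_u ('D_v f) z) => r; exact: dist_half.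
Qed.

End MixedDerivatives.

(** * Smooth functions *)

Section Smooth.
Variables (R : realType) (p : nat).
Implicit Types (U : set 'rV[R]_p) (f g : 'rV[R]_p -> R) (k : 'I_p) (n : nat).

(** Smoothness of finite order, with the innermost derivative taken first:
    this is what allows inductions in which the partial derivative of a product
    or of a composite is a sum of products. *)
Fixpoint smooth_upto n U g : Prop :=
  (forall x, U x -> differentiable g x) /\
  if n is n'.+1 then forall k, smooth_upto n' U (partial k g) else True.

Lemma smooth_uptoP U g : smooth_on U g <-> forall n, smooth_upto n U g.
Proof.
split=> [h n|].
  elim: n g h => [|n IH] g h; split=> // x; first exact: (h [::]).
  - exact: (h [::]).
  - by apply: IH => s y Uy; have := h (rcons s x) y Uy; rewrite foldr_rcons.
move=> h s; elim/last_ind: s g h => [|s k IH] g h x Ux; first exact: (h 0%N).1.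
by rewrite foldr_rcons; apply: IH => // n; exact: (h n.+1).2.
Qed.

Lemma smooth_uptoW n U g : smooth_upto n.+1 U g -> smooth_upto n U g.
Proof.
elim: n g => [|n IH] g [h1 h2]; split => // k; exact/IH/h2.
Qed.

Lemma near_eq_partial k f g x :
  (\forall y \near x, f y = g y) -> partial k f x = partial k g x.
Proof. exact: near_eq_derive. Qed.

Lemma open_near U x : open U -> U x -> \forall y \near x, U y.
Proof. by move=> Uo Ux; apply: open_nbhs_nbhs. Qed.

Lemma smooth_upto_eq n U f g : open U -> (forall x, U x -> f x = g x) ->
  smooth_upto n U f -> smooth_upto n U g.
Proof.
move=> Uo; elim: n f g => [|n IH] f g fg [h1 h2]; split => //.
- move=> x Ux; apply: near_eq_differentiable (h1 x Ux).
  by apply: filterS (open_near Uo Ux) => y; exact: fg.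
- move=> x Ux; apply: near_eq_differentiable (h1 x Ux).
  by apply: filterS (open_near Uo Ux) => y; exact: fg.
move=> k; apply: IH (h2 k) => x Ux; apply: near_eq_partial.
by apply: filterS (open_near Uo Ux) => y; exact: fg.
Qed.

Lemma smooth_on_eq U f g : open U -> (forall x, U x -> f x = g x) ->
  smooth_on U f -> smooth_on U g.
Proof.
move=> Uo fg /smooth_uptoP h; apply/smooth_uptoP => n; exact: smooth_upto_eq (h n).
Qed.

Lemma partial_cst k (c : R) : partial k (cst c) = cst 0.
Proof. by apply/funext => x; rewrite /partial derive_cst. Qed.

Lemma partialD k f g x : differentiable f x -> differentiable g x ->
  partial k (f + g) x = partial k f x + partial k g x.
Proof. by move=> df dg; rewrite /partial deriveD //; exact: diff_derivable. Qed.

Lemma partialN k f x : differentiable f x -> partial k (- f) x = - partial k f x.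
Proof. by move=> df; rewrite /partial deriveN //; exact: diff_derivable. Qed.

Lemma partialM k f g x : differentiable f x -> differentiable g x ->
  partial k (f * g) x = partial k f x * g x + f x * partial k g x.
Proof.
move=> df dg; rewrite /partial deriveM; try exact: diff_derivable.
by rewrite addrC /GRing.scale /= [g x * _]mulrC.
Qed.

Lemma smooth_upto_cst n U (c : R) : smooth_upto n U (cst c).
Proof.
elim: n c => [|n IH] c; (split; first by move=> x _; exact: differentiable_cst) => // k.
by rewrite partial_cst.
Qed.

Lemma smooth_uptoD n U f g : open U ->
  smooth_upto n U f -> smooth_upto n U g -> smooth_upto n U (f + g).
Proof.
move=> Uo; elim: n f g => [|n IH] f g [f1 f2] [g1 g2];
  (split; first by move=> x Ux; apply: differentiableD; [exact: f1|exact: g1]) => // k.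
apply: smooth_upto_eq (IH _ _ (f2 k) (g2 k)) => // x Ux.
by rewrite partialD; [|exact: f1|exact: g1].
Qed.

Lemma smooth_uptoN n U f : open U -> smooth_upto n U f -> smooth_upto n U (- f).
Proof.
move=> Uo; elim: n f => [|n IH] f [f1 f2];
  (split; first by move=> x Ux; apply: differentiableN; exact: f1) => // k.
by apply: smooth_upto_eq (IH _ (f2 k)) => // x Ux; rewrite partialN//; exact: f1.
Qed.

Lemma smooth_uptoM n U f g : open U ->
  smooth_upto n U f -> smooth_upto n U g -> smooth_upto n U (f * g).
Proof.
move=> Uo; elim: n f g => [|n IH] f g hf hg;
  (split; first by move=> x Ux; apply: differentiableM; [exact: hf.1|exact: hg.1]) => // k.
have h : smooth_upto n U (partial k f * g + f * partial k g).
  apply: smooth_uptoD => //; apply: IH; try exact: smooth_uptoW.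
    exact: hf.2.
  exact: hg.2.
apply: smooth_upto_eq h => // x Ux.
by rewrite partialM; [|exact: hf.1|exact: hg.1].
Qed.

Lemma smooth_on_cst U c : smooth_on U (cst c).
Proof. by apply/smooth_uptoP => n; exact: smooth_upto_cst. Qed.

Lemma smooth_onD U f g : open U ->
  smooth_on U f -> smooth_on U g -> smooth_on U (f + g).
Proof.
move=> Uo /smooth_uptoP hf /smooth_uptoP hg; apply/smooth_uptoP => n.
exact: smooth_uptoD.
Qed.

Lemma smooth_onN U f : open U -> smooth_on U f -> smooth_on U (- f).
Proof.
by move=> Uo /smooth_uptoP hf; apply/smooth_uptoP => n; exact: smooth_uptoN.
Qed.

Lemma smooth_onM U f g : open U ->
  smooth_on U f -> smooth_on U g -> smooth_on U (f * g).
Proof.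
move=> Uo /smooth_uptoP hf /smooth_uptoP hg; apply/smooth_uptoP => n.
exact: smooth_uptoM.
Qed.

Lemma smooth_on_partial U k f : smooth_on U f -> smooth_on U (partial k f).
Proof. by move=> h s x Ux; have := h (rcons s k) x Ux; rewrite foldr_rcons. Qed.

Lemma smooth_on_differentiable U f x : smooth_on U f -> U x -> differentiable f x.
Proof. by move=> h; exact: (h [::]). Qed.

Lemma smooth_on_sub U U' f : U' `<=` U -> smooth_on U f -> smooth_on U' f.
Proof. by move=> s h l x /s; exact: h. Qed.

Lemma partial_coord k l x : partial k (fun y : 'rV[R]_p => y 0 l) x = (k == l)%:R.
Proof.
rewrite /partial; apply: cvg_lim => //; apply: cvg_near_cst.
near=> h; rewrite /= !mxE eqxx /= addrK /GRing.scale /= mulrA mulVf.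
  by rewrite mul1r eq_sym.
by near: h; exact: nbhs_dnbhs_neq.
Unshelve. all: by end_near. Qed.

Lemma smooth_on_coord U l : smooth_on U (fun y : 'rV[R]_p => y 0 l).
Proof.
apply/smooth_uptoP; case=> [|n];
  (split; first by move=> x _; exact: differentiable_coord) => // k.
have -> : partial k (fun y : 'rV[R]_p => y 0 l) = cst ((k == l)%:R).
  by apply/funext => x; rewrite partial_coord.
exact: smooth_upto_cst.
Qed.

Lemma partialC U k l f x : open U -> smooth_on U f -> U x ->
  partial k (partial l f) x = partial l (partial k f) x.
Proof.
move=> Uo fU Ux; have nU := open_near Uo Ux.
apply: derive_derive.
- by apply: filterS nU => y; exact: smooth_on_differentiable.
- by apply: filterS nU => y; exact/smooth_on_differentiable/smooth_on_partial.
- by apply: filterS nU => y; exact/smooth_on_differentiable/smooth_on_partial.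
- apply: differentiable_continuous; apply: smooth_on_differentiable Ux.
  exact/(smooth_on_partial l)/(smooth_on_partial k).
- apply: differentiable_continuous; apply: smooth_on_differentiable Ux.
  exact/(smooth_on_partial k)/(smooth_on_partial l).
Qed.

End Smooth.

(** * Bump functions *)

Section Flat.
Variable R : realType.
Implicit Types (x y : R) (k : nat).

(** The functions x^(-k) exp(-1/x), continued by 0 to x <= 0. The derivative of
    one is a combination of others, so that all of them are shown to be smooth
    by one induction, uniform in [k]. *)
Definition flat k x : R := if 0 < x then x^-1 ^+ k * expR (- x^-1) else 0.

(** The term of degree k+2 in the exponential series of 1/x gives decay of
    second order at 0, which makes the derivative there zero. *)
Lemma flat_le k x : `|flat k x| <= k.+2`!%:R * x ^+ 2.
Proof.
rewrite /flat; case: ifPn => [x0|_]; last by rewrite normr0 mulr_ge0 // sqr_ge0.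
have y0 : 0 < x^-1 by rewrite invr_gt0.
rewrite ger0_norm; last by rewrite mulr_ge0 ?expR_ge0 // exprn_ge0 // ltW.
rewrite expRN ler_pdivrMr ?expR_gt0 //.
have h := expR_ge1Dxn k.+1 (ltW y0).
have {h} : x^-1 ^+ k.+2 / k.+2`!%:R <= expR x^-1 by apply: le_trans h; rewrite lerDr.
rewrite ler_pdivrMr ?ltr0n ?fact_gt0 // => h.
have -> : x^-1 ^+ k = x ^+ 2 * x^-1 ^+ k.+2.
  by rewrite (exprD _ 2 k) mulrA -exprMn divff ?gt_eqF // expr1n mul1r.
  by rewrite [leRHS]mulrAC [leRHS]mulrC ler_pM2l ?exprn_gt0 // mulrC.
Qed.

Lemma flat0 k : flat k 0 = 0.
Proof. by rewrite /flat ltxx. Qed.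

Lemma is_derive_flat k x :
  is_derive x 1 (flat k) (flat k.+2 x - k%:R * flat k.+1 x).
Proof.
have [x0|x0|->] := ltgtP x 0.
- have E : {near x, cst 0 =1 flat k}.
    near=> y; rewrite /flat ltNge ltW //; near: y; exact: lt_nbhsl.
  have -> : flat k.+2 x - k%:R * flat k.+1 x = 0.
    by rewrite /flat ltNge ltW //= mulr0 subr0.
  apply: (near_eq_is_derive E).
- have xn0 : x != 0 by rewrite gt_eqF.
  have E : {near x, (GRing.inv ^+ k * (expR \o (- GRing.inv)) : R -> R) =1 flat k}.
    by near=> y; rewrite /flat (_ : 0 < y) ?fctE //; near: y; exact: lt_nbhsr.
  apply: (near_eq_is_derive E).
  have dinv : is_derive x 1 (GRing.inv : R -> R) (- x ^- 2).
    by have := is_deriveV xn0 (is_derive_id x 1); rewrite /GRing.scale /= mulr1; exact.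
  apply: is_derive_eq; rewrite /flat x0 !fctE.
  rewrite /GRing.scale /= -exprVn; case: k E => [|k] _ /=; first by ring.
  by rewrite !exprS; move: (x^-1 ^+ k) (k.+1%:R) => z c; ring.
- rewrite !flat0 mulr0 subr0.
  suff : (fun h : R => h^-1 *: ((flat k \o shift 0) (h *: 1) - flat k 0)) @ 0^' --> (0 : R).
    by move=> h; split; [apply/cvg_ex; exists 0|apply: cvg_lim].
  apply/cvgrPdist_le => e e0; near=> h.
  rewrite sub0r normrN /= flat0 subr0 addr0 /GRing.scale /= mulr1 normrM normfV.
  have hn0 : 0 < `|h| by rewrite normr_gt0; near: h; exact: nbhs_dnbhs_neq.
  rewrite mulrC ler_pdivrMr //; apply: le_trans (flat_le _ _) _.
  rewrite -real_normK ?num_real // expr2 mulrA ler_pM2r // -ler_pdivlMl ?ltr0n ?fact_gt0 //.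
  near: h; apply: dnbhs0_le.
  by rewrite mulr_gt0 // invr_gt0 ltr0n fact_gt0.
Unshelve. all: by end_near. Qed.

Lemma flat_ge1 x : 1 <= x -> 1 <= expR 1 * flat 0 x.
Proof.
move=> x1; have x0 : 0 < x by apply: lt_le_trans x1.
rewrite /flat x0 expr0 mul1r -expRD -[X in X <= _]expR0 ler_expR.
by rewrite subr_ge0 invf_le1.
Qed.

(** The value e exp(-1/y) is 1 at y = 1 and at least 1 beyond. The inner use
    turns this into an argument which is 1 for x <= 1 and non-positive for
    x >= 2. *)
Definition plateau x : R := expR 1 * flat 0 (1 - expR 1 * flat 0 (x - 1)).

Lemma plateau1 x : x <= 1 -> plateau x = 1.
Proof.
move=> x1; rewrite /plateau {2}/flat ltNge subr_le0 x1 /= mulr0 subr0.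
by rewrite /flat ltr01 expr0 mul1r invr1 -expRD subrr expR0.
Qed.

Lemma plateau0 x : 2 <= x -> plateau x = 0.
Proof.
move=> x2; rewrite /plateau /flat ltNge subr_le0 flat_ge1 /= ?mulr0 //.
by rewrite lerBrDr -(natrD _ 1 1).
Qed.

End Flat.

Section SmoothFlat.
Variables (R : realType) (p : nat) (U : set 'rV[R]_p).
Hypothesis Uo : open U.

Lemma smooth_on_flat f k : smooth_on U f -> smooth_on U (flat k \o f).
Proof.
move=> fU; apply/smooth_uptoP => n.
have fU' m : smooth_upto m U f by move: m; exact/smooth_uptoP.
have dflat j y : differentiable (flat j : R -> R) y.
  by apply/derivable1_diffP; have [] := is_derive_flat j y.
have df x : U x -> differentiable f x by exact: smooth_on_differentiable.
elim: n k => [|n IH] k; (split; first by move=> x Ux;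
  apply: differentiable_comp; [exact: df|exact: dflat]) => // l.
have h : smooth_upto n U
    ((flat k.+2 \o f - cst (k%:R) * (flat k.+1 \o f)) * partial l f).
  apply: smooth_uptoM => //; last exact: (fU' n.+1).2.
  apply: smooth_uptoD => //; apply: smooth_uptoN => //.
  by apply: smooth_uptoM => //; exact: smooth_upto_cst.
apply: smooth_upto_eq h => // x Ux.
rewrite /partial deriveE; last by apply: differentiable_comp; [exact: df|exact: dflat].
rewrite diff_comp; [|exact: df|exact: dflat].
rewrite /= diff1E; last exact: dflat.
rewrite -deriveE; last exact: df.
by rewrite derive1E (@derive_val _ _ _ _ _ _ _ (is_derive_flat k (f x))) mulrC.
Qed.

Lemma smooth_on_plateau f : smooth_on U f -> smooth_on U (@plateau R \o f).
Proof.
move=> fU.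
have h1 : smooth_on U (f - cst 1).
  by apply: smooth_onD => //; apply: smooth_onN => //; exact: smooth_on_cst.
have h2 := smooth_on_flat 0 h1.
have h3 := smooth_onM Uo (@smooth_on_cst R p U (expR 1)) h2.
have h4 := smooth_onD Uo (@smooth_on_cst R p U 1) (smooth_onN Uo h3).
exact: smooth_onM Uo (@smooth_on_cst R p U (expR 1)) (smooth_on_flat 0 h4).
Qed.

End SmoothFlat.

Section Bump.
Variables (R : realType) (p : nat) (c : 'rV[R]_p).

Definition cube (e : R) : set 'rV[R]_p := [set y | forall k, `|y 0 k - c 0 k| <= e].

(** The factor 2 / e^2 is chosen so that the argument of [plateau] reaches 2 on
    the boundary of the cube, while it stays below 1 at distance e / 2. *)
Definition cube_bump (e : R) : 'rV[R]_p -> R :=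
  \prod_(k < p) (fun y : 'rV[R]_p => plateau (2 / e ^+ 2 * (y 0 k - c 0 k) ^+ 2)).

Lemma smooth_bump e : smooth_on setT (cube_bump e).
Proof.
rewrite /cube_bump; elim/big_ind: _ => [|f g|k _].
- exact: smooth_on_cst.
- exact/smooth_onM/openT.
have h : smooth_on setT ((fun y : 'rV[R]_p => y 0 k) - cst (c 0 k)).
  apply: (smooth_onD openT); first exact: smooth_on_coord.
  exact/(smooth_onN openT)/smooth_on_cst.
set g := (fun y : 'rV[R]_p => y 0 k) - cst (c 0 k) in h.
have hg := smooth_onM openT (@smooth_on_cst R p setT (2 / e ^+ 2)) (smooth_onM openT h h).
suff <- : @plateau R \o (cst (2 / e ^+ 2) * (g * g)) =
    (fun y : 'rV[R]_p => plateau (2 / e ^+ 2 * (y 0 k - c 0 k) ^+ 2)).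
  exact: (smooth_on_plateau openT hg).
by apply/funext => y; rewrite /= !fctE expr2.
Qed.

Lemma bump1 e : 0 < e -> \forall y \near c, cube_bump e y = 1.
Proof.
move=> e0; apply/nbhs_ballP; exists (e / 2); first by rewrite /= divr_gt0.
move=> y [_ cy]; rewrite /cube_bump fct_prodE big1 // => k _.
apply: plateau1; have := cy 0 k; rewrite /ball /= => /ltW h.
rewrite mulrAC ler_pdivrMr ?exprn_gt0 // mul1r.
rewrite -real_normK ?num_real // distrC.
apply: (@le_trans _ _ (2 * (e / 2) ^+ 2)).
  by rewrite ler_pM2l // lerXn2r // nnegrE ?divr_ge0 // ltW.
by have := exprn_gt0 2 e0; lra.
Qed.

Lemma bump_supp e y : 0 < e -> cube_bump e y != 0 -> cube e y.
Proof.
move=> e0 h k; rewrite leNgt; apply: contra h => h.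
rewrite /cube_bump fct_prodE (bigD1 k) //= plateau0 ?mul0r //.
rewrite mulrAC ler_pdivlMr ?exprn_gt0 // ler_pM2l //.
rewrite -[X in _ <= X]real_normK ?num_real // lerXn2r // ?nnegrE ?ltW //.
Qed.

Lemma cube_compact e : compact (cube e).
Proof.
have -> : cube e = [set y | forall k,
    (fun k => `[c 0 k - e, c 0 k + e]%classic) k (y ord0 k)].
  by apply/seteqP; split=> y /= h k; have := h k; rewrite in_itv /= -ler_distl.
apply: (@rV_compact _ _ (fun k => `[c 0 k - e, c 0 k + e]%classic)) => k.
exact: segment_compact.
Qed.

Lemma cube_subset U : open U -> U c -> exists2 e, 0 < e & cube e `<=` U.
Proof.
move=> Uo Uc; have /nbhs_ballP[e /= e0 h] := open_nbhs_nbhs (conj Uo Uc).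
exists (e / 2); first by rewrite divr_gt0.
move=> y cy; apply: h; split=> // i k; rewrite ord1 /ball /= distrC.
by apply: le_lt_trans (cy k) _; rewrite ltr_pdivrMr // ltr_pMr // ltr1n.
Qed.

End Bump.

(** * The differential ring of smooth functions *)

Section SmoothRing.
Variables (R : realType) (p : nat) (U : set 'rV[R]_p).
Local Notation W := (U°).

Definition smoothp : {pred 'rV[R]_p -> R} := [pred f | `[< smooth_on W f >]].

Lemma smoothpP f : reflect (smooth_on W f) (f \in smoothp).
Proof. exact: asboolP. Qed.

Let Wo : open W. Proof. exact: open_interior. Qed.

Fact smooth_subring_closed : subring_closed smoothp.
Proof.
split=> [|f g /smoothpP hf /smoothpP hg|f g /smoothpP hf /smoothpP hg]; apply/smoothpP.
- exact: smooth_on_cst.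
- exact/smooth_onD/smooth_onN.
- exact: smooth_onM.
Qed.

HB.instance Definition _ := GRing.isSubringClosed.Build _ smoothp smooth_subring_closed.

(** Functions on the whole space which are smooth in the interior of [U]; their
    values elsewhere are arbitrary. They form a subring of all functions, and
    the interior makes this meaningful for any set [U]. *)
Record smfun := SmFun { sm_val :> 'rV[R]_p -> R; _ : sm_val \in smoothp }.

HB.instance Definition _ := [isSub for sm_val].
HB.instance Definition _ := [Choice of smfun by <:].
HB.instance Definition _ := [SubChoice_isSubComNzRing of smfun by <:].

Lemma smfunP (f : smfun) : smooth_on W f.
Proof. exact/smoothpP/(valP f). Qed.

Lemma smfun_eq (f g : smfun) : (forall x, f x = g x) -> f = g.
Proof. by move=> fg; apply: val_inj; apply/funext. Qed.

Definition smeval (x : 'rV[R]_p) (f : smfun) : R := f x.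

Fact smeval_zmod_morphism x : zmod_morphism (smeval x).
Proof. by []. Qed.

Fact smeval_monoid_morphism x : monoid_morphism (smeval x).
Proof. by []. Qed.

HB.instance Definition _ x := GRing.isZmodMorphism.Build smfun R (smeval x)
  (smeval_zmod_morphism x).
HB.instance Definition _ x := GRing.isMonoidMorphism.Build smfun R (smeval x)
  (smeval_monoid_morphism x).

(** Outside the interior, derivatives are given the value 0. The Leibniz rule
    and commutation then hold at every point and not only where the functions
    are smooth. *)
Definition cutoff (f : 'rV[R]_p -> R) : 'rV[R]_p -> R :=
  fun x => if `[< W x >] then f x else 0.

Lemma cutoff_in f x : W x -> cutoff f x = f x.
Proof. by rewrite /cutoff => /asboolP ->. Qed.

Lemma cutoff_out f x : ~ W x -> cutoff f x = 0.
Proof. by rewrite /cutoff => /asboolPn/negbTE ->. Qed.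

Lemma smooth_cutoff f : smooth_on W f -> cutoff f \in smoothp.
Proof.
move=> fW; apply/smoothpP; apply: smooth_on_eq fW => // x Wx.
by rewrite cutoff_in.
Qed.

Definition restr f : smfun := insubd (0 : smfun) (cutoff f).

Lemma restrE f : smooth_on W f -> restr f = cutoff f :> ('rV[R]_p -> R).
Proof. by move=> fW; apply: insubdK; exact: smooth_cutoff. Qed.

Definition smpartial (k : 'I_p) (f : smfun) : smfun := restr (partial k f).

Lemma smpartialE k f : smpartial k f = cutoff (partial k f) :> ('rV[R]_p -> R).
Proof. by rewrite restrE //; apply/smooth_on_partial/smfunP. Qed.

Let smdiff (f : smfun) x : W x -> differentiable f x.
Proof. by move=> Wx; apply: smooth_on_differentiable Wx; exact: smfunP. Qed.

Fact smpartial_zmod_morphism k : zmod_morphism (smpartial k).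
Proof.
move=> f g; apply: smfun_eq => x.
rewrite -[RHS]/(smpartial k f x - smpartial k g x) !smpartialE.
case: (pselect (W x)) => Wx; last by rewrite !cutoff_out ?subrr.
rewrite !cutoff_in // -partialN; last exact: smdiff.
apply: partialD; first exact: smdiff.
by apply: differentiableN; exact: smdiff.
Qed.

HB.instance Definition _ k := GRing.isZmodMorphism.Build smfun smfun (smpartial k)
  (smpartial_zmod_morphism k).

Lemma smpartialM k (f g : smfun) :
  smpartial k (f * g) = smpartial k f * g + f * smpartial k g.
Proof.
apply: smfun_eq => x.
rewrite -[RHS]/(smpartial k f x * g x + f x * smpartial k g x) !smpartialE.
case: (pselect (W x)) => Wx; last by rewrite !cutoff_out // mul0r mulr0 addr0.
by rewrite !cutoff_in // -partialM //; exact: smdiff.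
Qed.

Lemma smpartialC k l (f : smfun) :
  smpartial k (smpartial l f) = smpartial l (smpartial k f).
Proof.
apply: smfun_eq => x.
have Ex j (h : smfun) y : smpartial j h y = cutoff (partial j h) y.
  by rewrite smpartialE.
apply: (etrans (Ex k _ x)); apply: (etrans _ (esym (Ex l _ x))).
case: (pselect (W x)) => Wx; last first.
  exact: (etrans (cutoff_out _ Wx) (esym (cutoff_out _ Wx))).
have E j (h : smfun) : \forall y \near x, smpartial j h y = partial j h y.
  apply: filterS (open_near Wo Wx) => y Wy.
  by apply: (etrans (Ex j h y)); exact: cutoff_in.
apply: (etrans (cutoff_in _ Wx)); apply: (etrans _ (esym (cutoff_in _ Wx))).
apply: (etrans (near_eq_partial k (E l f))).
apply: (etrans _ (esym (near_eq_partial l (E k f)))).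
exact: (partialC k l Wo (smfunP f) Wx).
Qed.

Lemma smfun_tf n (f : smfun) : f *+ n.+1 = 0 -> f = 0.
Proof.
move=> f0; apply: smfun_eq => x.
have /eqP : smeval x (f *+ n.+1) = 0 by rewrite f0.
by rewrite raddfMn mulrn_eq0 /= => /eqP.
Qed.

Definition smfun_dring : dring 'I_p :=
  @Dring _ smfun smpartial smpartialM smpartialC smfun_tf.

End SmoothRing.

(** * Superfunctions and the pencil in a chart *)

Section SuperSmooth.
Variables (R : realType) (p q : nat) (U : set 'rV[R]_p).
Local Notation W := (U°).
Local Notation K := (smfun_dring U).
Local Notation A := (grassmann_superdiff K q).
Implicit Types (h : superfun R p q) (u v : A) (x : 'rV[R]_p) (a : crd p q).

Let Wo : open W. Proof. exact: open_interior. Qed.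

Definition ev x : A -> grassmann R q := gmap (smeval x).

HB.instance Definition _ x := GRing.isZmodMorphism.Build A (grassmann R q) (ev x)
  (gmap_zmod_morphism (smeval x)).
HB.instance Definition _ x := GRing.isMonoidMorphism.Build A (grassmann R q) (ev x)
  (gmap_monoid_morphism q (smeval x)).

Lemma ev_sig x u : ev x (sd_sig A u) = gsign true (ev x u).
Proof. exact: (gmap_gsign (smeval x) true u). Qed.

Lemma ev_inj u v : (forall x, ev x u = ev x v) -> u = v.
Proof.
move=> h; apply/ffunP => B; apply: smfun_eq => x.
by have := congr1 (fun w : grassmann R q => w B) (h x); rewrite !ffunE.
Qed.

(** A superfunction in a chart is an arbitrary function on the whole space, of
    which only the values in the chart matter. The element [u] of the
    algebraic model represents it if these values agree. *)
Definition reps h u : Prop := forall x, W x -> h x = ev x u.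

(** The representative which vanishes outside the interior; identities between
    the values in the chart become identities in the ring. *)
Definition localize h : A := [ffun B => restr U (fun x => h x B)].

Lemma ev_localize_out h x : ~ W x -> ev x (localize h) = 0.
Proof.
move=> Wx; apply/ffunP => B; rewrite !ffunE /smeval /restr.
by rewrite val_insubd; case: ifP => _ //; rewrite cutoff_out.
Qed.

Lemma reps_localize h : ssmooth_on W h -> reps h (localize h).
Proof.
move=> hs x Wx; apply/ffunP => B; rewrite !ffunE /smeval restrE //.
by rewrite cutoff_in.
Qed.

Lemma reps_pd a h u : reps h u -> reps (pd a h) (sd_d A a u).
Proof.
move=> hu x Wx; case: a => [k|l] /=; last by rewrite (hu x Wx) /ev gmap_gderiv.
apply/ffunP => B; rewrite !ffunE /smeval smpartialE cutoff_in //.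
apply: near_eq_partial; apply: filterS (open_near Wo Wx) => y Wy.
by rewrite (hu y Wy) ffunE.
Qed.

Lemma reps_gsign b h u : reps h u -> reps (fun x => gsign b (h x)) (twist b u).
Proof.
move=> hu x Wx; rewrite (hu x Wx); case: b => /=; last by rewrite gsign0.
by rewrite ev_sig.
Qed.

Lemma ev_sg b x u : ev x (sg b u) = sg b (ev x u).
Proof. exact: sg_additive. Qed.

Lemma hom_localize b h : ssmooth_on W h -> (forall x, W x -> has_parity b (h x)) ->
  homog b (localize h).
Proof.
move=> hs hb; apply: ev_inj => x; rewrite ev_sg.
case: (pselect (W x)) => Wx.
  rewrite -(reps_gsign true (reps_localize hs) Wx) -(reps_localize hs Wx).
  apply/ffunP => B; rewrite gsignE /=.
  have := hb x Wx B; case: (odd #|B|); case: (b) => //= hB;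
    by rewrite ?[RHS]ffunE // hB // ?oppr0.
rewrite ev_sig ev_localize_out // raddf0.
by case: b hb; rewrite /= ?oppr0.
Qed.

Lemma has_parity_ev b u x : homog b u -> has_parity b (ev x u).
Proof.
move=> hu B oB.
have := congr1 (fun w => ev x w B) hu.
rewrite ev_sig ev_sg gsignE /= => E.
have : ev x u B *+ 2 = 0.
  rewrite mulr2n; move: oB E; case: (odd #|B|); case: (b) => //= _ E.
    by rewrite -{1}E addNr.
  by rewrite {1}E ffunE addNr.
by move=> /eqP; rewrite mulrn_eq0 /= => /eqP.
Qed.

Lemma ssmooth_ev u : ssmooth_on W (fun x => ev x u).
Proof.
move=> B; apply: smooth_on_eq (smfunP (u B)) => // x _.
by rewrite ffunE.
Qed.

End SuperSmooth.

Section Constants.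
Variables (R : realType) (p : nat) (U : set 'rV[R]_p).

Definition smconst (w : R) : smfun U :=
  SmFun (introT (smoothpP U (cst w)) (@smooth_on_cst R p _ w)).

Fact smconst_zmod_morphism : zmod_morphism smconst.
Proof. by move=> a b; apply: smfun_eq. Qed.

Fact smconst_monoid_morphism : monoid_morphism smconst.
Proof. by split=> [|a b]; apply: smfun_eq. Qed.

HB.instance Definition _ := GRing.isZmodMorphism.Build R (smfun U) smconst
  smconst_zmod_morphism.
HB.instance Definition _ := GRing.isMonoidMorphism.Build R (smfun U) smconst
  smconst_monoid_morphism.

Lemma smpartial_const k w : smpartial k (smconst w) = 0.
Proof.
apply: smfun_eq => x; rewrite smpartialE /cutoff /= partial_cst.
by case: ifP.
Qed.

End Constants.

(** The expressions of the pencil, the bracket and the Lie derivative in a chart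
    are represented by their algebraic counterparts. *)
Section LocalPencil.
Variables (R : realType) (p q : nat) (U : set 'rV[R]_p) (c : lb_coefs R p q).
Local Notation W := (U°).
Local Notation K := (smfun_dring U).
Local Notation A := (grassmann_superdiff K q).
Local Notation d := (sd_d A).
Local Notation ev := (@ev R p q U).
Local Notation localize := (@localize R p q U).
Implicit Types (u v : A) (w : R) (a b : crd p q) (x : 'rV[R]_p).

Hypothesis S_smooth : forall a b, ssmooth_on W (lb_S c a b).
Hypothesis gam_smooth : forall a, ssmooth_on W (lb_gamma c a).
Hypothesis theta_smooth : ssmooth_on W (lb_theta c).

Definition LS a b : A := localize (lb_S c a b).
Definition Lgam a : A := localize (lb_gamma c a).
Definition Ltheta : A := localize (lb_theta c).

Definition kap : {rmorphism R -> K} := smconst U.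
Local Notation kscale := (@kscale _ K q R kap).

Fact smconst_d k w : dr_d K k (kap w) = 0.
Proof. exact: smpartial_const. Qed.

Lemma ev_kscale x w u : ev x (kscale w u) = w *: ev x u.
Proof. by apply/ffunP => B; rewrite !ffunE. Qed.

Implicit Types (f g : superfun R p q).

Lemma reps_kscale w f u : reps f u -> reps (fun x => w *: f x) (kscale w u).
Proof. by move=> fu x Wx; rewrite (fu x Wx) ev_kscale. Qed.

Lemma reps_add f g u v : reps f u -> reps g v -> reps (fun x => f x + g x) (u + v).
Proof.
by move=> fu gv x Wx; rewrite (fu x Wx) (gv x Wx); exact: (esym (raddfD _ _ _)).
Qed.

Lemma reps_mul f g u v : reps f u -> reps g v -> reps (fun x => f x * g x) (u * v).
Proof.
by move=> fu gv x Wx; rewrite (fu x Wx) (gv x Wx); exact: (esym (rmorphM _ _ _)).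
Qed.

Lemma reps_sum (J : finType) (F : J -> superfun R p q) (G : J -> A) :
  (forall j, reps (F j) (G j)) -> reps (fun x => \sum_j F j x) (\sum_j G j).
Proof.
move=> FG x Wx; apply: (etrans _ (esym (raddf_sum _ _ _ _))).
by apply: eq_bigr => j _; exact: FG.
Qed.

Lemma reps_sg (b : bool) f u : reps f u -> reps (fun x => (-1) ^+ b * f x) (sg b u).
Proof. by move=> fu x Wx; rewrite (fu x Wx) -sgE ev_sg. Qed.

Let rS a b : reps (lb_S c a b) (LS a b) := reps_localize (S_smooth a b).
Let rg a : reps (lb_gamma c a) (Lgam a) := reps_localize (gam_smooth a).
Let rt : reps (lb_theta c) Ltheta := reps_localize theta_smooth.

Local Notation pencilw := (pencilw kap LS Lgam Ltheta).

Lemma reps_pencil w f u : reps f u -> reps (pencil_expr c w f) (kscale 2^-1 (pencilw w u)).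
Proof.
move=> fu; apply: reps_kscale; apply: reps_add; [apply: reps_add; [apply: reps_add|]|].
- apply: reps_sum => a; apply: reps_sum => b; apply: reps_mul => //.
  exact/reps_pd/reps_pd.
- apply: reps_sum => a; apply: reps_mul; last exact: reps_pd.
  by apply: reps_add; [apply: reps_sum => b; exact: reps_pd|exact: reps_kscale].
- by apply: reps_mul => //; apply: reps_kscale; apply: reps_sum => a; exact: reps_pd.
- by apply: reps_mul => //; exact: reps_kscale.
Qed.

Lemma reps_bracket f g u v : reps f u -> reps g v ->
  reps (fun_bracket_expr c f g) (bracket LS u v).
Proof.
move=> fu gv; apply: reps_sum => a; apply: reps_sum => b; apply: reps_mul => //.
by apply: reps_mul; apply: reps_pd => //; exact: reps_gsign.
Qed.

Local Notation ham := (ham LS Lgam Ltheta).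

(** The factor 1/4 is the square of the 1/2 in the definition of the pencil. *)
Definition hamcoef a : superfun R p q := fun x => ev x (kscale 4^-1 (ham a)).

Let rX a : reps (hamcoef a) (kscale 4^-1 (ham a)).
Proof. by []. Qed.

Lemma reps_vfield f u : reps f u ->
  reps (vfield_expr hamcoef f) (kscale 4^-1 (\sum_a ham a * d a u)).
Proof.
move=> fu; rewrite kscale_sum => x Wx.
rewrite (eq_bigr (fun a => kscale 4^-1 (ham a) * d a u)); last first.
  by move=> a _; rewrite kscale_mull.
move: x Wx; apply: reps_sum => a; apply: reps_mul => //; exact: reps_pd.
Qed.

Lemma reps_lie w f u : reps f u -> reps (lie_expr hamcoef w f)
  (kscale 4^-1 (\sum_a ham a * d a u + kscale w ((\sum_a sg (par a) (d a (ham a))) * u))).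
Proof.
move=> fu; rewrite kscaleDr; apply: reps_add; first exact: reps_vfield.
have -> : kscale 4^-1 (kscale w ((\sum_a sg (par a) (d a (ham a))) * u)) =
    kscale w (\sum_a sg (par a) (d a (kscale 4^-1 (ham a)))) * u.
  rewrite kscaleA mulrC -kscaleA -!kscale_mull; congr (_ * _); congr (kscale w _).
  rewrite kscale_sum; apply: eq_bigr => a _; rewrite (kscale_d smconst_d).
  by case: (par a); rewrite /= ?kscaleNr.
apply: reps_mul => //; apply: reps_kscale; apply: reps_sum => a.
exact: (reps_sg (par a) (reps_pd a (rX a))).
Qed.

Hypothesis S_parity : forall a b x, W x ->
  has_parity (~~ (par a (+) par b)) (lb_S c a b x).
Hypothesis gam_parity : forall a x, W x -> has_parity (~~ par a) (lb_gamma c a x).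
Hypothesis theta_parity : forall x, W x -> has_parity true (lb_theta c x).
Hypothesis S_sym : forall a b x, W x ->
  lb_S c a b x = (-1) ^+ (par a && par b) * lb_S c b a x.

Let hom_LS a b : homog (~~ (spar a (+) spar b)) (LS a b).
Proof. by apply: hom_localize => // x; exact: S_parity. Qed.
Let hom_Lgam a : homog (~~ spar a) (Lgam a).
Proof. by apply: hom_localize => // x; exact: gam_parity. Qed.
Let hom_Ltheta : homog true Ltheta.
Proof. by apply: hom_localize. Qed.

Lemma LS_out a b x : ~ W x -> ev x (LS a b) = 0.
Proof. exact: ev_localize_out. Qed.

Let sym_LS a b : LS a b = sg (spar a && spar b) (LS b a).
Proof.
apply: ev_inj => x; rewrite ev_sg; case: (pselect (W x)) => Wx.
  by rewrite -(rS a b Wx) -(rS b a Wx) S_sym // -sgE.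
by rewrite !LS_out // sg0.
Qed.

Hypothesis jac_ext : forall i j k : option (crd p q),
  sg (xpar i && xpar k)
     (ext_nabla LS Lgam Ltheta k (xdeg i + xdeg j)
       (twist (xpar k) (ext LS Lgam Ltheta i j)))
  + sg (xpar k && xpar j)
     (ext_nabla LS Lgam Ltheta j (xdeg k + xdeg i)
       (twist (xpar j) (ext LS Lgam Ltheta k i)))
  + sg (xpar j && xpar i)
     (ext_nabla LS Lgam Ltheta i (xdeg j + xdeg k)
       (twist (xpar i) (ext LS Lgam Ltheta j k))) = 0.

(** [pencilw_pencilw] is applied to the functionals which evaluate one
    coefficient at the point [x]. *)
Lemma pencil_expr_square w f u x : reps f u -> W x ->
  pencil_expr c w (pencil_expr c w f) x = lie_expr hamcoef w f x.
Proof.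
move=> fu Wx.
apply: (etrans (reps_pencil w (reps_pencil w fu) Wx)).
apply: (etrans _ (esym (reps_lie w fu Wx))).
have h4 : 2^-1 * 2^-1 = 4^-1 :> R by rewrite -invfM -natrM.
rewrite (pencilw_kscale smconst_d) kscaleA h4.
apply: (etrans (ev_kscale _ _ _)); apply: (etrans _ (esym (ev_kscale _ _ _))).
congr (_ *: _).
apply/ffunP => B.
apply: (pencilw_pencilw smconst_d hom_LS hom_Lgam hom_Ltheta sym_LS jac_ext
  (psi := fun v => ev x v B)).
- by move=> v v'; rewrite (raddfD (ev x)) ffunE.
- by move=> r v; rewrite ev_kscale ffunE.
Qed.

Lemma hamcoef_parity a x : has_parity (par a) (hamcoef a x).
Proof.
rewrite /hamcoef ev_kscale => B hB; rewrite ffunE.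
have h := hom_ham hom_LS hom_Lgam hom_Ltheta a.
by rewrite (has_parity_ev x h hB) scaler0.
Qed.

(** On functions the field acts as the square of the pencil in weight 0, which
    preserves the bracket. *)
Lemma hamcoef_poisson f g u v x : reps f u -> reps g v -> W x ->
  vfield_expr hamcoef (fun_bracket_expr c f g) x =
  fun_bracket_expr c (vfield_expr hamcoef f) g x
  + fun_bracket_expr c f (vfield_expr hamcoef g) x.
Proof.
move=> fu gv Wx; rewrite (reps_vfield (reps_bracket fu gv) Wx).
rewrite (reps_bracket (reps_vfield fu) gv Wx) (reps_bracket fu (reps_vfield gv) Wx).
have E t : \sum_a ham a * d a t =
    pencil LS Lgam Ltheta 0 (pencil LS Lgam Ltheta 0 t).
  by rewrite (pencil_pencil hom_LS hom_Lgam hom_Ltheta sym_LS jac_ext) mulr0n subr0.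
have bl r s t : bracket LS (kscale r s) t = kscale r (bracket LS s t).
  rewrite /bracket kscale_sum; apply: eq_bigr => a _; rewrite kscale_sum.
  apply: eq_bigr => b _.
  have -> : twist (spar a) (kscale r s) = kscale r (twist (spar a) s).
    by case: (spar a) => //=; apply/ffunP => B;
      rewrite !(gsignE, ffunE) /GRing.scale /= sg_mulr.
  by rewrite (kscale_d smconst_d) kscale_mull kscale_mulr.
have br r s t : bracket LS s (kscale r t) = kscale r (bracket LS s t).
  rewrite /bracket kscale_sum; apply: eq_bigr => a _; rewrite kscale_sum.
  by apply: eq_bigr => b _; rewrite (kscale_d smconst_d) !kscale_mulr.
rewrite bl br -(raddfD (ev x)) -kscaleDr !E; congr (ev x (kscale _ _)).
exact: (pencil_pencil_bracket hom_LS hom_Lgam hom_Ltheta sym_LS jac_ext).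
Qed.

Lemma hamcoef_smooth a : ssmooth_on W (hamcoef a).
Proof. exact: ssmooth_ev. Qed.

End LocalPencil.

(** * Parity, powers and coordinates of superfunctions *)

Section ParityPower.
Variables (R : realType) (q : nat).
Implicit Types (u v : grassmann R q) (b c : bool) (w : R).

Lemma has_parityP b u : has_parity b u <-> gsign true u = sg b u.
Proof.
split=> [h|h A hA].
  apply/ffunP => A; have := h A; rewrite gsignE /=.
  by case: (odd #|A|); case: (b) => //= hA; rewrite ?[RHS]ffunE // hA // ?oppr0.
have := congr1 (fun v : grassmann R q => v A) h; rewrite gsignE /= => E.
have : u A *+ 2 = 0.
  rewrite mulr2n; move: hA E; case: (odd #|A|); case: (b) => //= _ E.
    by rewrite -{1}E addNr.
  by rewrite {1}E ffunE addNr.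
by move=> /eqP; rewrite mulrn_eq0 /= => /eqP.
Qed.

Lemma has_parityM b c u v :
  has_parity b u -> has_parity c v -> has_parity (b (+) c) (u * v).
Proof.
move=> /has_parityP hu /has_parityP hv; apply/has_parityP.
by rewrite rmorphM /= hu hv sg_mull sg_mulr sgsg.
Qed.

Lemma has_parityZ b (k : R) u : has_parity b u -> has_parity b (k *: u).
Proof. by move=> h A hA; rewrite ffunE h // scaler0. Qed.

Lemma has_parityD b u v : has_parity b u -> has_parity b v -> has_parity b (u + v).
Proof. by move=> hu hv A hA; rewrite ffunE hu // hv // addr0. Qed.

Lemma has_parity0 b : has_parity b (0 : grassmann R q).
Proof. by move=> A _; rewrite ffunE. Qed.

Lemma has_parity1 : has_parity false (1 : grassmann R q).
Proof. by apply/has_parityP; rewrite rmorph1. Qed.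

Lemma has_parityX n u : has_parity false u -> has_parity false (u ^+ n).
Proof.
move=> hu; elim: n => [|n IH]; first exact: has_parity1.
by rewrite exprS; exact: (has_parityM hu IH).
Qed.

Lemma gpow_parity w u : has_parity false u -> has_parity false (gpow w u).
Proof.
move=> hu; rewrite /gpow; elim/big_ind: _ => [|x y|k _].
- exact: has_parity0.
- exact: has_parityD.
apply/has_parityZ/has_parityX/has_parityD => //.
by rewrite -scaleNr; exact/has_parityZ/has_parity1.
Qed.

Lemma gpow0 u : gpow 0 u = 1.
Proof.
rewrite /gpow big_ord_recl big_ord0 mul1r fact0 invr1 mul1r subrr powRr0.
rewrite expr0 scale1r big1 ?addr0 // => k _.
by rewrite big_ord_recl sub0r oppr0 !mul0r scale0r.
Qed.

Lemma gpow1 w : gpow w (1 : grassmann R q) = 1.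
Proof.
have b1 : gbody (1 : grassmann R q) = 1 by rewrite /gbody ffunE eqxx.
rewrite /gpow b1 big_ord_recl big_ord0 fact0 invr1 mul1r mul1r powR1.
rewrite expr0 scale1r big1 ?addr0 // => k _.
by rewrite subrr expr0n scaler0.
Qed.

End ParityPower.

Lemma det1_grassmann (R : realType) (q n : nat) :
  \det (1%:M : 'M[grassmann R q]_n) = 1.
Proof.
rewrite -(map_mx1 (in_alg (grassmann R q))) det_map_mx det1.
by rewrite rmorph1.
Qed.

Section SuperCoord.
Variables (R : realType) (p q : nat).
Implicit Types (a b : crd p q) (x : 'rV[R]_p).

Lemma near_eq_pd a (f g : superfun R p q) x :
  (\forall y \near x, f y = g y) -> pd a f x = pd a g x.
Proof.
move=> fg; case: a => [k|l] /=; last by rewrite (nbhs_singleton fg).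
apply/ffunP => A; rewrite !ffunE; apply: near_eq_partial.
by apply: filterS fg => y ->.
Qed.

Lemma partialMr k (f : 'rV[R]_p -> R) (c : R) x : differentiable f x ->
  partial k (fun y => f y * c) x = partial k f x * c.
Proof.
move=> df; have -> : (fun y => f y * c) = f * cst c by [].
rewrite partialM; [|exact: df|exact: differentiable_cst].
by rewrite partial_cst mulr0 addr0.
Qed.

Lemma pd_cst a (u : grassmann R q) x :
  pd a (fun=> u) x = if a is inr l then gderiv l u else 0.
Proof.
case: a => [k|l] //=; apply/ffunP => A.
by rewrite !ffunE -[fun=> _]/(cst _) partial_cst.
Qed.

Lemma pd_coordf a b x : pd a (coordf b : superfun R p q) x = (a == b)%:R.
Proof.
case: b => [k'|l'] /=; last first.
  rewrite pd_cst; case: a => [k|l] //; rewrite gderiv_gen.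
  by rewrite (inj_eq (@inr_inj _ _)).
case: a => [k|l] /=; last by rewrite gderivZ gderiv1 scaler0.
apply/ffunP => A; rewrite ffunE.
have -> : (fun y : 'rV[R]_p => ((y 0 k')%:A : grassmann R q) A) =
    (fun y => y 0 k' * (1 : grassmann R q) A).
  by apply/funext => y; rewrite ffunE.
rewrite partialMr; last exact: differentiable_coord.
rewrite partial_coord (inj_eq (@inl_inj _ _)).
by case: (k == k'); rewrite ?mul1r // mul0r mulr0n ffunE.
Qed.

End SuperCoord.

(** * Extension of densities by zero *)

Section Charts.
Variables (R : realType) (p q : nat) (M : supermanifold R p q).
Local Notation superfun := (superfun R p q).
Implicit Types (i j k : sm_idx M) (m : sm_body M) (f g : superfun) (w : R).

Lemma chart_dom_open i : open (chart_dom i).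
Proof. by apply: sm_chart_open => //; exact: sm_dom_open. Qed.

Lemma chart_image_near i (W : set (sm_body M)) m : open W -> W `<=` sm_dom i -> W m ->
  \forall y \near sm_chart i m, (sm_chart i @` W) y.
Proof.
move=> Wo Wi Wm; apply: open_nbhs_nbhs; split; first exact: sm_chart_open.
by exists m.
Qed.

Lemma trans_near0 i j m f : sm_dom i m -> sm_dom j m ->
  (\forall y \near sm_chart j m, f y = 0) -> sm_trans i j f (sm_chart i m) = 0.
Proof.
move=> im jm f0; rewrite (@sm_trans_local _ _ _ M i j m f (fun=> 0%:A) im jm).
  by rewrite sm_trans_cst // scale0r.
by apply: filterS f0 => y ->; rewrite scale0r.
Qed.

Lemma ssmooth_coordf U a : ssmooth_on U (coordf a : superfun).
Proof.
move=> A; case: a => [k|l] /=; last exact: smooth_on_cst.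
have -> : (fun y : 'rV[R]_p => ((y 0 k)%:A : grassmann R q) A) =
    (fun y => y 0 k) * cst ((1 : grassmann R q) A).
  by apply/funext => y; rewrite ffunE.
apply: (@smooth_on_sub _ _ setT) => //.
by apply: (smooth_onM openT); [exact: smooth_on_coord|exact: smooth_on_cst].
Qed.

Lemma ssmooth_cst U (u : grassmann R q) : ssmooth_on U ((fun=> u) : superfun).
Proof. by move=> A; exact: smooth_on_cst. Qed.

(** The Jacobian of the identity is the unit matrix. *)
Lemma ber_id i m : sm_dom i m -> sm_ber i i (sm_chart i m) = 1.
Proof.
move=> im; have [_ [K [K1 _ K2]]] := sm_berP im im.
have E a b : pd a (sm_trans i i (coordf b)) (sm_chart i m) = (a == b)%:R.
  rewrite -(pd_coordf a b (sm_chart i m)); apply: near_eq_pd.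
  apply: filterS (chart_image_near (@sm_dom_open _ _ _ M i) (fun _ => id) im)
    => _ [m' im' <-].
  apply: (sm_trans_id (@sm_dom_open _ _ _ M i)) => //.
  exact: ssmooth_coordf.
have J11 : \matrix_(k, l) pd (inr k) (sm_trans i i (coordf (inr l))) (sm_chart i m)
  = 1%:M :> 'M[grassmann R q]_q.
  by apply/matrixP => k l; rewrite !mxE E (inj_eq (@inr_inj _ _)).
have J00 : \matrix_(k, l) pd (inl k) (sm_trans i i (coordf (inl l))) (sm_chart i m)
  = 1%:M :> 'M[grassmann R q]_p.
  by apply/matrixP => k l; rewrite !mxE E (inj_eq (@inl_inj _ _)).
have J01 : \matrix_(k, l) pd (inl k) (sm_trans i i (coordf (inr l))) (sm_chart i m)
  = 0 :> 'M[grassmann R q]_(p, q).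
  by apply/matrixP => k l; rewrite !mxE E.
by move: K2; rewrite J11 J00 J01 !mul0mx subr0 !det1_grassmann mulr1.
Qed.

Lemma smooth_on_local (U : set 'rV[R]_p) (g : 'rV[R]_p -> R) :
  (forall x, U x -> exists V, [/\ open V, V x & smooth_on V g]) -> smooth_on U g.
Proof. by move=> h s x /h[V [_ Vx gV]]; exact: gV. Qed.

Lemma ber_parity i j m : sm_dom i m -> sm_dom j m ->
  has_parity false (sm_ber i j (sm_chart i m)).
Proof. by move=> im jm; have [] := sm_berP im jm. Qed.

Section Extension.
Variables (i0 : sm_idx M) (Q : set 'rV[R]_p).
Hypothesis Qc : compact Q.
Hypothesis QU : Q `<=` chart_dom i0.

(** The support of the density to be extended, as a subset of the body. *)
Definition csupp : set (sm_body M) := [set m | sm_dom i0 m /\ Q (sm_chart i0 m)].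

(** The inverse of the chart is continuous, so this is the continuous image of a
    compact set in a Hausdorff space. Closedness is what makes an extension by
    zero smooth. *)
Lemma closed_csupp : closed csupp.
Proof.
apply: compact_closed; first exact: sm_hausdorff.
case: (pselect (exists m, csupp m)) => [[m1 _]|ne]; last first.
  rewrite (_ : csupp = set0); first exact: compact0.
  by apply/seteqP; split => m // cm; case: ne; exists m.
(* [g] inverts the chart; the point [m1] is its value outside the chart. *)
pose g (y : 'rV[R]_p) : sm_body M :=
  if pselect (exists m, sm_dom i0 m /\ sm_chart i0 m = y) is left h
  then projT1 (cid h) else m1.
have gE m : sm_dom i0 m -> g (sm_chart i0 m) = m.
  move=> im; rewrite /g; case: pselect => [h|[]]; last by exists m.
  case: (cid h) => m' [im' mm'] /=.
  exact: sm_chart_inj (mem_set im') (mem_set im) mm'.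
have -> : csupp = g @` Q.
  apply/seteqP; split => [m [im Qm]|m [y Qy <-]].
    by exists (sm_chart i0 m) => //; exact: gE.
  by have [m' im' my] := QU Qy; rewrite -my gE //; split => //; rewrite my.
apply: continuous_compact => //; apply: continuous_in_subspaceT => y /set_mem Qy.
have [m im <-] := QU Qy; rewrite /continuous_at gE // => N.
rewrite nbhsE => -[V [Vo Vm] VN].
have Wo : open (sm_dom i0 `&` V) by apply: openI => //; exact: sm_dom_open.
have Wi : sm_dom i0 `&` V `<=` sm_dom i0 by move=> ? [].
apply: filterS (chart_image_near Wo Wi (conj im Vm)) => _ [m' [im' Vm'] <-].
by rewrite /= gE //; exact: VN.
Qed.

Variables (w : R) (F : superfun).
Hypothesis F_smooth : ssmooth_on setT F.
Hypothesis F_supp : forall y, ~ Q y -> F y = 0.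

Definition overlap j : set 'rV[R]_p := sm_chart j @` (sm_dom i0 `&` sm_dom j).

(** Outside the overlap with the chart [i0] the density is zero; inside it is
    given by the transformation law. *)
Definition extend j : superfun := fun x =>
  if `[< overlap j x >] then dens_trans (sm_trans j i0) (sm_ber j i0) w F x else 0.

Lemma overlapP j m : sm_dom j m -> overlap j (sm_chart j m) <-> sm_dom i0 m.
Proof.
move=> jm; split=> [[m' [im' jm'] mm']|im]; last by exists m.
by rewrite -(sm_chart_inj (mem_set jm') (mem_set jm) mm').
Qed.

Lemma extend_in j m : sm_dom j m -> sm_dom i0 m ->
  extend j (sm_chart j m) = dens_trans (sm_trans j i0) (sm_ber j i0) w F (sm_chart j m).
Proof. by move=> jm im; rewrite /extend; case: asboolP => // -[]; apply/overlapP. Qed.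

Lemma F_near0 m : sm_dom i0 m -> ~ csupp m -> \forall y \near sm_chart i0 m, F y = 0.
Proof.
move=> im nm; have Qo : open (~` Q).
  by rewrite openC; apply: compact_closed => //; exact: norm_hausdorff.
have : \forall y \near sm_chart i0 m, (~` Q) y.
  by apply: open_nbhs_nbhs; split=> // Qm; apply: nm.
by apply: filterS => y; exact: F_supp.
Qed.

(** A point outside the support has a neighbourhood disjoint from it, where the
    transformation law gives zero by locality of the coordinate changes. *)
Lemma extend_near0 j m : sm_dom j m -> ~ csupp m ->
  \forall y \near sm_chart j m, extend j y = 0.
Proof.
move=> jm nm.
have Wo : open (sm_dom j `&` ~` csupp).
  by apply: openI; [exact: sm_dom_open|rewrite openC; exact: closed_csupp].
have Wj : sm_dom j `&` ~` csupp `<=` sm_dom j by move=> ? [].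
apply: filterS (chart_image_near Wo Wj (conj jm nm)) => _ [m' [jm' nm'] <-].
case: (pselect (sm_dom i0 m')) => im'.
  by rewrite extend_in // /dens_trans trans_near0 ?mul0r //; exact: F_near0.
by rewrite /extend; case: asboolP => // /overlapP -/(_ jm').
Qed.

Lemma extend_near j m : sm_dom j m -> sm_dom i0 m ->
  \forall y \near sm_chart j m,
    extend j y = dens_trans (sm_trans j i0) (sm_ber j i0) w F y.
Proof.
move=> jm im.
have Wo : open (sm_dom j `&` sm_dom i0) by apply: openI; exact: sm_dom_open.
have Wj : sm_dom j `&` sm_dom i0 `<=` sm_dom j by move=> ? [].
apply: filterS (chart_image_near Wo Wj (conj jm im)) => _ [m' [jm' im'] <-].
exact: extend_in.
Qed.

Lemma extend_smooth j : ssmooth_on (chart_dom j) (extend j).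
Proof.
move=> A; apply: smooth_on_local => _ [m jm <-].
case: (pselect (csupp m)) => [[im _]|nm].
  have Wo : open (sm_dom j `&` sm_dom i0) by apply: openI; exact: sm_dom_open.
  have Wj : sm_dom j `&` sm_dom i0 `<=` sm_dom j by move=> ? [].
  have Vo := sm_chart_open Wo Wj.
  exists (sm_chart j @` (sm_dom j `&` sm_dom i0)); split => //; first by exists m.
  have F' : ssmooth_on (sm_chart i0 @` (sm_dom j `&` sm_dom i0)) F.
    by move=> B; exact: (smooth_on_sub _ (F_smooth B)).
  have := sm_trans_smooth w Wo (fun _ => id) F' A.
  apply: smooth_on_eq Vo _ => _ [m' [jm' im'] <-].
  by rewrite extend_in.
have [V [Vo Vm V0]] : exists V, [/\ open V, V (sm_chart j m) &
    forall y, V y -> extend j y = 0].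
  have : nbhs (sm_chart j m) [set y | extend j y = 0] := extend_near0 jm nm.
  rewrite nbhsE => -[V [Vo Vm] V0].
  by exists V.
exists V; split => //.
apply: smooth_on_eq Vo _ (smooth_on_cst 0) => y Vy.
by rewrite V0 // ffunE.
Qed.

(** In the chart [i0] this is the cocycle condition for the three charts. *)
Lemma extend_compat j k m : sm_dom j m -> sm_dom k m ->
  extend j (sm_chart j m) =
  dens_trans (sm_trans j k) (sm_ber j k) w (extend k) (sm_chart j m).
Proof.
move=> jm km; case: (pselect (sm_dom i0 m)) => im.
  rewrite (extend_in jm im).
  have W3 : open (sm_dom j `&` sm_dom k `&` sm_dom i0).
    by apply: openI; [apply: openI|]; exact: sm_dom_open.
  have F' : ssmooth_on (sm_chart i0 @` (sm_dom j `&` sm_dom k `&` sm_dom i0)) F.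
    by move=> B; exact: (smooth_on_sub _ (F_smooth B)).
  rewrite -(sm_cocycle w W3 (fun _ => id) (conj (conj jm km) im) F').
  rewrite {1}/dens_trans [RHS]/dens_trans; congr (_ * _).
  apply: sm_trans_local => //.
  by apply: filterS (extend_near km im) => y ->.
have nm : ~ csupp m by move=> [].
rewrite (nbhs_singleton (extend_near0 jm nm)) /dens_trans trans_near0 ?mul0r //.
exact: extend_near0.
Qed.

Definition extension : wdensity M w :=
  WDensity extend_smooth extend_compat.

Lemma extension_chart y : chart_dom i0 y -> extension i0 y = F y.
Proof.
move=> [m im <-]; rewrite /= extend_in // /dens_trans ber_id // gpow1 mulr1.
apply: (sm_trans_id (@sm_dom_open _ _ _ M i0)) => // B.
exact: (smooth_on_sub _ (F_smooth B)).
Qed.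

Lemma extension_parity b j y : (forall z, has_parity b (F z)) ->
  chart_dom j y -> has_parity b (extension j y).
Proof.
move=> hF [m jm <-]; case: (pselect (sm_dom i0 m)) => im; last first.
  rewrite /= /extend; case: asboolP => [/overlapP -/(_ jm) //|_].
  exact: has_parity0.
rewrite /= extend_in // -[b]addbF; apply: has_parityM.
  have Wo : open (sm_dom j `&` sm_dom i0) by apply: openI; exact: sm_dom_open.
  apply: (sm_trans_parity Wo (fun _ => id) (conj jm im)) => [B|z _]; last exact: hF.
  exact: (smooth_on_sub _ (F_smooth B)).
exact/gpow_parity/ber_parity.
Qed.

End Extension.

End Charts.

(** Every superfunction of given parity near a point is, near that point, the
    only component of a global density: multiply it by a bump function and
    extend by zero. *)
Section BumpDensity.
Variables (R : realType) (p q : nat) (M : supermanifold R p q).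
Variables (i0 : sm_idx M) (m0 : sm_body M) (w0 : R) (b : bool) (f : superfun R p q).
Hypothesis im0 : sm_dom i0 m0.
Hypothesis f_smooth : ssmooth_on setT f.
Hypothesis f_parity : forall y, has_parity b (f y).

Lemma bump_density : exists psi : density M, dens_parity b psi /\
  \forall y \near sm_chart i0 m0, forall w, psi w i0 y = if w == w0 then f y else 0.
Proof.
have Uo : open (chart_dom i0) := @chart_dom_open R p q M i0.
have Ux : chart_dom i0 (sm_chart i0 m0) by exists m0.
have [e e0 QU] := cube_subset Uo Ux.
pose Q := cube (sm_chart i0 m0) e.
have Qc : compact Q by exact: cube_compact.
pose F w : superfun R p q := fun y =>
  cube_bump (sm_chart i0 m0) e y *: (if w == w0 then f y else 0).
have Fsm w : ssmooth_on setT (F w).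
  move=> A; rewrite /F; case: (w == w0).
    have -> : (fun y => (cube_bump (sm_chart i0 m0) e y *: f y) A) =
        cube_bump (sm_chart i0 m0) e * (fun y => f y A).
      by apply/funext => y; rewrite ffunE.
    exact: smooth_onM openT (smooth_bump _ _) (f_smooth A).
  have -> : (fun y => (cube_bump (sm_chart i0 m0) e y *: (0 : grassmann R q)) A) = cst 0.
    by apply/funext => y; rewrite scaler0 ffunE.
  exact: smooth_on_cst.
have Fsupp w y : ~ Q y -> F w y = 0.
  move=> nQ; rewrite /F; case: (eqVneq (cube_bump (sm_chart i0 m0) e y) 0) => [->|h].
    by rewrite scale0r.
  by case: nQ; exact: bump_supp h.
pose D w : wdensity M w := extension Qc QU w (Fsm w) (Fsupp w).
have Dfin : exists W : seq R, forall w, w \notin W ->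
    forall i x, chart_dom i x -> D w i x = 0.
  exists [:: w0] => w; rewrite inE => /negbTE ww0 j _ [m jm <-].
  have F0 y : F w y = 0 by rewrite /F ww0 scaler0.
  rewrite /D /extension /= /extend; case: asboolP => // /overlapP -/(_ jm) im.
  have Fn : \forall y \near sm_chart i0 m, F w y = 0.
    by apply: filterS (@filterT _ (nbhs (sm_chart i0 m)) _) => y _; exact: F0.
  by rewrite /dens_trans (trans_near0 jm im Fn) mul0r.
exists (@Density R p q M D Dfin); split.
  move=> w j x jx; apply: extension_parity => // z.
  rewrite /F; apply: has_parityZ; case: (w == w0) => //; exact: has_parity0.
have h1 := bump1 (sm_chart i0 m0) e0.
have h2 := open_near Uo Ux.
apply: filterS (filterI h1 h2) => y [y1 y2] w.
have E : D w i0 y = F w y by exact: extension_chart.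
apply: (etrans E).
by rewrite /F y1 scale1r.
Qed.

End BumpDensity.

(** * Brackets of densities with one component *)

Section Mono.
Variables (R : realType) (p q : nat) (V : set 'rV[R]_p).
Hypothesis Vo : open V.
Local Notation superfun := (superfun R p q).
Local Notation lexpr := (lexpr R p q).
Implicit Types (f g : superfun) (psi chi : lexpr) (u v w : R) (a b : crd p q).

(** On [V] the density is f t^u. *)
Definition is_mono u f psi : Prop :=
  forall w y, V y -> psi w y = if w == u then f y else 0.

Lemma mono_weight u v f psi : u = v -> is_mono u f psi -> is_mono v f psi.
Proof. by move=> ->. Qed.

Lemma mono_ldx a u f psi : is_mono u f psi -> is_mono u (pd a f) (ldx a psi).
Proof.
move=> h w y Vy; rewrite /ldx.
have Vn := open_near Vo Vy.
case: (eqVneq w u) => [->|wu].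
  by apply: near_eq_pd; apply: filterS Vn => z Vz; rewrite h // eqxx.
have -> : pd a (psi w) y = pd a (fun=> 0 : grassmann R q) y.
  by apply: near_eq_pd; apply: filterS Vn => z Vz; rewrite h // (negbTE wu).
by rewrite pd_cst; case: a => // l; rewrite raddf0.
Qed.

Lemma mono_lsign (c : bool) u f psi : is_mono u f psi ->
  is_mono u (fun x => gsign c (f x)) (lsign c psi).
Proof. by move=> h w y Vy; rewrite /lsign h //; case: ifP => _ //; exact: raddf0. Qed.

Lemma mono_lmul u v f g psi chi : is_mono u f psi -> is_mono v g chi ->
  is_mono (u + v) (fun x => f x * g x) (lmul psi chi).
Proof.
move=> hf hg w y Vy; rewrite /lmul.
rewrite -(@fsbig_widen _ _ _ _ [set u]) //; last first.
  by move=> s /= [_ /eqP su]; rewrite hf // (negbTE su) mul0r.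
rewrite fsbig_set1 hf // eqxx hg // subr_eq addrC.
by case: ifP => _; rewrite ?mulr0.
Qed.

Lemma mono_ldt u f psi : is_mono u f psi ->
  is_mono (u - 1) (fun x => u *: f x) (ldt psi).
Proof.
move=> h w y Vy; rewrite /ldt h // [w == _]eq_sym subr_eq [u == _]eq_sym.
by case: eqP => [->|_] //; rewrite scaler0.
Qed.

Lemma mono_lt n u f psi : is_mono u f psi -> is_mono (u + n%:R) f (lt n psi).
Proof. by move=> h w y Vy; rewrite /lt h // subr_eq. Qed.

Lemma mono_lcoef c u f psi : is_mono u f psi ->
  is_mono u (fun x => c x * f x) (lcoef c psi).
Proof. by move=> h w y Vy; rewrite /lcoef h //; case: ifP => _; rewrite ?mulr0. Qed.

Lemma mono_add u f g psi chi : is_mono u f psi -> is_mono u g chi ->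
  is_mono u (fun x => f x + g x) (fun w x => psi w x + chi w x).
Proof. by move=> hf hg w y Vy; rewrite hf // hg //; case: ifP => _; rewrite ?addr0. Qed.

Lemma mono_sum (J : finType) u (f : J -> superfun) (psi : J -> lexpr) :
  (forall j, is_mono u (f j) (psi j)) ->
  is_mono u (fun x => \sum_j f j x) (fun w x => \sum_j psi j w x).
Proof.
move=> h w y Vy; rewrite (eq_bigr _ (fun j _ => h j w y Vy)).
by case: ifP => _ //; rewrite big1.
Qed.

Variable c : lb_coefs R p q.

(** The coefficient of t^(u + v) in the bracket of f t^u and g t^v. *)
Definition bracketw u v f g : superfun := fun x =>
  \sum_a \sum_b lb_S c a b x *
    (pd b (fun y => gsign (par a) (f y)) x * pd a g x)
  + \sum_a lb_gamma c a x *
      (pd a f x * (v *: g x) + (u *: gsign (par a) (f x)) * pd a g x)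
  + lb_theta c x * ((u *: f x) * (v *: g x)).

Lemma mono_bracket u v f g psi chi : is_mono u f psi -> is_mono v g chi ->
  is_mono (u + v) (bracketw u v f g) (long_bracket_expr c psi chi).
Proof.
move=> hf hg; apply: mono_add; [apply: mono_add|].
- apply: mono_sum => a; apply: mono_sum => b; apply: mono_lcoef; apply: mono_lmul.
    exact/mono_ldx/mono_lsign.
  exact: mono_ldx.
- apply: mono_sum => a; apply: (@mono_weight (u + v - 1 + 1%:R)).
    by rewrite subrK.
  apply: mono_lt; apply: mono_lcoef; apply: mono_add.
    apply: (@mono_weight (u + (v - 1))); first by rewrite addrA.
    by apply: mono_lmul; [exact: mono_ldx|exact: mono_ldt].
  apply: (@mono_weight (u - 1 + v)); first by rewrite addrAC.
  by apply: mono_lmul; [exact/mono_ldt/mono_lsign|exact: mono_ldx].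
apply: (@mono_weight (u - 1 + (v - 1) + 2%:R)).
  by rewrite [u - 1 + _]addrACA -opprD -(natrD _ 1 1) subrK.
by apply: mono_lt; apply: mono_lcoef; apply: mono_lmul; exact: mono_ldt.
Qed.

End Mono.

(** * The Jacobi identity in a chart *)

Section LocalJacobi.
Variables (R : realType) (p q : nat) (U : set 'rV[R]_p) (c : lb_coefs R p q).
Local Notation superfun := (superfun R p q).
Local Notation W := (U°).
Local Notation K := (smfun_dring U).
Local Notation A := (grassmann_superdiff K q).
Local Notation ev := (@ev R p q U).
Local Notation kscale := (@kscale _ K q R (kap U)).
Implicit Types (k l : option (crd p q)) (F : superfun) (a b : crd p q).

Hypothesis S_smooth : forall a b, ssmooth_on W (lb_S c a b).
Hypothesis gam_smooth : forall a, ssmooth_on W (lb_gamma c a).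
Hypothesis theta_smooth : ssmooth_on W (lb_theta c).
Hypothesis S_sym : forall a b x, W x ->
  lb_S c a b x = (-1) ^+ (par a && par b) * lb_S c b a x.

(** The coordinates on the space of densities as densities: x^a has weight 0,
    and s = t^(-1) has weight -1 and coefficient 1. *)
Definition ext_coord k : superfun := if k is Some a then coordf a else fun=> 1.
Definition ext_weight k : R := - (xdeg k)%:R.

Definition ext_expr k l : superfun := fun x =>
  match k, l with
  | Some a, Some b => lb_S c a b x
  | Some a, None | None, Some a => - lb_gamma c a x
  | None, None => lb_theta c x
  end.

(** The bracket of F t^w with the coordinate [k]; see [bracketw_ext_coord]. *)
Definition ext_nabla_expr k w F : superfun := fun x =>
  match k with
  | Some a => \sum_b lb_S c a b x * pd b (fun y => gsign (par a) (F y)) x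
              + lb_gamma c a x * (w *: gsign (par a) (F x))
  | None => - (\sum_a lb_gamma c a x * pd a F x) + - (lb_theta c x * (w *: F x))
  end.

Lemma pd_one a x : pd a ((fun=> 1) : superfun) x = 0.
Proof. by rewrite pd_cst; case: a => // l; rewrite gderiv1. Qed.

Lemma sum_delta (a : crd p q) (G : crd p q -> grassmann R q) :
  \sum_b G b * (b == a)%:R = G a.
Proof.
rewrite (bigD1 a) //= eqxx mulr1 big1 ?addr0 // => b /negbTE ->.
by rewrite mulr0.
Qed.

Lemma bracketw_ext_coord w F k x :
  bracketw c w (ext_weight k) F (ext_coord k) x = ext_nabla_expr k w F x.
Proof.
case: k => [a|]; rewrite /bracketw /ext_weight /=.
  rewrite oppr0; under eq_bigr => b _.
    under eq_bigr => b' _ do rewrite pd_coordf mulrA.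
    rewrite -mulr_suml; over.
  rewrite (sum_delta a (fun b => \sum_b' lb_S c b b' x *
    pd b' (fun y => gsign (par b) (F y)) x)).
  rewrite scale0r !mulr0 addr0; congr (_ + _).
  under eq_bigr => b _ do rewrite mulr0 add0r pd_coordf mulrA.
  exact: sum_delta.
rewrite [X in X + _ + _]big1 ?add0r => [|a _]; last first.
  by rewrite big1 // => b _; rewrite pd_one !mulr0.
congr (_ + _).
  rewrite -sumrN; apply: eq_bigr => a _.
  by rewrite pd_one mulr0 addr0 scaleNr scale1r !mulrN mulr1.
by rewrite scaleNr scale1r !mulrN mulr1.
Qed.

Lemma gsign_coordf (e : bool) a x :
  gsign e (coordf a x : grassmann R q) = sg (e && par a) (coordf a x).
Proof.
case: e; last by rewrite gsign0.
case: a => [k|l] /=; last exact: gsign_gen.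
exact: (proj1 (has_parityP _ _) (has_parityZ (x 0 k) (@has_parity1 R q))).
Qed.

Lemma pd_gsign_coordf (e : bool) a b x :
  pd b (fun y => gsign e (coordf a y : grassmann R q)) x = sg (e && par a) (b == a)%:R.
Proof.
have -> : (fun y => gsign e (coordf a y : grassmann R q)) =
    (fun y => sg (e && par a) (coordf a y)).
  by apply/funext => y; exact: gsign_coordf.
case: a => [k|l].
  by rewrite -(pd_coordf b (inl k) x) andbF.
rewrite -(pd_coordf b (inr l) x) /= !pd_cst andbT.
case: b => [k|l']; first by rewrite sg0.
by rewrite sg_additive.
Qed.

(** The brackets of the coordinates are the entries of the matrix. *)
Lemma ext_nabla_expr_ext_coord k l x : W x ->
  ext_nabla_expr l (ext_weight k) (ext_coord k) x = ext_expr k l x.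
Proof.
move=> Wx; case: l k => [a|] [b|] /=; rewrite /ext_weight /=.
- rewrite oppr0 scale0r mulr0 addr0.
  under eq_bigr => b' _ do rewrite pd_gsign_coordf sg_mulr -sg_mull.
  rewrite (sum_delta b (fun b' => sg (par a && par b) (lb_S c a b' x))) sgE andbC.
  by rewrite -S_sym.
- rewrite big1 ?add0r => [|b' _]; last first.
    by rewrite gsign1 pd_one mulr0.
  by rewrite gsign1 scaleNr scale1r mulrN mulr1.
- rewrite oppr0 scale0r mulr0 oppr0 addr0; congr (- _).
  by under eq_bigr => b' _ do rewrite pd_coordf; exact: sum_delta.
- rewrite big1 ?oppr0 ?add0r => [|b' _]; last by rewrite pd_one mulr0.
  by rewrite scaleNr scale1r mulrN mulr1 opprK.
Qed.

Local Notation LS := (LS U c).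
Local Notation Lgam := (Lgam U c).
Local Notation Ltheta := (Ltheta U c).

Lemma reps_ext_expr k l : reps (ext_expr k l) (ext LS Lgam Ltheta k l).
Proof.
have hN F (t : A) : reps F t -> reps (fun x => - F x) (- t).
  by move=> Ft x Wx; rewrite (Ft x Wx); exact: (esym (raddfN _ _)).
case: k l => [a|] [b|] /=; rewrite /ext_expr.
- exact: reps_localize.
- by apply: hN; exact: reps_localize.
- by apply: hN; exact: reps_localize.
- exact: reps_localize.
Qed.

Lemma reps_ext_nabla_expr k n F (t : A) : reps F t ->
  reps (ext_nabla_expr k (- n%:R) F) (ext_nabla LS Lgam Ltheta k n (twist (xpar k) t)).
Proof.
have hN G (s : A) : reps G s -> reps (fun x => - G x) (- s).
  by move=> Ft x Wx; rewrite (Ft x Wx); exact: (esym (raddfN _ _)).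
have scn (s : A) : kscale (- n%:R) s = - (s *+ n) by rewrite kscaleNl kscale_nat.
move=> Ft; case: k => [a|] /=.
  rewrite -mulrnAr -mulrN -scn; apply: reps_add.
    apply: reps_sum => b; apply: reps_mul; first exact: reps_localize.
    by apply: reps_pd; exact: reps_gsign.
  apply: reps_mul; first exact: reps_localize.
  by apply: reps_kscale; exact: reps_gsign.
have -> : Ltheta * t *+ n = - (Ltheta * kscale (- n%:R) t).
  by rewrite scn mulrN opprK mulrnAr.
apply: reps_add; apply: hN.
  apply: reps_sum => b; apply: reps_mul; first exact: reps_localize.
  exact: reps_pd.
apply: reps_mul; first exact: reps_localize.
exact: reps_kscale.
Qed.

Lemma ev_ext_nabla_expr_out k n (t : A) x : ~ W x ->
  ev x (ext_nabla LS Lgam Ltheta k n t) = 0.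
Proof.
move=> Wx.
have z0 h (s : A) : ev x (localize U h * s) = 0.
  apply: (etrans (rmorphM _ _ _)).
  apply: (etrans (congr1 (fun z => z * ev x s) (ev_localize_out h Wx))).
  exact: mul0r.
have zs (J : finType) (G : J -> A) : (forall j, ev x (G j) = 0) ->
    ev x (\sum_j G j) = 0.
  move=> G0; apply: (etrans (raddf_sum _ _ _ _)).
  by apply: big1 => j _; exact: G0.
case: k => [a|] /=.
  rewrite -mulrnAr; apply: (etrans (raddfB _ _ _)).
  apply: (etrans (congr2 (fun y z => y - z) (zs _ _ (fun b => z0 _ _)) (z0 _ _))).
  exact: subrr.
rewrite -mulrnAr; apply: (etrans (raddfD _ _ _)).
have zN : ev x (- \sum_a Lgam a * sd_d A a t) = 0.
  apply: (etrans (raddfN _ _)).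
  apply: (etrans (congr1 -%R (zs _ _ (fun b => z0 _ _)))); exact: oppr0.
apply: (etrans (congr2 (fun y z => y + z) zN (z0 _ _))); exact: addr0.
Qed.

Lemma ext_coord_smooth k V : ssmooth_on V (ext_coord k).
Proof. by case: k => [a|]; [exact: ssmooth_coordf|exact: ssmooth_cst]. Qed.

Lemma ext_coord_parity k y : has_parity (xpar k) (ext_coord k y).
Proof.
case: k => [[k|l]|] /=; [|rewrite /=|exact: has_parity1].
  exact/has_parityZ/has_parity1.
by apply/has_parityP; exact: gsign_gen.
Qed.

End LocalJacobi.

Section ChartJacobi.
Variables (R : realType) (p q : nat) (M : supermanifold R p q).
Variables (B : long_bracket M) (hJ : jacobi B) (i : sm_idx M).
Local Notation U := (chart_dom i).
Local Notation c := (lb_coef B i).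
Local Notation ev := (@ev R p q U).
Local Notation LS := (LS U c).
Local Notation Lgam := (Lgam U c).
Local Notation Ltheta := (Ltheta U c).
Implicit Types (k l r : option (crd p q)).

Lemma chart_interior : U° = U.
Proof. exact: (interior_id _).1 (@chart_dom_open R p q M i). Qed.

Let smooth_S a b : ssmooth_on U° (lb_S c a b).
Proof. by rewrite chart_interior; exact: lb_S_smooth. Qed.
Let smooth_gam a : ssmooth_on U° (lb_gamma c a).
Proof. by rewrite chart_interior; exact: lb_gamma_smooth. Qed.
Let smooth_theta : ssmooth_on U° (lb_theta c).
Proof. by rewrite chart_interior; exact: lb_theta_smooth. Qed.
Let Ssym a b x : U° x -> lb_S c a b x = (-1) ^+ (par a && par b) * lb_S c b a x.
Proof. by rewrite chart_interior; exact: lb_S_sym. Qed.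

(** The bracket is local. Hence the value at [x] of an iterated bracket of
    densities which agree with coordinates near [x] is that of the
    coordinates. *)
Lemma iterated_bracket (V : set 'rV[R]_p) (ak al ar : density M) k l r x :
  open V -> V `<=` U ->
  is_mono V (ext_weight R k) (ext_coord k) (dens_lexpr ak i) ->
  is_mono V (ext_weight R l) (ext_coord l) (dens_lexpr al i) ->
  is_mono V (ext_weight R r) (ext_coord r) (dens_lexpr ar i) -> V x ->
  B (B ak al) ar (ext_weight R k + ext_weight R l + ext_weight R r) i x =
  ev x (ext_nabla LS Lgam Ltheta r (xdeg k + xdeg l)
    (twist (xpar r) (ext LS Lgam Ltheta k l))).
Proof.
move=> Vo VU hk hl hr Vx.
have h2 : is_mono V (ext_weight R k + ext_weight R l) (ext_expr c k l)
    (dens_lexpr (B ak al) i).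
  move=> w y Vy; apply: (etrans (lb_brE B ak al w (VU y Vy))).
  rewrite (mono_bracket Vo c hk hl) //; case: ifP => // _.
  rewrite bracketw_ext_coord; apply: (ext_nabla_expr_ext_coord Ssym).
  by rewrite chart_interior; exact: VU.
rewrite (lb_brE B (B ak al) ar _ (VU x Vx)) (mono_bracket Vo c h2 hr) // eqxx.
rewrite bracketw_ext_coord.
have -> : ext_weight R k + ext_weight R l = - (xdeg k + xdeg l)%:R.
  by rewrite /ext_weight natrD opprD.
apply: (reps_ext_nabla_expr smooth_S smooth_gam smooth_theta); last first.
  by rewrite chart_interior; exact: VU.
exact: (reps_ext_expr smooth_S smooth_gam smooth_theta).
Qed.

(** At a point of the chart the identity is that of the densities which extend
    the three coordinates from a neighbourhood of the point; outside the chart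
    all terms are 0. *)
Lemma chart_jacobi k l r :
  sg (xpar k && xpar r)
     (ext_nabla LS Lgam Ltheta r (xdeg k + xdeg l)
       (twist (xpar r) (ext LS Lgam Ltheta k l)))
  + sg (xpar r && xpar l)
     (ext_nabla LS Lgam Ltheta l (xdeg r + xdeg k)
       (twist (xpar l) (ext LS Lgam Ltheta r k)))
  + sg (xpar l && xpar k)
     (ext_nabla LS Lgam Ltheta k (xdeg l + xdeg r)
       (twist (xpar k) (ext LS Lgam Ltheta l r))) = 0.
Proof.
apply: ev_inj => x; apply: (etrans _ (esym (raddf0 _))).
apply: (etrans (raddfD _ _ _)).
apply: (etrans (congr1 (fun z => z + _) (raddfD (ev x) _ _))).
apply: (etrans (congr2 (fun y z => y + z)
  (congr2 (fun y z => y + z) (ev_sg _ _ _) (ev_sg _ _ _)) (ev_sg _ _ _))).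
case: (pselect (U x)) => [[m im mx]|nU]; last first.
  have nW : ~ U° x by rewrite chart_interior.
  by rewrite !(@ev_ext_nabla_expr_out R p q U c _ _ _ x nW) !sg0 !addr0.
have bd (t : option (crd p q)) := bump_density (ext_weight R t) im
  (@ext_coord_smooth R p q t setT) (@ext_coord_parity R p q t).
have [ak [pk nk]] := bd k; have [al [pl nl]] := bd l; have [ar [pr nr]] := bd r.
have nU := open_near (@chart_dom_open R p q M i)
  (ex_intro2 _ _ m im erefl : U (sm_chart i m)).
have [V [Vo Vm VN]] : exists V, [/\ open V, V (sm_chart i m) & forall y, V y ->
    (forall w, ak w i y = if w == ext_weight R k then ext_coord k y else 0) /\
    (forall w, al w i y = if w == ext_weight R l then ext_coord l y else 0) /\
    (forall w, ar w i y = if w == ext_weight R r then ext_coord r y else 0) /\ U y].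
  eexists (interior _); split; first exact: open_interior.
    exact: (filterI nk (filterI nl (filterI nr nU))).
  by move=> y /interior_subset.
have VU : V `<=` U by move=> y /VN[_ [_ []]].
have hk : is_mono V (ext_weight R k) (ext_coord k) (dens_lexpr ak i).
  by move=> w y /VN[h _]; exact: h.
have hl : is_mono V (ext_weight R l) (ext_coord l) (dens_lexpr al i).
  by move=> w y /VN[_ [h _]]; exact: h.
have hr : is_mono V (ext_weight R r) (ext_coord r) (dens_lexpr ar i).
  by move=> w y /VN[_ [_ [h _]]]; exact: h.
rewrite mx in Vm.
rewrite -(iterated_bracket Vo VU hk hl hr Vm) -(iterated_bracket Vo VU hr hk hl Vm).
rewrite -(iterated_bracket Vo VU hl hr hk Vm).
have := hJ pk pl pr (ext_weight R k + ext_weight R l + ext_weight R r) (VU x Vm).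
rewrite !sgE => <-; congr (_ + _ * B _ _ _ _ _ + _ * B _ _ _ _ _).
  by rewrite -addrA addrC.
by rewrite addrC addrA.
Qed.

End ChartJacobi.

(** * The vector field of the squared pencil *)

Section HamiltonianField.
Variables (R : realType) (p q : nat) (M : supermanifold R p q).
Variables (B : long_bracket M) (Delta : forall w : R, wdensity M w -> wdensity M w).
Arguments Delta : clear implicits.
Hypothesis hDelta : canonical_pencil B Delta.
Hypothesis hJ : jacobi B.
Implicit Types (i : sm_idx M) (x : 'rV[R]_p) (w : R).

(** Densities of weight 0 are functions, because a zeroth power of the
    Berezinian is 1. *)
Definition function_wdensity (f : function M) : wdensity M 0.
Proof.
apply: (@WDensity R p q M 0 f (@fun_smooth _ _ _ _ f)) => i j m im jm.
by rewrite /dens_trans gpow0 mulr1; exact: fun_compat.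
Defined.

Definition wdensity_function (psi : wdensity M 0) : function M.
Proof.
apply: (@Function R p q M psi (@wd_smooth _ _ _ _ _ psi)) => i j m im jm.
by apply: (etrans (wd_compat psi im jm)); rewrite /dens_trans gpow0 mulr1.
Defined.

Definition ham_coef i a : superfun R p q := hamcoef (chart_dom i) (lb_coef B i) a.

Let smooth_S i a b : ssmooth_on (chart_dom i)° (lb_S (lb_coef B i) a b).
Proof. by rewrite chart_interior; exact: lb_S_smooth. Qed.
Let smooth_gam i a : ssmooth_on (chart_dom i)° (lb_gamma (lb_coef B i) a).
Proof. by rewrite chart_interior; exact: lb_gamma_smooth. Qed.
Let smooth_theta i : ssmooth_on (chart_dom i)° (lb_theta (lb_coef B i)).
Proof. by rewrite chart_interior; exact: lb_theta_smooth. Qed.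
Let par_S i a b x : (chart_dom i)° x ->
  has_parity (~~ (par a (+) par b)) (lb_S (lb_coef B i) a b x).
Proof. by rewrite chart_interior; exact: lb_S_parity. Qed.
Let par_gam i a x : (chart_dom i)° x -> has_parity (~~ par a) (lb_gamma (lb_coef B i) a x).
Proof. by rewrite chart_interior; exact: lb_gamma_parity. Qed.
Let par_theta i x : (chart_dom i)° x -> has_parity true (lb_theta (lb_coef B i) x).
Proof. by rewrite chart_interior; exact: lb_theta_parity. Qed.
Let sym_S i a b x : (chart_dom i)° x -> lb_S (lb_coef B i) a b x =
  (-1) ^+ (par a && par b) * lb_S (lb_coef B i) b a x.
Proof. by rewrite chart_interior; exact: lb_S_sym. Qed.

Let reps_pencil_chart i w f u := @reps_pencil _ _ _ (chart_dom i) (lb_coef B i)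
  (@smooth_S i) (@smooth_gam i) (@smooth_theta i) w f u.

Let in_chart i x : chart_dom i x -> (chart_dom i)° x.
Proof. by rewrite chart_interior. Qed.

Let reps_wdensity w (psi : wdensity M w) i :
  reps (psi i) (localize (chart_dom i) (psi i)).
Proof. by apply: reps_localize; rewrite chart_interior; exact: wd_smooth. Qed.

Lemma Delta_square w (psi : wdensity M w) i x : chart_dom i x ->
  Delta w (Delta w psi) i x = lie_expr (ham_coef i) w (psi i) x.
Proof.
move=> ix; have Wx := in_chart ix.
have ru := @reps_wdensity w psi i.
have rD : reps (Delta w psi i) _ := fun y Wy =>
  etrans (hDelta psi (interior_subset Wy)) (reps_pencil_chart w ru Wy).
apply: (etrans (hDelta (Delta w psi) ix)).
apply: (etrans (reps_pencil_chart w rD Wx)).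
apply: (etrans (esym (reps_pencil_chart w (reps_pencil_chart w ru) Wx))).
exact: (pencil_expr_square (@smooth_S i) (@smooth_gam i) (@smooth_theta i)
  (@par_S i) (@par_gam i) (@par_theta i) (@sym_S i)
  (chart_jacobi hJ i) w ru Wx).
Qed.

(** Defining the action through [Delta] saves the transformation law of the
    coefficients of the field. *)
Definition ham_act (f : function M) : function M :=
  wdensity_function (Delta 0 (Delta 0 (function_wdensity f))).

Lemma ham_actE (f : function M) i x : chart_dom i x ->
  ham_act f i x = vfield_expr (ham_coef i) (f i) x.
Proof.
move=> ix; apply: (etrans (Delta_square (function_wdensity f) ix)).
by rewrite /lie_expr scale0r mul0r addr0.
Qed.

Lemma ham_coef_smooth i a : ssmooth_on (chart_dom i) (ham_coef i a).
Proof. by rewrite -{1}chart_interior; exact: hamcoef_smooth. Qed.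

Lemma ham_coef_parity i a x : chart_dom i x -> has_parity (par a) (ham_coef i a x).
Proof.
move=> _; exact: (hamcoef_parity (@smooth_S i) (@smooth_gam i) (@smooth_theta i)
  (@par_S i) (@par_gam i) (@par_theta i)).
Qed.

Definition ham_field : even_vfield M :=
  EvenVfield ham_coef_smooth ham_coef_parity ham_actE.

Lemma ham_field_poisson : poisson B ham_field.
Proof.
move=> f g i x ix; have Wx := in_chart ix.
have ru := @reps_wdensity 0 (function_wdensity f) i.
have rv := @reps_wdensity 0 (function_wdensity g) i.
have rXf : reps (ham_act f i) _ := fun y Wy =>
  etrans (ham_actE f (interior_subset Wy)) (reps_vfield _ ru Wy).
have rXg : reps (ham_act g i) _ := fun y Wy =>
  etrans (ham_actE g (interior_subset Wy)) (reps_vfield _ rv Wy).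
apply: (etrans (hamcoef_poisson (@smooth_S i) (@smooth_gam i) (@smooth_theta i)
  (@par_S i) (@par_gam i) (@par_theta i) (@sym_S i)
  (chart_jacobi hJ i) ru rv Wx)).
congr (_ + _).
  apply: (etrans (reps_bracket (@smooth_S i) (reps_vfield _ ru) rv Wx)).
  exact: (esym (reps_bracket (@smooth_S i) rXf rv Wx)).
apply: (etrans (reps_bracket (@smooth_S i) ru (reps_vfield _ rv) Wx)).
exact: (esym (reps_bracket (@smooth_S i) ru rXg Wx)).
Qed.

End HamiltonianField.

Theorem theorem3p4 (R : realType) (p q : nat) (M : supermanifold R p q)
    (B : long_bracket M) (Delta : forall w : R, wdensity M w -> wdensity M w)
    (hDelta : canonical_pencil B Delta) (hJ : jacobi B) :
  exists X : even_vfield M,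
    poisson B X /\
    forall (w : R) (psi : wdensity M w) (i : sm_idx M) (x : 'rV[R]_p),
      chart_dom i x ->
      Delta w (Delta w psi) i x = lie_expr (vf_coef X i) w (psi i) x.
Proof.
exists (ham_field hDelta hJ); split; first exact: ham_field_poisson.
by move=> w psi i x ix; exact: (Delta_square hDelta hJ).
Qed.
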